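(* Let $l\ge 1$ be an integer and let $\epsilon_{\mathrm b}\in\mathbb{C}\setminus(-\infty,0]$ with $\operatorname{Im}\epsilon_{\mathrm b}\ge 0$ be fixed. Let $Q_{\mathrm{abs},2l}$ be the normalized electric multipole absorption cross section of a homogeneous passive sphere of permittivity $\epsilon$ and electrical size $k_0a>0$, and let $\epsilon_{\mathrm p,l}(k_0a)$ be the plasmonic multipole singularity, both as defined in the context. Then: (i) For small $k_0a$, $$Q_{\mathrm{abs},2l}\sim(k_0a)^{2l-1}\,\frac{2(l+1)(2l+1)}{l^2((2l-1)!!)^2}\,\frac{|\epsilon_{\mathrm b}|^{l+1}}{\operatorname{Re}\sqrt{\epsilon_{\mathrm b}}}\,\frac{\operatorname{Im}\epsilon}{|\epsilon-\epsilon_{\mathrm p,l}(k_0a)|^2}.$$ (ii) The right-hand side of (i) is, as a function of $\epsilon$, of the form of a constant times $F(\epsilon)=\operatorname{Im}\{\epsilon\}/|\epsilon-\epsilon_{\mathrm p,l}(k_0a)|^2$, and $F$ has a local maximum for $\operatorname{Im}\epsilon>0$ at $$\epsilon_{\mathrm{opt},l}(k_0a)=\epsilon_{\mathrm p,l}(k_0a)^*.$$ Hence $\epsilon_{\mathrm{opt},l}(k_0a)=\epsilon_{\mathrm p,l}(k_0a)^*$ gives an approximation of the optimal permittivity for multipole absorption (i.e. of the permittivity $\epsilon$ maximizing $Q_{\mathrm{abs},2l}$) of small homogeneous dielectric spheres embedded in lossy media. (iii) For the dipole ($l=1$) and the quadrupole ($l=2$) this optimal permittivity is given by $$\epsilon_{\mathrm{opt},1}(k_0a)=-2\epsilon_{\mathrm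 b}^*-\frac{12}{5}\epsilon_{\mathrm b}^{*2}(k_0a)^2+2\mathrm i\,\epsilon_{\mathrm b}^{*2}\sqrt{\epsilon_{\mathrm b}^*}\,(k_0a)^3+\mathcal{O}\{(k_0a)^4\},$$ $$\epsilon_{\mathrm{opt},2}(k_0a)=-\frac32\epsilon_{\mathrm b}^*-\frac{5}{14}\epsilon_{\mathrm b}^{*2}(k_0a)^2-\frac{65}{392}\epsilon_{\mathrm b}^{*3}(k_0a)^4+\frac{\mathrm i}{12}\epsilon_{\mathrm b}^{*3}\sqrt{\epsilon_{\mathrm b}^*}\,(k_0a)^5+\mathcal{O}\{(k_0a)^6\}.$$
   Context: Square roots are principal; $z^*$ is the complex conjugate; $\sim$ denotes asymptotic approximation as $k_0a\to0$ and $\mathcal O$ is the usual order symbol. $\mathrm{j}_l$ is the spherical Bessel function, $\mathrm{h}^{(1)}_l$ the spherical Hankel function of the first kind, $\psi_l(z)=z\,\mathrm{j}_l(z)$, $\xi_l(z)=z\,\mathrm{h}^{(1)}_l(z)$, primes denote derivatives with respect to the argument. Here $k_0$ is the vacuum wavenumber, $a$ the radius, $k=k_0\sqrt{\epsilon}$, $k_{\mathrm b}=k_0\sqrt{\epsilon_{\mathrm b}}$, $m=\sqrt{\epsilon}/\sqrt{\epsilon_{\mathrm b}}$. Passive means $\operatorname{Im}\epsilon\ge0$, and $\epsilon$ is assumed not to lie on the branch cut of the square root (the negative real axis). The electric Mie coefficient (interior field) is $$r_{2l}=\frac{-\mathrm i\,m}{\xi_l(k_{\mathrm b}a)\psi_l'(ka)-m\,\psi_l(ka)\xi_l'(k_{\mathrm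 b}a)},$$ and the normalized absorption cross section (cross section divided by $\pi a^2$) is $$Q_{\mathrm{abs},2l}=\frac{2}{\operatorname{Re}\sqrt{\epsilon_{\mathrm b}}}\operatorname{Im}\left\{\sqrt{\epsilon}\left[(l+1)\,\mathrm{j}_l(ka)\,\mathrm{j}_{l-1}(ka)^*+l\,\mathrm{j}_{l+2}(ka)\,\mathrm{j}_{l+1}(ka)^*\right]\right\}|r_{2l}|^2 .$$ The plasmonic multipole singularity: with $x=z\sqrt{\epsilon}$, $x_{\mathrm b}=z\sqrt{\epsilon_{\mathrm b}}$ the function $$f_l(\epsilon,z)=\frac{2l+1}{l}\left(\mathrm i\,x_{\mathrm b}^{l}\xi_l(x_{\mathrm b})\,x^{-l}\psi_l'(x)\,\epsilon_{\mathrm b}-\mathrm i\,x^{-l-1}\psi_l(x)\,x_{\mathrm b}^{l+1}\xi_l'(x_{\mathrm b})\,\epsilon\right)$$ extends analytically to $\mathbb{C}^2$, and $r_{2l}=\frac{2l+1}{l}\frac{(\sqrt{\epsilon_{\mathrm b}})^{l+1}}{(\sqrt\epsilon)^{l-1}}\frac{1}{f_l(\epsilon,k_0a)}$. By the Weierstrass preparation theorem, near $(\epsilon,z)=(-\frac{l+1}{l}\epsilon_{\mathrm b},0)$ there is a unique factorization $f_l(\epsilon,z)=\alpha(\epsilon,z)\,(\epsilon-\epsilon_{\mathrm p,l}(z))$ with $\alpha$ and $\epsilon_{\mathrm p,l}$ analytic, $\alpha(\epsilon,0)=1$ and $\epsilon_{\mathrm p,l}(0)=-\frac{l+1}{l}\epsilon_{\mathrm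 b}$; the pole $\epsilon_{\mathrm p,l}(k_0a)$ of $r_{2l}$ so defined is the plasmonic multipole singularity. *)

(* Defs.v *)
From Stdlib Require Export Reals Factorial.
From Coquelicot Require Export Coquelicot.

Local Open Scope C_scope.

Definition off_cut (z : C) : Prop := ~ (Im z = 0%R /\ (Re z <= 0)%R).

(* Principal branch: nonnegative real part; on the cut the root is taken in
   the closed upper half-plane. *)
Definition Csqrt (z : C) : C :=
  (sqrt ((Cmod z + Re z) / 2),
   ((if Rle_dec 0 (Im z) then 1 else -1) * sqrt ((Cmod z - Re z) / 2))%R).

Definition CSeries (a : nat -> C) : C :=
  (Series (fun n => Re (a n)), Series (fun n => Im (a n))).

(* odd_dfact n = (2n-1)!!, with (-1)!! = 1 *)
Fixpoint odd_dfact (n : nat) : nat :=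
  match n with
  | O => 1
  | S p => (2 * p + 1) * odd_dfact p
  end.

(* DLMF 10.53.1:
   j_l(z) = z^l sum_{k>=0} (-z^2/2)^k / (k! (2l+2k+1)!!) *)
Definition sph_j (l : nat) (z : C) : C :=
  z ^ l * CSeries (fun k =>
    (- (z ^ 2 / 2)) ^ k / RtoC (INR (fact k * odd_dfact (l + k + 1)))).

(* DLMF 10.53.2:
   y_l(z) = - z^(-l-1) sum_{k=0}^{l} (2l-2k-1)!! (z^2/2)^k / k!
     + (-1)^(l+1) z^(-l-1) sum_{k>=l+1} (-z^2/2)^k / (k! (2k-2l-1)!!),
   the second sum being reindexed by k = l+1+i. *)
Definition sph_y (l : nat) (z : C) : C :=
  - (sum_n (fun k =>
       RtoC (INR (odd_dfact (l - k)) / INR (fact k)) * (z ^ 2 / 2) ^ k) l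
     / z ^ (l + 1))
  + (- (1)) ^ (l + 1) / z ^ (l + 1) * CSeries (fun i =>
      (- (z ^ 2 / 2)) ^ (l + 1 + i)
      / RtoC (INR (fact (l + 1 + i) * odd_dfact (i + 1)))).

Definition sph_h1 (l : nat) (z : C) : C := sph_j l z + Ci * sph_y l z.

Definition psi (l : nat) (z : C) : C := z * sph_j l z.
Definition xi (l : nat) (z : C) : C := z * sph_h1 l z.

(* [eb] is the background permittivity, [eps] that of the sphere, and
   [k0a] > 0 its electrical size; k a = k0a sqrt(eps), k_b a = k0a sqrt(eb). *)
Definition mie_r2 (l : nat) (eb : C) (k0a : R) (eps : C) : C :=
  let m := Csqrt eps / Csqrt eb in
  let ka := RtoC k0a * Csqrt eps in
  let kba := RtoC k0a * Csqrt eb in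
  (- Ci * m)
  / (xi l kba * C_derive (psi l) ka - m * psi l ka * C_derive (xi l) kba).

Definition Qabs (l : nat) (eb : C) (k0a : R) (eps : C) : R :=
  let ka := RtoC k0a * Csqrt eps in
  (2 / Re (Csqrt eb)
   * Im (Csqrt eps
         * (RtoC (INR l + 1) * sph_j l ka * Cconj (sph_j (l - 1) ka)
            + RtoC (INR l) * sph_j (l + 2) ka * Cconj (sph_j (l + 1) ka)))
   * Cmod (mie_r2 l eb k0a eps) ^ 2)%R.

Definition passive (eps : C) : Prop := (0 <= Im eps)%R /\ off_cut eps.

(* Total division makes this formula meaningful only for z <> 0, eps <> 0. *)
Definition mie_denom (l : nat) (eb eps z : C) : C :=
  let x := z * Csqrt eps in
  let xb := z * Csqrt eb in
  RtoC ((2 * INR l + 1) / INR l)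
  * (Ci * xb ^ l * xi l xb * / x ^ l * C_derive (psi l) x * eb
     - Ci * / x ^ (l + 1) * psi l x * xb ^ (l + 1) * C_derive (xi l) xb * eps).

Definition C2_NormedModule : NormedModule C_AbsRing :=
  prod_NormedModule C_AbsRing C_NormedModule C_NormedModule.

(* Analyticity is complex differentiability on a neighbourhood. *)
Definition analytic_at (f : C -> C) (z : C) : Prop :=
  locally (T := C_UniformSpace) z
    (fun w => ex_derive (K := C_AbsRing) (V := C_NormedModule) f w).

Definition analytic2_at (f : C * C -> C) (p : C * C) : Prop :=
  locally (T := C2_NormedModule) p
    (fun q => ex_filterdiff (U := C2_NormedModule) (V := C_NormedModule)
                f (locally q)).

(* [f] is the analytic extension to C^2 of (eps, z) |-> f_l(eps, z). *)
Definition is_mie_denom_extension (l : nat) (eb : C) (f : C * C -> C) : Prop :=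
  (forall p, analytic2_at f p) /\
  (forall eps z : C, eps <> 0 -> z <> 0 -> f (eps, z) = mie_denom l eb eps z).

Definition static_pole (l : nat) (eb : C) : C :=
  - (RtoC ((INR l + 1) / INR l) * eb).

(* The factorization f(eps,z) = alpha(eps,z) (eps - ep(z)) near
   (static_pole, 0), which determines the germ of [ep] at 0. *)
Definition is_plasmonic_singularity
    (l : nat) (eb : C) (f : C * C -> C) (ep : C -> C) : Prop :=
  exists alpha : C * C -> C,
    let p0 := (static_pole l eb, RtoC 0) in
    analytic2_at alpha p0 /\
    analytic_at ep 0 /\
    locally (T := C_UniformSpace) (static_pole l eb)
      (fun eps => alpha (eps, RtoC 0) = 1) /\
    ep 0 = static_pole l eb /\
    locally (T := C2_NormedModule) p0
      (fun p => f p = alpha p * (fst p - ep (snd p))).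

Definition abs_profile (p eps : C) : R := (Im eps / Cmod (eps - p) ^ 2)%R.

Definition Qabs_approx (l : nat) (eb p : C) (k0a : R) (eps : C) : R :=
  (k0a ^ (2 * l - 1)
   * (2 * (INR l + 1) * (2 * INR l + 1)
      / (INR l ^ 2 * INR (odd_dfact l) ^ 2))
   * (Cmod eb ^ (l + 1) / Re (Csqrt eb))
   * (Im eps / Cmod (eps - p) ^ 2))%R.

Definition eps_opt (ep : C -> C) (k0a : R) : C := Cconj (ep (RtoC k0a)).

Definition is_local_max_on (D : C -> Prop) (g : C -> R) (x : C) : Prop :=
  D x /\
  locally (T := C_UniformSpace) x (fun y => D y -> (g y <= g x)%R).

Definition is_max_on (D : C -> Prop) (g : C -> R) (x : C) : Prop :=
  D x /\ forall y, D y -> (g y <= g x)%R.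

Definition bigO_pow (g : R -> C) (n : nat) : Prop :=
  exists M : R, at_right 0 (fun t => (Cmod (g t) <= M * t ^ n)%R).

(* Main.v *)
(** The power series of the spherical Bessel functions turn the denominator of
the Mie coefficient into
[denomF e = (e - e0) + t R(e) + i xb^(2l+1) G(e)], with [t = k0a],
[e0 = static_pole] and [R], [G] bounded. Near [e0] the Weierstrass factor
[alpha] is close to 1, and away from [e0] both [denomF] and [e - ep(t)] are
close to [e - e0]; hence [denomF ~ e - ep(t)] uniformly for bounded [e]. The
absorbed power in the numerator is a function with real Taylor coefficients, so
its imaginary part is proportional to [Im e] up to a relative error [O(t)],
which gives (i) uniformly. In (ii), [Im e / |e - p|^2] has its maximum
[1 / (4 |Im p|)] at the conjugate of [p] as soon as [Im p < 0], and a
near-maximizer in the relative sense lies within a small multiple of [|Im p|]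
of it; for real [eb], [Im p < 0] comes from the radiative term [G]. Finally
[denomF (ep t) = 0] with [denomF] expanded to the order of (iii) determines the
expansion of the pole by successive substitution. *)

From Stdlib Require Import Lra Lia Psatz ClassicalEpsilon.
Require Import Defs.
Local Open Scope C_scope.

(** The obstacle is the width of the resonance. In a lossless background [Im p] is of order
    [t^(2l+1)], far below the error [O(t)] of the static limit, so an absolute comparison says
    nothing where the profile peaks. Every estimate is therefore relative: the denominator is
    measured against [|e - ep(t)|], which near the resonance comes from the factorization, and the
    numerator against [Im e], which vanishes on the real axis. Such errors multiply the profile by
    [1 +- kappa], and this localizes maximizers to a fraction of the width.

    No branch of the root of [e] matters: [j_l] and [y_l] are [z^l] and [z^(-l-1)] times entire
    functions of [z^2], so the powers cancel in [f_l] and, after taking moduli, in the cross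
    section. The only surviving root is the odd power of [xb], which carries the radiation damping.

    At [e = ep t] the relative estimate has right-hand side 0, so the pole is an exact zero of
    [denomF]. Its expansion, and the sign of its imaginary part in the lossless case, come from that
    equation. *)

Lemma Im_RtoC_mult (x : R) (z : C) : Im (RtoC x * z) = (x * Im z)%R.
Proof. unfold Im; simpl; ring. Qed.

Lemma Im_le_Cmod (z : C) : (Rabs (Im z) <= Cmod z)%R.
Proof. eapply Rle_trans; [apply Rmax_r | apply Rmax_Cmod]. Qed.

Lemma Cmod_le_Re_Im (z : C) : (Cmod z <= Rabs (Re z) + Rabs (Im z))%R.
Proof.
replace z with (RtoC (Re z) + Ci * RtoC (Im z)) at 1
  by (destruct z; apply injective_projections; simpl; ring).
eapply Rle_trans; [apply Cmod_triangle|].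
rewrite Cmod_mult, Cmod_Ci, !Cmod_R; lra.
Qed.

Lemma Cmod_minus_rev (x y : C) : (Cmod x - Cmod y <= Cmod (x - y))%R.
Proof.
replace x with (x - y + y) at 1 by ring.
pose proof (Cmod_triangle (x - y) y); lra.
Qed.

Lemma Cminus_eq_0 (x y : C) : x - y = 0 -> x = y.
Proof. intros H; replace x with (x - y + y) by ring; rewrite H; ring. Qed.

(** * Complex series with real coefficients *)

Definition ex_CSeries (u : nat -> C) : Prop :=
  ex_series (fun n => Re (u n)) /\ ex_series (fun n => Im (u n)).

Lemma CSeries_ext (u v : nat -> C) :
  (forall n, u n = v n) -> CSeries u = CSeries v.
Proof.
intros H; unfold CSeries; f_equal; apply Series_ext; intros n; now rewrite H.
Qed.

Lemma ex_CSeries_plus (u v : nat -> C) :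
  ex_CSeries u -> ex_CSeries v -> ex_CSeries (fun n => u n + v n).
Proof.
intros [Hu1 Hu2] [Hv1 Hv2]; split; now apply (@ex_series_plus R_AbsRing).
Qed.

Lemma CSeries_plus (u v : nat -> C) :
  ex_CSeries u -> ex_CSeries v ->
  CSeries (fun n => u n + v n) = CSeries u + CSeries v.
Proof.
intros [Hu1 Hu2] [Hv1 Hv2]; unfold CSeries.
apply injective_projections; simpl; now rewrite <- Series_plus.
Qed.

Lemma ex_CSeries_scal (c : C) (u : nat -> C) :
  ex_CSeries u -> ex_CSeries (fun n => c * u n).
Proof.
intros [Hu1 Hu2]; split.
- apply (@ex_series_minus R_AbsRing R_NormedModule
    (fun n => Re c * Re (u n))%R (fun n => Im c * Im (u n))%R);
    now apply (@ex_series_scal_l R_AbsRing).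
- apply (@ex_series_plus R_AbsRing R_NormedModule
    (fun n => Re c * Im (u n))%R (fun n => Im c * Re (u n))%R);
    now apply (@ex_series_scal_l R_AbsRing).
Qed.

Lemma CSeries_scal (c : C) (u : nat -> C) :
  ex_CSeries u -> CSeries (fun n => c * u n) = c * CSeries u.
Proof.
intros [Hu1 Hu2]; unfold CSeries; apply injective_projections; simpl.
- rewrite <- !Series_scal_l, <- Series_minus; [reflexivity| |];
    now apply (@ex_series_scal_l R_AbsRing).
- rewrite <- !Series_scal_l, <- Series_plus; [reflexivity| |];
    now apply (@ex_series_scal_l R_AbsRing).
Qed.

Lemma CSeries_incr_1 (u : nat -> C) :
  ex_CSeries u -> CSeries u = u 0%nat + CSeries (fun n => u (S n)).
Proof.
intros [Hu1 Hu2]; unfold CSeries.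
rewrite (Series_incr_1 (fun n => Re (u n))) by assumption.
rewrite (Series_incr_1 (fun n => Im (u n))) by assumption.
apply injective_projections; reflexivity.
Qed.

Lemma ex_CSeries_incr_1 (u : nat -> C) :
  ex_CSeries u -> ex_CSeries (fun n => u (S n)).
Proof.
intros [Hu1 Hu2]; split;
  [now apply ex_series_incr_1 in Hu1 | now apply ex_series_incr_1 in Hu2].
Qed.

Lemma ex_CSeries_incr_n (u : nat -> C) (n : nat) :
  ex_CSeries u -> ex_CSeries (fun i => u (n + 1 + i)%nat).
Proof.
intros Hu; induction n as [|n IH]; [now apply ex_CSeries_incr_1 in Hu|].
apply ex_CSeries_incr_1 in IH; destruct IH as [I1 I2].
split; eapply ex_series_ext; [|exact I1| |exact I2];
  intros i; simpl; do 2 f_equal; lia.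
Qed.

Lemma CSeries_incr_n (u : nat -> C) (n : nat) :
  ex_CSeries u -> CSeries u = sum_n u n + CSeries (fun i => u (n + 1 + i)%nat).
Proof.
intros Hu; induction n as [|n IH].
- rewrite sum_O, (CSeries_incr_1 u Hu); reflexivity.
- rewrite IH, (CSeries_incr_1 (fun i => u (n + 1 + i)%nat))
    by now apply ex_CSeries_incr_n.
  rewrite sum_Sn, Cplus_assoc.
  replace (n + 1 + 0)%nat with (S n) by lia.
  f_equal; apply CSeries_ext; intros i; f_equal; lia.
Qed.

(** * Entire functions with real Taylor coefficients *)

Definition entire_coeffs (a : nat -> R) : Prop :=
  forall r, (0 <= r)%R -> ex_series (fun k => Rabs (a k) * r ^ k)%R.

Definition abs_sum (a : nat -> R) (r : R) : R :=
  Series (fun k => Rabs (a k) * r ^ k)%R.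

Lemma Series_bound (u b : nat -> R) :
  (forall n, (Rabs (u n) <= b n)%R) -> ex_series b ->
  ex_series u /\ (Rabs (Series u) <= Series b)%R.
Proof.
intros Hub Hb.
assert (Ha : ex_series (fun n => Rabs (u n))).
{ apply (@ex_series_le R_AbsRing R_CompleteNormedModule) with b; [|assumption].
  intros n; change (Rabs (Rabs (u n)) <= b n)%R; rewrite Rabs_Rabsolu; apply Hub. }
split; [now apply ex_series_Rabs|].
eapply Rle_trans; [now apply Series_Rabs|].
apply Series_le; [|assumption]; intros n; split; [apply Rabs_pos | apply Hub].
Qed.

Lemma abs_sum_ge0 (a : nat -> R) (r : R) :
  entire_coeffs a -> (0 <= r)%R -> (0 <= abs_sum a r)%R.
Proof.
intros Ha Hr; eapply Rle_trans; [apply Rabs_pos|].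
apply (fun H => proj2 (Series_bound (fun k => Rabs (a k) * r ^ k)%R _ H (Ha r Hr))).
intros k; rewrite Rabs_pos_eq; [lra|].
apply Rmult_le_pos; [apply Rabs_pos | now apply pow_le].
Qed.

(** Real and imaginary parts are summed separately, hence the factor 2. The extra constant [c] lets
    one lemma serve both plain values and Taylor remainders, where it is [|h|^2]. *)
Lemma CSeries_bound (a : nat -> R) (u : nat -> C) (r c : R) :
  entire_coeffs a -> (0 <= r)%R ->
  (forall k, (Cmod (u k) <= Rabs (a k) * r ^ k * c)%R) ->
  ex_CSeries u /\ (Cmod (CSeries u) <= 2 * (abs_sum a r * c))%R.
Proof.
intros Ha Hr Hu.
assert (Hb : ex_series (fun k => Rabs (a k) * r ^ k * c)%R)
  by (apply ex_series_scal_r; now apply Ha).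
destruct (Series_bound (fun n => Re (u n)) _
  (fun n => Rle_trans _ _ _ (re_le_Cmod _) (Hu n)) Hb) as [E1 B1].
destruct (Series_bound (fun n => Im (u n)) _
  (fun n => Rle_trans _ _ _ (Im_le_Cmod _) (Hu n)) Hb) as [E2 B2].
split; [now split|].
rewrite Series_scal_r in B1, B2; fold (abs_sum a r) in B1, B2.
eapply Rle_trans; [apply Cmod_le_Re_Im|].
change (Rabs (Series (fun n => Re (u n))) + Rabs (Series (fun n => Im (u n)))
  <= 2 * (abs_sum a r * c))%R; lra.
Qed.

Lemma INR_le_pow2 (k : nat) : (INR k <= 2 ^ k)%R.
Proof.
induction k as [|k IH]; [simpl; lra|].
rewrite S_INR; simpl; pose proof (pow_R1_Rle 2 k); lra.
Qed.

(** Since [k <= 2^k], the affine factor is absorbed by doubling the radius, which is harmless when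
    every radius is available. *)
Lemma entire_coeffs_affine (p q : R) (a : nat -> R) :
  entire_coeffs a -> entire_coeffs (fun k => (p + q * INR k) * a k)%R.
Proof.
intros Ha r Hr.
apply (@ex_series_le R_AbsRing R_CompleteNormedModule)
  with (fun k => (Rabs p + Rabs q) * (Rabs (a k) * (2 * r) ^ k))%R.
- intros k.
  assert (Hrk : (0 <= r ^ k)%R) by now apply pow_le.
  assert (Hpq : (Rabs (p + q * INR k) <= (Rabs p + Rabs q) * 2 ^ k)%R).
  { eapply Rle_trans; [apply Rabs_triang|].
    rewrite Rabs_mult, (Rabs_pos_eq (INR k)) by apply pos_INR.
    pose proof (INR_le_pow2 k); pose proof (pow_R1_Rle 2 k ltac:(lra)).
    pose proof (Rabs_pos p); pose proof (Rabs_pos q); nra. }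
  change (Rabs (Rabs ((p + q * INR k) * a k) * r ^ k) <=
    (Rabs p + Rabs q) * (Rabs (a k) * (2 * r) ^ k))%R.
  rewrite Rabs_mult, Rabs_Rabsolu, (Rabs_pos_eq (r ^ k)), Rabs_mult, Rpow_mult_distr
    by assumption.
  replace ((Rabs p + Rabs q) * (Rabs (a k) * (2 ^ k * r ^ k)))%R
    with ((Rabs p + Rabs q) * 2 ^ k * (Rabs (a k) * r ^ k))%R by ring.
  rewrite Rmult_assoc; apply Rmult_le_compat_r; [|assumption].
  apply Rmult_le_pos; [apply Rabs_pos | assumption].
- apply (@ex_series_scal_l R_AbsRing); apply Ha; lra.
Qed.

Lemma entire_coeffs_shift (a : nat -> R) :
  entire_coeffs a -> entire_coeffs (fun k => a (S k)).
Proof.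
intros Ha r Hr.
(* The radius [r + 1] avoids dividing by [r], which may be 0, when undoing the shift. *)
assert (H := Ha (r + 1)%R ltac:(lra)); apply ex_series_incr_1 in H.
apply (@ex_series_le R_AbsRing R_CompleteNormedModule) with (2 := H).
intros k; change (Rabs (Rabs (a (S k)) * r ^ k) <= Rabs (a (S k)) * (r + 1) ^ S k)%R.
rewrite Rabs_mult, Rabs_Rabsolu, (Rabs_pos_eq (r ^ k)) by now apply pow_le.
apply Rmult_le_compat_l; [apply Rabs_pos|].
assert (r ^ k <= (r + 1) ^ k)%R by (apply pow_incr; lra).
assert (0 <= r ^ k)%R by now apply pow_le.
simpl; nra.
Qed.

Lemma entire_coeffs_fact (M : R) (a : nat -> R) :
  (forall k, (Rabs (a k) <= M / INR (fact k))%R) -> entire_coeffs a.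
Proof.
intros Ha r Hr.
apply (@ex_series_le R_AbsRing R_CompleteNormedModule)
  with (fun k => M * (r ^ k * / INR (fact k)))%R.
- intros k; change (Rabs (Rabs (a k) * r ^ k) <= M * (r ^ k * / INR (fact k)))%R.
  assert (0 <= r ^ k)%R by now apply pow_le.
  rewrite Rabs_mult, Rabs_Rabsolu, (Rabs_pos_eq (r ^ k)) by assumption.
  specialize (Ha k); unfold Rdiv in Ha; nra.
- apply (@ex_series_scal_l R_AbsRing); exists (exp r).
  eapply is_series_ext; [|exact (is_exp_Reals r)].
  intros k; change (pow_n r k * / INR (fact k) = r ^ k * / INR (fact k))%R.
  now rewrite pow_n_pow.
Qed.

Definition entire_fun (a : nat -> R) (w : C) : C :=
  CSeries (fun k => RtoC (a k) * w ^ k).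

Lemma entire_term_bound (a : nat -> R) (w : C) (r : R) (k : nat) :
  (Cmod w <= r)%R -> (Cmod (RtoC (a k) * w ^ k) <= Rabs (a k) * r ^ k * 1)%R.
Proof.
intros Hw; rewrite Rmult_1_r, Cmod_mult, Cmod_R, Cmod_pow.
apply Rmult_le_compat_l; [apply Rabs_pos|].
apply pow_incr; split; [apply Cmod_ge_0 | assumption].
Qed.

Lemma ex_entire_fun (a : nat -> R) (w : C) :
  entire_coeffs a -> ex_CSeries (fun k => RtoC (a k) * w ^ k).
Proof.
intros Ha.
apply (CSeries_bound a _ (Cmod w) 1 Ha (Cmod_ge_0 w)).
intros k; now apply entire_term_bound, Rle_refl.
Qed.

Lemma entire_fun_bound (a : nat -> R) (r : R) (w : C) :
  entire_coeffs a -> (Cmod w <= r)%R ->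
  (Cmod (entire_fun a w) <= 2 * abs_sum a r)%R.
Proof.
intros Ha Hw; rewrite <- (Rmult_1_r (abs_sum a r)).
assert (0 <= r)%R by (pose proof (Cmod_ge_0 w); lra).
apply CSeries_bound; try assumption.
intros k; now apply entire_term_bound.
Qed.

Lemma entire_fun_incr (a : nat -> R) (w : C) :
  entire_coeffs a ->
  entire_fun a w = RtoC (a 0%nat) + w * entire_fun (fun k => a (S k)) w.
Proof.
intros Ha; unfold entire_fun at 1.
rewrite CSeries_incr_1 by now apply ex_entire_fun.
simpl (w ^ 0); rewrite Cmult_1_r; f_equal.
unfold entire_fun; rewrite <- CSeries_scal
  by now apply ex_entire_fun, entire_coeffs_shift.
apply CSeries_ext; intros k; rewrite Cpow_S; ring.
Qed.

(** Multiplying the coefficients by [k] is the Euler operator [w d/dw]; in this form the derivatives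
    of [psi] and [xi] become power series in [w = z^2]. *)
Lemma entire_fun_affine (p q : R) (a : nat -> R) (w : C) :
  entire_coeffs a ->
  entire_fun (fun k => (p + q * INR k) * a k)%R w
  = RtoC p * entire_fun a w
    + RtoC q * w * entire_fun (fun k => (INR (S k) * a (S k))%R) w.
Proof.
intros Ha.
assert (Hk : entire_coeffs (fun k => (INR k * a k)%R)).
{ intros r Hr; eapply ex_series_ext; [|exact (entire_coeffs_affine 0 1 a Ha r Hr)].
  intros k; simpl; do 2 f_equal; ring. }
rewrite <- Cmult_assoc.
replace (w * entire_fun (fun k => (INR (S k) * a (S k))%R) w)
  with (entire_fun (fun k => (INR k * a k)%R) w)
  by (rewrite (entire_fun_incr _ _ Hk), RtoC_mult; change (INR 0) with 0%R; ring).
unfold entire_fun; rewrite <- !CSeries_scal, <- CSeries_plus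
  by (try apply ex_CSeries_scal; now apply ex_entire_fun).
apply CSeries_ext; intros k.
rewrite RtoC_mult, RtoC_plus, !RtoC_mult; ring.
Qed.

(** Induction on [Im (w w^k) = Re w Im (w^k) + Im w Re (w^k)]: each of the [k] factors contributes
    one [|Im w|]. With [1 <= r] the bound [r^k] may replace [r^(k-1)]. *)
Lemma Cpow_Im_bound (w : C) (r : R) (k : nat) :
  (Cmod w <= r)%R -> (1 <= r)%R ->
  (Rabs (Im (w ^ k)) <= INR k * r ^ k * Rabs (Im w))%R.
Proof.
intros Hw Hr; induction k as [|k IH].
- simpl; rewrite Rabs_R0; lra.
- rewrite Cpow_S.
  replace (Im (w * w ^ k)) with (Re w * Im (w ^ k) + Im w * Re (w ^ k))%R
    by (unfold Re, Im; simpl; ring).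
  eapply Rle_trans; [apply Rabs_triang|]; rewrite !Rabs_mult.
  assert (H1 := re_le_Cmod w).
  assert (H2 : (Rabs (Re (w ^ k)) <= r ^ k)%R).
  { eapply Rle_trans; [apply re_le_Cmod|]; rewrite Cmod_pow.
    apply pow_incr; split; [apply Cmod_ge_0 | assumption]. }
  pose proof (Rabs_pos (Im w)); pose proof (pow_R1_Rle r k Hr).
  pose proof (Rabs_pos (Im (w ^ k))).
  rewrite S_INR; simpl pow.
  assert (Rabs (Re w) * Rabs (Im (w ^ k)) <= r * (INR k * r ^ k * Rabs (Im w)))%R.
  { apply Rmult_le_compat; try apply Rabs_pos; lra. }
  assert (Rabs (Im w) * Rabs (Re (w ^ k)) <= Rabs (Im w) * (r * r ^ k))%R.
  { apply Rmult_le_compat_l; [assumption|]; nra. }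
  lra.
Qed.

(* Real coefficients: the imaginary part is controlled by that of the argument
   alone, which is what makes the estimates below relative to [Im eps]. *)
Lemma entire_fun_Im_bound (a : nat -> R) (r : R) (w : C) :
  entire_coeffs a -> (1 <= r)%R -> (Cmod w <= r)%R ->
  (Rabs (Im (entire_fun a w)) <= abs_sum a (2 * r) * Rabs (Im w))%R.
Proof.
intros Ha Hr Hw.
unfold abs_sum; rewrite <- Series_scal_r.
apply (fun u b H1 H2 => proj2 (Series_bound u b H1 H2)).
- intros k; rewrite Im_RtoC_mult, Rabs_mult, Rmult_assoc.
  apply Rmult_le_compat_l; [apply Rabs_pos|].
  eapply Rle_trans; [now apply Cpow_Im_bound with (r := r)|].
  apply Rmult_le_compat_r; [apply Rabs_pos|].
  rewrite Rpow_mult_distr; apply Rmult_le_compat_r;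
    [apply pow_le; lra | apply INR_le_pow2].
- apply ex_series_scal_r; apply Ha; lra.
Qed.

(** * Complex derivatives *)

(** Phrased with the modulus, whereas the balls of [C] as a uniform space are squares. *)
Definition Ccontinuous (f : C -> C) (z : C) : Prop :=
  forall e, (0 < e)%R ->
    exists d, (0 < d)%R /\ forall y, (Cmod (y - z) < d)%R -> (Cmod (f y - f z) < e)%R.

Lemma Ccontinuous_const (c z : C) : Ccontinuous (fun _ => c) z.
Proof.
intros e He; exists 1%R; split; [lra|]; intros y _.
replace (c - c) with (RtoC 0) by ring; now rewrite Cmod_0.
Qed.

Lemma Ccontinuous_id (z : C) : Ccontinuous (fun y => y) z.
Proof. intros e He; exists e; now split. Qed.

Lemma Ccontinuous_plus (f g : C -> C) (z : C) :
  Ccontinuous f z -> Ccontinuous g z -> Ccontinuous (fun y => f y + g y) z.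
Proof.
intros Hf Hg e He.
destruct (Hf (e / 2)%R ltac:(lra)) as (d1 & Hd1 & H1).
destruct (Hg (e / 2)%R ltac:(lra)) as (d2 & Hd2 & H2).
exists (Rmin d1 d2); split; [now apply Rmin_pos|]; intros y Hy.
specialize (H1 y (Rlt_le_trans _ _ _ Hy (Rmin_l _ _))).
specialize (H2 y (Rlt_le_trans _ _ _ Hy (Rmin_r _ _))).
replace (f y + g y - (f z + g z)) with ((f y - f z) + (g y - g z)) by ring.
eapply Rle_lt_trans; [apply Cmod_triangle|]; lra.
Qed.

Lemma Ccontinuous_mult (f g : C -> C) (z : C) :
  Ccontinuous f z -> Ccontinuous g z -> Ccontinuous (fun y => f y * g y) z.
Proof.
intros Hf Hg e He.
pose proof (Cmod_ge_0 (f z)) as Pf; pose proof (Cmod_ge_0 (g z)) as Pg.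
set (K := (1 + Cmod (f z) + Cmod (g z))%R).
assert (HK : (1 <= K)%R) by (unfold K; lra).
assert (HeK : (0 < Rmin 1 (e / (2 * K)))%R).
{ apply Rmin_pos; [lra|]; apply Rdiv_lt_0_compat; lra. }
destruct (Hf _ HeK) as (d1 & Hd1 & H1).
destruct (Hg _ HeK) as (d2 & Hd2 & H2).
exists (Rmin d1 d2); split; [now apply Rmin_pos|]; intros y Hy.
specialize (H1 y (Rlt_le_trans _ _ _ Hy (Rmin_l _ _))).
specialize (H2 y (Rlt_le_trans _ _ _ Hy (Rmin_r _ _))).
replace (f y * g y - f z * g z)
  with ((f y - f z) * (g y - g z) + ((f y - f z) * g z + f z * (g y - g z))) by ring.
assert (L1 := Rlt_le_trans _ _ _ H1 (Rmin_l _ _)).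
assert (L2 := Rlt_le_trans _ _ _ H1 (Rmin_r _ _)).
assert (L4 := Rlt_le_trans _ _ _ H2 (Rmin_r _ _)).
assert (HE : (e / (2 * K) * K = e / 2)%R) by (field; lra).
set (E := (e / (2 * K))%R) in *.
eapply Rle_lt_trans; [apply Cmod_triangle|].
eapply Rle_lt_trans; [apply Rplus_le_compat_l, Cmod_triangle|].
rewrite !Cmod_mult.
pose proof (Cmod_ge_0 (f y - f z)); pose proof (Cmod_ge_0 (g y - g z)).
assert (Cmod (f y - f z) * Cmod (g y - g z) <= E)%R by nra.
assert (Cmod (f y - f z) * Cmod (g z) <= E * Cmod (g z))%R by nra.
assert (Cmod (f z) * Cmod (g y - g z) <= E * Cmod (f z))%R by nra.
unfold K in HE; nra.
Qed.

Lemma Ccontinuous_comp (f g : C -> C) (z : C) :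
  Ccontinuous f z -> Ccontinuous g (f z) -> Ccontinuous (fun y => g (f y)) z.
Proof.
intros Hf Hg e He; destruct (Hg e He) as (d & Hd & H).
destruct (Hf d Hd) as (d' & Hd' & H'); exists d'; split; auto.
Qed.

Lemma Ccontinuous_inv (z : C) : z <> 0 -> Ccontinuous (fun y => / y) z.
Proof.
intros Hz e He.
assert (Hm : (0 < Cmod z)%R) by now apply Cmod_gt_0.
exists (Rmin (Cmod z / 2) (e * (Cmod z * Cmod z) / 2)); split.
{ apply Rmin_pos; [lra|]; apply Rdiv_lt_0_compat; [|lra].
  apply Rmult_lt_0_compat; nra. }
intros y Hy.
assert (Hy1 := Rlt_le_trans _ _ _ Hy (Rmin_l _ _)).
assert (Hy2 := Rlt_le_trans _ _ _ Hy (Rmin_r _ _)).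
assert (Hyz : (Cmod z / 2 < Cmod y)%R).
{ pose proof (Cmod_minus_rev z y).
  replace (y - z) with (- (z - y)) in Hy1 by ring.
  rewrite Cmod_opp in Hy1; lra. }
assert (Hy0 : y <> 0) by (intros ->; rewrite Cmod_0 in Hyz; lra).
replace (/ y - / z) with (- ((y - z) / (y * z))) by (field; now split).
rewrite Cmod_opp, Cmod_div, Cmod_mult
  by (intros E; apply (f_equal Cmod) in E; rewrite Cmod_mult, Cmod_0 in E; nra).
apply Rlt_div_l; [nra|].
assert (e * (Cmod z / 2 * Cmod z) < e * (Cmod y * Cmod z))%R; [|lra].
apply Rmult_lt_compat_l; [assumption|]; nra.
Qed.

(* Caratheodory's form of the complex derivative. *)
Definition is_Cderiv (f : C -> C) (z l : C) : Prop :=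
  exists phi : C -> C, Ccontinuous phi z /\ phi z = l /\
    exists d, (0 < d)%R /\
      forall y, (Cmod (y - z) < d)%R -> f y = f z + (y - z) * phi y.

Lemma is_Cderiv_const (c z : C) : is_Cderiv (fun _ => c) z 0.
Proof.
exists (fun _ => RtoC 0); split; [apply Ccontinuous_const|]; split; [reflexivity|].
exists 1%R; split; [lra|]; intros; ring.
Qed.

Lemma is_Cderiv_id (z : C) : is_Cderiv (fun y => y) z 1.
Proof.
exists (fun _ => RtoC 1); split; [apply Ccontinuous_const|]; split; [reflexivity|].
exists 1%R; split; [lra|]; intros; ring.
Qed.

Lemma is_Cderiv_ext (f g : C -> C) (z l : C) :
  (forall y, f y = g y) -> is_Cderiv f z l -> is_Cderiv g z l.
Proof.
intros E (phi & H1 & H2 & d & Hd & H3); exists phi; repeat split; try assumption.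
exists d; split; [assumption|]; intros y; rewrite <- !E; apply H3.
Qed.

Lemma is_Cderiv_continuous (f : C -> C) (z l : C) :
  is_Cderiv f z l -> Ccontinuous f z.
Proof.
intros (phi & H1 & _ & d & Hd & H3) e He.
assert (H : Ccontinuous (fun y => f z + (y - z) * phi y) z).
{ apply Ccontinuous_plus; [apply Ccontinuous_const|].
  apply Ccontinuous_mult; [|assumption].
  apply Ccontinuous_plus; [apply Ccontinuous_id | apply Ccontinuous_const]. }
destruct (H e He) as (d' & Hd' & H').
exists (Rmin d d'); split; [now apply Rmin_pos|]; intros y Hy.
specialize (H' y (Rlt_le_trans _ _ _ Hy (Rmin_r _ _))).
rewrite (H3 y (Rlt_le_trans _ _ _ Hy (Rmin_l _ _))).
replace (f z + (y - z) * phi y - f z)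
  with (f z + (y - z) * phi y - (f z + (z - z) * phi z)) by ring; exact H'.
Qed.

Lemma is_Cderiv_plus (f g : C -> C) (z lf lg : C) :
  is_Cderiv f z lf -> is_Cderiv g z lg -> is_Cderiv (fun y => f y + g y) z (lf + lg).
Proof.
intros (p & P1 & P2 & d1 & Hd1 & P3) (q & Q1 & Q2 & d2 & Hd2 & Q3).
exists (fun y => p y + q y); split; [now apply Ccontinuous_plus|].
split; [now rewrite P2, Q2|].
exists (Rmin d1 d2); split; [now apply Rmin_pos|]; intros y Hy.
rewrite (P3 y (Rlt_le_trans _ _ _ Hy (Rmin_l _ _))),
  (Q3 y (Rlt_le_trans _ _ _ Hy (Rmin_r _ _))); ring.
Qed.

Lemma is_Cderiv_mult (f g : C -> C) (z lf lg : C) :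
  is_Cderiv f z lf -> is_Cderiv g z lg ->
  is_Cderiv (fun y => f y * g y) z (lf * g z + f z * lg).
Proof.
intros Hf Hg; assert (Cg := is_Cderiv_continuous _ _ _ Hg).
destruct Hf as (p & P1 & P2 & d1 & Hd1 & P3).
destruct Hg as (q & Q1 & Q2 & d2 & Hd2 & Q3).
exists (fun y => p y * g y + f z * q y); split.
{ apply Ccontinuous_plus; apply Ccontinuous_mult; try assumption.
  apply Ccontinuous_const. }
split; [now rewrite P2, Q2|].
exists (Rmin d1 d2); split; [now apply Rmin_pos|]; intros y Hy.
rewrite (P3 y (Rlt_le_trans _ _ _ Hy (Rmin_l _ _))) at 1.
rewrite (Q3 y (Rlt_le_trans _ _ _ Hy (Rmin_r _ _))); ring.
Qed.

Lemma is_Cderiv_comp (f g : C -> C) (z lf lg : C) :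
  is_Cderiv f z lf -> is_Cderiv g (f z) lg -> is_Cderiv (fun y => g (f y)) z (lf * lg).
Proof.
intros Hf Hg; assert (Cf := is_Cderiv_continuous _ _ _ Hf).
destruct Hf as (p & P1 & P2 & d1 & Hd1 & P3).
destruct Hg as (q & Q1 & Q2 & d2 & Hd2 & Q3).
destruct (Cf d2 Hd2) as (d3 & Hd3 & H3).
exists (fun y => p y * q (f y)); split.
{ apply Ccontinuous_mult; [assumption|]; now apply Ccontinuous_comp. }
split; [now rewrite P2, Q2|].
exists (Rmin d1 d3); split; [now apply Rmin_pos|]; intros y Hy.
rewrite (Q3 (f y) (H3 y (Rlt_le_trans _ _ _ Hy (Rmin_r _ _)))).
rewrite (P3 y (Rlt_le_trans _ _ _ Hy (Rmin_l _ _))) at 1; ring.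
Qed.

Lemma is_Cderiv_inv (z : C) : z <> 0 -> is_Cderiv (fun y => / y) z (- / (z * z)).
Proof.
intros Hz; exists (fun y => - (1) * (/ z * / y)); split.
{ apply Ccontinuous_mult; [apply Ccontinuous_const|].
  apply Ccontinuous_mult; [apply Ccontinuous_const | now apply Ccontinuous_inv]. }
split; [now field|].
exists (Cmod z); split; [now apply Cmod_gt_0|]; intros y Hy.
assert (y <> 0).
{ intros ->; replace (0 - z) with (- z) in Hy by ring; rewrite Cmod_opp in Hy; lra. }
field; now split.
Qed.

Lemma is_Cderiv_pow (n : nat) (z : C) :
  is_Cderiv (fun y => y ^ S n) z (RtoC (INR (S n)) * z ^ n).
Proof.
induction n as [|n IH].
- eapply is_Cderiv_ext; [|simpl; replace (1 * 1) with (RtoC 1) by ring; apply is_Cderiv_id].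
  intros y; simpl; ring.
- apply (is_Cderiv_ext (fun y => y * y ^ S n)); [reflexivity|].
  replace (RtoC (INR (S (S n))) * z ^ S n)
    with (1 * z ^ S n + z * (RtoC (INR (S n)) * z ^ n))
    by (rewrite (S_INR (S n)), RtoC_plus, Cpow_S; ring).
  apply is_Cderiv_mult; [apply is_Cderiv_id | apply IH].
Qed.

(** The remainder [R_k] satisfies [R_(k+1) = (w + h) R_k + k w^(k-1) h^2]. The bound is crude but
    summable against entire coefficients; at [k = 0] the factor [INR k] makes the value of [pred]
    harmless. *)
Lemma Cpow_remainder (w h : C) (r : R) (k : nat) :
  (Cmod w <= r)%R -> (Cmod (w + h) <= r)%R -> (1 <= r)%R ->
  (Cmod ((w + h) ^ k - w ^ k - RtoC (INR k) * w ^ pred k * h)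
   <= INR k * INR k * r ^ k * (Cmod h * Cmod h))%R.
Proof.
intros Hw Hwh Hr; induction k as [|k IH].
- simpl; replace (1 - 1 - 0 * 1 * h) with (RtoC 0) by ring; rewrite Cmod_0; lra.
- replace ((w + h) ^ S k - w ^ S k - RtoC (INR (S k)) * w ^ pred (S k) * h)
    with ((w + h) * ((w + h) ^ k - w ^ k - RtoC (INR k) * w ^ pred k * h)
          + RtoC (INR k) * w ^ pred k * (h * h)).
  2: { rewrite S_INR, RtoC_plus; simpl pred; rewrite !Cpow_S.
       destruct k; [simpl; ring|]; simpl pred; rewrite !Cpow_S; ring. }
  eapply Rle_trans; [apply Cmod_triangle|]; rewrite !Cmod_mult, Cmod_R, Cmod_pow.
  rewrite (Rabs_pos_eq (INR k)) by apply pos_INR.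
  assert (H1 : (Cmod w ^ pred k <= r ^ S k)%R).
  { apply Rle_trans with (r ^ pred k)%R.
    - apply pow_incr; split; [apply Cmod_ge_0 | assumption].
    - apply Rle_pow; [assumption | lia]. }
  set (q := Cmod ((w + h) ^ k - w ^ k - RtoC (INR k) * w ^ pred k * h)) in *.
  assert (Hh : (0 <= Cmod h * Cmod h)%R) by (pose proof (Cmod_ge_0 h); nra).
  set (hh := (Cmod h * Cmod h)%R) in *.
  assert (H2 : (Cmod (w + h) * q <= r * (INR k * INR k * r ^ k * hh))%R).
  { apply Rmult_le_compat; [apply Cmod_ge_0 | apply Cmod_ge_0 | assumption | assumption]. }
  pose proof (pos_INR k) as Hk.
  assert (H3 : (INR k * Cmod w ^ pred k * hh <= INR k * r ^ S k * hh)%R).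
  { apply Rmult_le_compat_r; [assumption|]; now apply Rmult_le_compat_l. }
  assert (0 <= r ^ S k * hh)%R.
  { apply Rmult_le_pos; [|assumption]; apply pow_le; lra. }
  rewrite S_INR; simpl pow in *; nra.
Qed.

(** Summing the remainders of the powers gives a quadratic error for the whole series, so the
    difference quotient, completed by [D] at [w], is a continuous slope. *)
Lemma is_Cderiv_entire_fun (a : nat -> R) (w : C) :
  entire_coeffs a ->
  is_Cderiv (entire_fun a) w (entire_fun (fun k => (INR (S k) * a (S k))%R) w).
Proof.
intros Ha.
set (D := entire_fun (fun k => (INR (S k) * a (S k))%R) w).
set (r := (Cmod w + 1)%R).
assert (Hr : (1 <= r)%R) by (unfold r; pose proof (Cmod_ge_0 w); lra).
(* The 2 comes from [CSeries_bound], the radius [4 r] from [k * k <= 4^k], and the 1 makes [M]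
   positive. *)
set (M := (2 * abs_sum a (4 * r) + 1)%R).
assert (HM : (0 < M)%R)
  by (pose proof (abs_sum_ge0 a (4 * r) Ha ltac:(lra)); unfold M; lra).
assert (Hrem : forall h, (Cmod h < 1)%R ->
  (Cmod (entire_fun a (w + h) - entire_fun a w - h * D) <= M * (Cmod h * Cmod h))%R).
{ intros h Hh.
  (* The derivative series is reindexed with [pred k], its vanishing term at 0 included, so that it
     can be subtracted termwise from the series of [(w + h)^k - w^k]. *)
  assert (ED : ex_CSeries (fun k => RtoC (a k) * (RtoC (INR k) * w ^ pred k)) /\
     D = CSeries (fun k => RtoC (a k) * (RtoC (INR k) * w ^ pred k))).
  { assert (E : ex_CSeries (fun k => RtoC (a k) * (RtoC (INR k) * w ^ pred k))).
    { apply (CSeries_bound a _ (2 * r) 1 Ha); [lra|]; intros k.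
      rewrite Rmult_1_r, !Cmod_mult, !Cmod_R, Cmod_pow.
      apply Rmult_le_compat_l; [apply Rabs_pos|].
      rewrite Rpow_mult_distr, Rabs_pos_eq by apply pos_INR.
      apply Rmult_le_compat;
        [apply pos_INR | apply pow_le, Cmod_ge_0 | apply INR_le_pow2 |].
      apply Rle_trans with (r ^ pred k)%R.
      - apply pow_incr; split; [apply Cmod_ge_0 | unfold r; lra].
      - apply Rle_pow; [assumption | lia]. }
    split; [assumption|].
    rewrite (CSeries_incr_1 _ E); unfold D, entire_fun.
    replace (RtoC (a 0%nat) * (RtoC (INR 0) * w ^ pred 0)) with (RtoC 0)
      by (simpl; ring).
    rewrite Cplus_0_l; apply CSeries_ext; intros k; simpl pred.
    rewrite RtoC_mult; ring. }
  destruct ED as [ED ->].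
  replace (entire_fun a (w + h) - entire_fun a w
      - h * CSeries (fun k => RtoC (a k) * (RtoC (INR k) * w ^ pred k)))
    with (CSeries (fun k => RtoC (a k) *
      ((w + h) ^ k - w ^ k - RtoC (INR k) * w ^ pred k * h))).
  - apply Rle_trans with (2 * (abs_sum a (4 * r) * (Cmod h * Cmod h)))%R.
    2: { pose proof (Cmod_ge_0 h); unfold M; nra. }
    apply CSeries_bound; [assumption | lra |]; intros k.
    rewrite Cmod_mult, Cmod_R, Rmult_assoc.
    apply Rmult_le_compat_l; [apply Rabs_pos|].
    eapply Rle_trans; [apply Cpow_remainder with (r := r)|].
    + unfold r; lra.
    + eapply Rle_trans; [apply Cmod_triangle|]; unfold r; lra.
    + assumption.
    + apply Rmult_le_compat_r; [pose proof (Cmod_ge_0 h); nra|].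
      replace (4 * r)%R with (2 * 2 * r)%R by ring.
      rewrite !Rpow_mult_distr; apply Rmult_le_compat_r; [apply pow_le; lra|].
      apply Rmult_le_compat; try apply pos_INR; apply INR_le_pow2.
  - unfold entire_fun; unfold Cminus.
    rewrite <- (CSeries_scal h) by assumption.
    replace (- CSeries (fun k => RtoC (a k) * w ^ k))
      with (- (1) * CSeries (fun k => RtoC (a k) * w ^ k)) by ring.
    replace (- CSeries (fun k => h * (RtoC (a k) * (RtoC (INR k) * w ^ pred k))))
      with (- (1) * CSeries (fun k => h * (RtoC (a k) * (RtoC (INR k) * w ^ pred k))))
      by ring.
    assert (E1 := ex_entire_fun a (w + h) Ha); assert (E2 := ex_entire_fun a w Ha).
    rewrite <- !CSeries_scal by (try apply ex_CSeries_scal; assumption).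
    rewrite <- !CSeries_plus;
      try apply ex_CSeries_plus; try apply ex_CSeries_scal; try assumption;
      try apply ex_CSeries_scal; try assumption.
    apply CSeries_ext; intros k; ring. }
exists (fun y => if Ceq_dec y w then D else (entire_fun a y - entire_fun a w) / (y - w)).
split; [|split].
- intros e He; exists (Rmin 1 (e / M)); split.
  { apply Rmin_pos; [lra|]; now apply Rdiv_lt_0_compat. }
  intros y Hy; destruct (Ceq_dec w w) as [_|n]; [|now elim n].
  destruct (Ceq_dec y w) as [->|Hyw].
  { replace (D - D) with (RtoC 0) by ring; now rewrite Cmod_0. }
  assert (Hd : y - w <> 0) by (intros E; now apply Hyw, Cminus_eq_0).
  assert (H0 : (0 < Cmod (y - w))%R) by now apply Cmod_gt_0.
  assert (H := Hrem (y - w) (Rlt_le_trans _ _ _ Hy (Rmin_l _ _))).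
  replace (w + (y - w)) with y in H by ring.
  replace ((entire_fun a y - entire_fun a w) / (y - w) - D)
    with ((entire_fun a y - entire_fun a w - (y - w) * D) / (y - w)) by now field.
  rewrite Cmod_div by assumption; apply Rlt_div_l; [assumption|].
  eapply Rle_lt_trans; [apply H|]; rewrite <- Rmult_assoc.
  apply Rmult_lt_compat_r; [assumption|].
  assert (H2 := Rlt_le_trans _ _ _ Hy (Rmin_r _ _)).
  apply Rmult_lt_compat_l with (r := M) in H2; [|assumption].
  replace (M * (e / M))%R with e in H2 by (field; lra); exact H2.
- now destruct (Ceq_dec w w) as [_|n]; [|elim n].
- exists 1%R; split; [lra|]; intros y _.
  destruct (Ceq_dec y w) as [->|Hyw]; [ring|].
  field; intros E; now apply Hyw, Cminus_eq_0.
Qed.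

Lemma Ccontinuous_entire_fun (a : nat -> R) (w : C) :
  entire_coeffs a -> Ccontinuous (entire_fun a) w.
Proof. intros Ha; eapply is_Cderiv_continuous; now apply is_Cderiv_entire_fun. Qed.

Lemma is_Cderiv_C_derive (f : C -> C) (z l : C) :
  is_Cderiv f z l -> C_derive f z = l.
Proof.
intros (phi & H1 & H2 & d & Hd & H3); apply is_C_lim_unique.
apply filterlim_locally; intros e.
destruct (H1 e (cond_pos e)) as (d' & Hd' & H').
(* Half the radius, because the ball is a square and the modulus is bounded by the sum of the two
   coordinates. *)
assert (Hm : (0 < Rmin d d' / 2)%R)
  by (apply Rdiv_lt_0_compat; [now apply Rmin_pos | lra]).
exists (mkposreal _ Hm); intros y Hy Hyz.
assert (Hyd : (Cmod (y - z) < Rmin d d')%R).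
{ destruct Hy as [Hy1 Hy2].
  eapply Rle_lt_trans; [apply Cmod_le_Re_Im|].
  change (Rabs (fst y - fst z) < Rmin d d' / 2)%R in Hy1.
  change (Rabs (snd y - snd z) < Rmin d d' / 2)%R in Hy2.
  unfold Re, Im; simpl; unfold Rminus in *; lra. }
rewrite (H3 y (Rlt_le_trans _ _ _ Hyd (Rmin_l _ _))).
replace ((f z + (y - z) * phi y - f z) / (y - z)) with (phi y).
- specialize (H' y (Rlt_le_trans _ _ _ Hyd (Rmin_r _ _))); rewrite H2 in H'.
  apply C_NormedModule_mixin_compat1; exact H'.
- field; intros E; now apply Hyz, Cminus_eq_0.
Qed.

(** * Spherical Bessel functions *)

Lemma odd_dfact_pos (n : nat) : (1 <= odd_dfact n)%nat.
Proof. induction n; simpl; nia. Qed.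

Lemma INR_odd_dfact_pos (n : nat) : (1 <= INR (odd_dfact n))%R.
Proof. rewrite <- INR_1; apply le_INR, odd_dfact_pos. Qed.

Lemma INR_odd_dfact_S (n : nat) :
  INR (odd_dfact (S n)) = ((2 * INR n + 1) * INR (odd_dfact n))%R.
Proof.
change (odd_dfact (S n)) with ((2 * n + 1) * odd_dfact n)%nat.
rewrite mult_INR, plus_INR, mult_INR; simpl (INR 2); simpl (INR 1); ring.
Qed.

Lemma odd_dfact_mono (m n : nat) : (m <= n)%nat -> (odd_dfact m <= odd_dfact n)%nat.
Proof.
induction 1 as [|n _ IH]; [lia|].
change (odd_dfact (S n)) with ((2 * n + 1) * odd_dfact n)%nat; nia.
Qed.

Definition jcoef (l k : nat) : R :=
  ((-1 / 2) ^ k / INR (fact k * odd_dfact (l + k + 1)))%R.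

(** The finite and the infinite sum of [sph_y] are one power series in [z^2], occupying [k <= l] and
    [k > l]; the overall minus sign of the first sum is included. *)
Definition ycoef (l k : nat) : R :=
  if Nat.leb k l then (- (INR (odd_dfact (l - k)) / (INR (fact k) * 2 ^ k)))%R
  else ((-1) ^ (l + 1) * ((-1 / 2) ^ k / INR (fact k * odd_dfact (k - l))))%R.

Lemma INR_fact_ge1 (k : nat) : (1 <= INR (fact k))%R.
Proof. rewrite <- INR_1; apply le_INR; pose proof (lt_O_fact k); lia. Qed.

Lemma half_pow_bound (k m : nat) (c : R) : (1 <= m)%nat ->
  (Rabs c = 1)%R ->
  (Rabs (c * ((-1 / 2) ^ k / INR (fact k * m))) <= 1 / INR (fact k))%R.
Proof.
intros Hm Hc.
assert (Hf := INR_fact_ge1 k).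
assert (Hm' : (1 <= INR m)%R) by (rewrite <- INR_1; now apply le_INR).
rewrite Rabs_mult, Hc, Rmult_1_l.
rewrite mult_INR; unfold Rdiv; rewrite Rabs_mult, <- RPow_abs.
replace (Rabs (-1 * / 2)) with (/ 2)%R by (rewrite Rabs_left; lra).
rewrite Rabs_pos_eq by (apply Rlt_le, Rinv_0_lt_compat; nra).
apply Rmult_le_compat; [apply pow_le; lra | | |].
- apply Rlt_le, Rinv_0_lt_compat; nra.
- rewrite <- (pow1 k); apply pow_incr; lra.
- apply Rinv_le_contravar; nra.
Qed.

Lemma jcoef_entire (l : nat) : entire_coeffs (jcoef l).
Proof.
apply entire_coeffs_fact with 1%R; intros k; unfold jcoef.
rewrite <- (Rmult_1_l ((-1 / 2) ^ k / _)%R); apply half_pow_bound;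
  [apply odd_dfact_pos | apply Rabs_R1].
Qed.

Lemma ycoef_entire (l : nat) : entire_coeffs (ycoef l).
Proof.
apply entire_coeffs_fact with (INR (odd_dfact l)); intros k; unfold ycoef.
assert (Hf := INR_fact_ge1 k).
assert (Hl := INR_odd_dfact_pos l).
destruct (Nat.leb_spec k l) as [H|H].
- assert (H2 := pow_R1_Rle 2 k ltac:(lra)).
  assert (Hk := INR_odd_dfact_pos (l - k)).
  rewrite Rabs_Ropp, Rabs_pos_eq
    by (apply Rlt_le, Rdiv_lt_0_compat; [lra | nra]).
  unfold Rdiv; apply Rmult_le_compat; try lra.
  + apply Rlt_le, Rinv_0_lt_compat; nra.
  + apply le_INR, odd_dfact_mono; lia.
  + apply Rinv_le_contravar; nra.
- apply Rle_trans with (1 / INR (fact k))%R.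
  + apply half_pow_bound; [apply odd_dfact_pos|].
    rewrite <- RPow_abs, (Rabs_left (-1)) by lra.
    replace (- -1)%R with 1%R by ring; apply pow1.
  + unfold Rdiv; apply Rmult_le_compat_r; [|lra].
    apply Rlt_le, Rinv_0_lt_compat; lra.
Qed.

(* [sph_j l z = z^l J l (z^2)], [sph_y l z = Y l (z^2) / z^(l+1)]; [JD] and [YD]
   are the corresponding parts of [psi'] and of [xi']. *)
Definition J (l : nat) (w : C) : C := entire_fun (jcoef l) w.
Definition Y (l : nat) (w : C) : C := entire_fun (ycoef l) w.
Definition jdcoef (l k : nat) : R := ((INR l + 1 + 2 * INR k) * jcoef l k)%R.
Definition ydcoef (l k : nat) : R := ((- INR l + 2 * INR k) * ycoef l k)%R.
Definition JD (l : nat) (w : C) : C := entire_fun (jdcoef l) w.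
Definition YD (l : nat) (w : C) : C := entire_fun (ydcoef l) w.

Lemma jdcoef_entire (l : nat) : entire_coeffs (jdcoef l).
Proof. apply entire_coeffs_affine, jcoef_entire. Qed.

Lemma ydcoef_entire (l : nat) : entire_coeffs (ydcoef l).
Proof. apply entire_coeffs_affine, ycoef_entire. Qed.

Lemma RtoC_neq_0 (x : R) : x <> 0%R -> RtoC x <> 0.
Proof. intros H E; apply H; now apply RtoC_inj. Qed.

Lemma half_pow_term (z : C) (k : nat) :
  (- (z ^ 2 / 2)) ^ k = RtoC ((-1 / 2) ^ k) * (z ^ 2) ^ k.
Proof.
rewrite RtoC_pow, <- Cpow_mult_l; f_equal.
rewrite RtoC_div by lra; field; apply RtoC_neq_0; lra.
Qed.

Lemma INR_fact_dfact_neq_0 (k n : nat) : INR (fact k * odd_dfact n) <> 0%R.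
Proof.
rewrite mult_INR; pose proof (INR_fact_ge1 k); pose proof (INR_odd_dfact_pos n); nra.
Qed.

Lemma sph_j_J (l : nat) (z : C) : sph_j l z = z ^ l * J l (z ^ 2).
Proof.
unfold sph_j; f_equal; apply CSeries_ext; intros k.
rewrite half_pow_term; unfold jcoef; rewrite RtoC_div by apply INR_fact_dfact_neq_0.
unfold Cdiv; ring.
Qed.

(** The quotient by [z^(l+1)] is never simplified, so the identity also holds at [z = 0]; this lets
    [xi_JY] be used as an equality of functions when differentiating. *)
Lemma sph_y_Y (l : nat) (z : C) : sph_y l z = Y l (z ^ 2) / z ^ (l + 1).
Proof.
unfold sph_y, Y, entire_fun.
rewrite (CSeries_incr_n (fun k => RtoC (ycoef l k) * (z ^ 2) ^ k) l) by apply ex_entire_fun, ycoef_entire.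
set (Z := z ^ (l + 1)); unfold Cdiv; rewrite Cmult_plus_distr_r.
replace (- (sum_n (fun k => RtoC (INR (odd_dfact (l - k)) / INR (fact k))
    * (z ^ 2 * / 2) ^ k) l * / Z))
  with (- (sum_n (fun k => RtoC (INR (odd_dfact (l - k)) / INR (fact k))
    * (z ^ 2 * / 2) ^ k) l) * / Z) by ring.
f_equal; [f_equal|].
- transitivity (- (1) * sum_n (fun k => RtoC (INR (odd_dfact (l - k)) / INR (fact k))
    * (z ^ 2 * / 2) ^ k) l); [ring|].
  etransitivity; [symmetry; apply (sum_n_mult_l (K := C_Ring))|].
  apply sum_n_ext_loc; intros k Hk.
  unfold ycoef; rewrite (proj2 (Nat.leb_le k l) Hk).
  change (- (1) * (RtoC (INR (odd_dfact (l - k)) / INR (fact k)) * (z ^ 2 * / 2) ^ k)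
    = RtoC (- (INR (odd_dfact (l - k)) / (INR (fact k) * 2 ^ k))) * (z ^ 2) ^ k).
  assert (INR (fact k) <> 0%R) by apply INR_fact_neq_0.
  assert (2 ^ k <> 0)%R by (apply pow_nonzero; lra).
  rewrite Cpow_mult_l, Cpow_inv by (apply RtoC_neq_0; lra).
  rewrite RtoC_opp, !RtoC_div, RtoC_mult, RtoC_pow by (try assumption; nra).
  field; split; [apply Cpow_nz, RtoC_neq_0; lra | now apply RtoC_neq_0].
- transitivity (((- (1)) ^ (l + 1) * CSeries (fun i =>
    (- (z ^ 2 * / 2)) ^ (l + 1 + i)
      * / RtoC (INR (fact (l + 1 + i) * odd_dfact (i + 1))))) * / Z); [ring|].
  f_equal.
  assert (Hterm : forall i, RtoC (ycoef l (l + 1 + i)) * (z ^ 2) ^ (l + 1 + i)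
    = (- (1)) ^ (l + 1) * ((- (z ^ 2 * / 2)) ^ (l + 1 + i)
      * / RtoC (INR (fact (l + 1 + i) * odd_dfact (i + 1))))).
  { intros i; unfold ycoef.
    rewrite (proj2 (Nat.leb_gt (l + 1 + i) l)) by lia.
    replace (l + 1 + i - l)%nat with (i + 1)%nat by lia.
    change (z ^ 2 * / 2) with (z ^ 2 / 2); rewrite half_pow_term.
    rewrite RtoC_mult, RtoC_div, (RtoC_pow (-1)%R) by apply INR_fact_dfact_neq_0.
    replace (RtoC (-1)) with (- (1)) by (apply injective_projections; simpl; ring).
    unfold Cdiv; ring. }
  rewrite (CSeries_ext _ _ Hterm), CSeries_scal; [reflexivity|].
  assert (E : ex_CSeries (fun i => (- (1)) ^ (l + 1) *
     (RtoC (ycoef l (l + 1 + i)) * (z ^ 2) ^ (l + 1 + i)))).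
  { apply ex_CSeries_scal.
    apply (ex_CSeries_incr_n (fun k => RtoC (ycoef l k) * (z ^ 2) ^ k) l).
    apply ex_entire_fun, ycoef_entire. }
  (* The sign is its own inverse, so convergence of the tail of [Y] carries over to the series in
     [sph_y]. *)
  assert (Hsq : (- (1)) ^ (l + 1) * (- (1)) ^ (l + 1) = RtoC 1).
  { rewrite <- Cpow_mult_l; replace (- (1) * - (1)) with (RtoC 1) by ring.
    apply Cpow_1_l. }
  destruct E as [E1 E2]; split;
    [eapply ex_series_ext; [|exact E1] | eapply ex_series_ext; [|exact E2]];
    intros i; cbv beta; f_equal; rewrite Hterm, Cmult_assoc, Hsq; ring.
Qed.

Lemma is_Cderiv_sq (z : C) : is_Cderiv (fun y => y ^ 2) z (2 * z).
Proof.
assert (H := is_Cderiv_pow 1 z); simpl INR in H.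
replace (RtoC (1 + 1) * z ^ 1) with (2 * z) in H; [exact H|].
rewrite RtoC_plus; ring.
Qed.

(** The product and chain rules give [z^l ((l+1) J + 2 w J')] with [w = z^2]; the bracket has
    coefficients [(l + 1 + 2 k) jcoef l k], which explains [jdcoef]. *)
Lemma is_Cderiv_pow_J (l : nat) (z : C) :
  is_Cderiv (fun y => y ^ S l * J l (y ^ 2)) z (z ^ l * JD l (z ^ 2)).
Proof.
unfold JD, jdcoef; rewrite entire_fun_affine by apply jcoef_entire.
replace (z ^ l * (RtoC (INR l + 1) * entire_fun (jcoef l) (z ^ 2)
    + RtoC 2 * z ^ 2 * entire_fun (fun k => (INR (S k) * jcoef l (S k))%R) (z ^ 2)))
  with ((RtoC (INR (S l)) * z ^ l) * J l (z ^ 2)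
    + z ^ S l * ((2 * z) * entire_fun (fun k => (INR (S k) * jcoef l (S k))%R) (z ^ 2)))
  by (rewrite S_INR, (Cpow_S z l); unfold J; ring).
apply (is_Cderiv_mult (fun y => y ^ S l) (fun y => J l (y ^ 2)));
  [apply is_Cderiv_pow|].
apply (is_Cderiv_comp (fun y => y ^ 2) (J l)); [apply is_Cderiv_sq|].
apply is_Cderiv_entire_fun, jcoef_entire.
Qed.

Lemma C_derive_psi (l : nat) (z : C) :
  C_derive (psi l) z = z ^ l * JD l (z ^ 2).
Proof.
apply is_Cderiv_C_derive.
eapply is_Cderiv_ext; [|apply is_Cderiv_pow_J].
intros y; unfold psi; rewrite sph_j_J, (Cpow_S y l); ring.
Qed.

Lemma xi_JY (l : nat) (z : C) :
  xi l z = z ^ S l * J l (z ^ 2) + Ci * (z * (Y l (z ^ 2) * / z ^ S l)).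
Proof.
unfold xi, sph_h1; rewrite sph_j_J, sph_y_Y, Nat.add_1_r.
unfold Cdiv; rewrite (Cpow_S z l); ring.
Qed.

(** The singular part of [xi] is [i z^(-l) Y(z^2)], with derivative [i z^(-l-1) (-l Y + 2 w Y')].
    Multiplying by [z^(l+1)] clears the pole and leaves [YD]. *)
Lemma C_derive_xi (l : nat) (z : C) : z <> 0 ->
  C_derive (xi l) z * z ^ S l
  = z ^ (2 * l + 1) * JD l (z ^ 2) + Ci * YD l (z ^ 2).
Proof.
intros Hz.
set (DY := entire_fun (fun k => (INR (S k) * ycoef l (S k))%R) (z ^ 2)).
assert (Hzl : z ^ S l <> 0) by now apply Cpow_nz.
assert (HY : is_Cderiv (fun y => Y l (y ^ 2)) z ((2 * z) * DY)).
{ apply (is_Cderiv_comp (fun y => y ^ 2) (Y l)); [apply is_Cderiv_sq|].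
  apply is_Cderiv_entire_fun, ycoef_entire. }
assert (HI : is_Cderiv (fun y => / y ^ S l) z
  ((RtoC (INR (S l)) * z ^ l) * - / (z ^ S l * z ^ S l))).
{ apply (is_Cderiv_comp (fun y => y ^ S l) Cinv);
    [apply is_Cderiv_pow | now apply is_Cderiv_inv]. }
assert (HX := is_Cderiv_plus _ _ _ _ _ (is_Cderiv_pow_J l z)
  (is_Cderiv_mult _ _ _ _ _ (is_Cderiv_const Ci z)
    (is_Cderiv_mult _ _ _ _ _ (is_Cderiv_id z) (is_Cderiv_mult _ _ _ _ _ HY HI)))).
rewrite (is_Cderiv_C_derive (xi l) z _
  (is_Cderiv_ext _ _ _ _ (fun y => eq_sym (xi_JY l y)) HX)).
unfold YD, ydcoef; rewrite entire_fun_affine by apply ycoef_entire.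
fold DY (Y l (z ^ 2)).
replace (2 * l + 1)%nat with (l + S l)%nat by lia.
rewrite Cpow_add_r, S_INR, RtoC_plus, RtoC_opp; rewrite !Cpow_S in *.
field; split; [now apply Cpow_nz | assumption].
Qed.

(** * The Mie denominator and the absorption cross section *)

Lemma Cmod_sq (z : C) : (Cmod z * Cmod z = Re z * Re z + Im z * Im z)%R.
Proof. pose proof (Cmod2_alt z) as H; simpl in H; lra. Qed.

Lemma Csqrt_sq (z : C) : Csqrt z * Csqrt z = z.
Proof.
pose proof (Cmod_ge_0 z); pose proof (re_le_Cmod z) as H1; apply Rabs_le_between in H1.
pose proof (Cmod_sq z) as Hsq.
unfold Csqrt; set (m := Cmod z) in *.
assert (E1 := sqrt_sqrt ((m + Re z) / 2) ltac:(lra)).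
assert (E2 := sqrt_sqrt ((m - Re z) / 2) ltac:(lra)).
(* The product of the two half-angle roots fixes the imaginary part of the square up to sign; the
   sign is the one chosen in [Csqrt]. *)
assert (E3 : (sqrt ((m + Re z) / 2) * sqrt ((m - Re z) / 2) = Rabs (Im z) / 2)%R).
{ rewrite <- sqrt_mult by lra.
  replace ((m + Re z) / 2 * ((m - Re z) / 2))%R with ((Rabs (Im z) / 2)²)%R.
  - apply sqrt_Rsqr; pose proof (Rabs_pos (Im z)); lra.
  - unfold Rsqr; pose proof (Rsqr_abs (Im z)) as Ha; unfold Rsqr in Ha; nra. }
set (p := sqrt ((m + Re z) / 2)) in *; set (q := sqrt ((m - Re z) / 2)) in *.
apply injective_projections; simpl; unfold Re, Im in *; destruct z as [x y]; simpl in *;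
  destruct (Rle_dec 0 y) as [Hy|Hy];
  try rewrite (Rabs_pos_eq y Hy) in E3; try rewrite (Rabs_left y) in E3 by lra; nra.
Qed.

Lemma Csqrt_neq_0 (z : C) : z <> 0 -> Csqrt z <> 0.
Proof. intros Hz E; apply Hz; rewrite <- (Csqrt_sq z), E; ring. Qed.

Lemma Cmod_Csqrt (z : C) : (Cmod (Csqrt z) * Cmod (Csqrt z) = Cmod z)%R.
Proof. now rewrite <- Cmod_mult, Csqrt_sq. Qed.

Lemma Re_Csqrt_pos (z : C) : off_cut z -> (0 < Re (Csqrt z))%R.
Proof.
intros Hz; change (0 < sqrt ((Cmod z + Re z) / 2))%R; apply sqrt_lt_R0.
pose proof (Cmod_ge_0 z); pose proof (Cmod_sq z) as Hsq.
destruct (Rlt_dec 0 (Re z)) as [H1|H1]; [lra|].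
destruct (Req_dec (Im z) 0) as [H2|H2]; [exfalso; apply Hz; split; lra|].
assert (0 < Im z * Im z)%R by nra; nra.
Qed.

Lemma off_cut_neq_0 (z : C) : off_cut z -> z <> 0.
Proof. intros H ->; apply H; unfold Re, Im; simpl; lra. Qed.

(** This is [f_l] after cancellation of all negative powers. The [Y] terms come from [i * i = -1]
    and are entire in [z] and [e]; the last line, of order [z^(2l+1)], is the contribution of [j_l]
    to the Hankel function. *)
Definition denomF (l : nat) (eb z e : C) : C :=
  RtoC ((2 * INR l + 1) / INR l) *
  (- (eb * JD l (z ^ 2 * e) * Y l (z ^ 2 * eb))
   + e * J l (z ^ 2 * e) * YD l (z ^ 2 * eb)
   + Ci * (z * Csqrt eb) ^ (2 * l + 1) *
     (eb * JD l (z ^ 2 * e) * J l (z ^ 2 * eb)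
      - e * J l (z ^ 2 * e) * JD l (z ^ 2 * eb))).

Lemma sq_mult_Csqrt (z e : C) : (z * Csqrt e) ^ 2 = z ^ 2 * e.
Proof. rewrite <- (Csqrt_sq e) at 2; ring. Qed.

Lemma mie_denom_eq (l : nat) (eb z e : C) :
  eb <> 0 -> z <> 0 -> e <> 0 -> mie_denom l eb e z = denomF l eb z e.
Proof.
intros Heb Hz He; unfold mie_denom, denomF; f_equal.
set (x := z * Csqrt e); set (xb := z * Csqrt eb).
assert (Hx : x <> 0) by (apply Cmult_neq_0; [assumption | now apply Csqrt_neq_0]).
assert (Hxb : xb <> 0) by (apply Cmult_neq_0; [assumption | now apply Csqrt_neq_0]).
rewrite C_derive_psi; unfold psi; rewrite sph_j_J.
assert (Ew : x ^ 2 = z ^ 2 * e) by apply sq_mult_Csqrt.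
assert (Ewb : xb ^ 2 = z ^ 2 * eb) by apply sq_mult_Csqrt.
assert (E1 : xb ^ l * xi l xb = xb ^ (2 * l + 1) * J l (z ^ 2 * eb) + Ci * Y l (z ^ 2 * eb)).
{ rewrite xi_JY, Ewb; replace (2 * l + 1)%nat with (l + S l)%nat by lia.
  rewrite Cpow_add_r, (Cpow_S xb l).
  field; split; [now apply Cpow_nz | assumption]. }
assert (E2 := C_derive_xi l xb Hxb); rewrite Ewb in E2.
rewrite Ew, (Nat.add_1_r l), (Cpow_S x l).
assert (Hxl := Cpow_nz x l Hx).
transitivity (Ci * (xb ^ l * xi l xb) * JD l (z ^ 2 * e) * eb
  - Ci * J l (z ^ 2 * e) * (C_derive (xi l) xb * xb ^ S l) * e).
- field; now split.
- rewrite E1, E2.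
  set (X := xb ^ (2 * l + 1)); set (P := JD l (z ^ 2 * e)); set (Q := J l (z ^ 2 * e)).
  replace (Ci * (X * J l (z ^ 2 * eb) + Ci * Y l (z ^ 2 * eb)) * P * eb
     - Ci * Q * (X * JD l (z ^ 2 * eb) + Ci * YD l (z ^ 2 * eb)) * e)
  with ((Ci * Ci) * (Y l (z ^ 2 * eb) * P * eb - Q * YD l (z ^ 2 * eb) * e)
    + Ci * X * (eb * P * J l (z ^ 2 * eb) - e * Q * JD l (z ^ 2 * eb))) by ring.
  replace (Ci * Ci) with (- (1)) by (apply injective_projections; simpl; ring).
  ring.
Qed.

(** When a denominator vanishes, both formulas for the cross section take the value 0, so the
    identities and the estimate below need no exception at such points. *)
Lemma Rdiv_0 (x : R) : (x / 0 = 0)%R.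
Proof. unfold Rdiv; rewrite Rinv_0; ring. Qed.

Lemma Cdiv_0 (x : C) : x / 0 = 0.
Proof.
unfold Cdiv; replace (/ RtoC 0) with (RtoC 0); [ring|].
apply injective_projections; simpl; rewrite ?Ropp_0, Rmult_0_l, Rplus_0_r, Rdiv_0; reflexivity.
Qed.

(** With [D] the denominator of [mie_r2], [f_l sqrt(e)^l] equals [i eb sqrt(eb)^l D] times
    [(2l+1)/l]. Moduli remove the roots. The factor [Cmod e ^ (l - 1)] stays on the left because the
    numerator of the cross section supplies exactly this power. *)
Lemma Cmod_mie_r2 (l : nat) (eb e : C) (t : R) :
  (1 <= l)%nat -> (0 < t)%R -> eb <> 0 -> e <> 0 ->
  (Cmod (mie_r2 l eb t e) ^ 2 * Cmod e ^ (l - 1)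
   = ((2 * INR l + 1) / INR l) ^ 2 * Cmod eb ^ (l + 1)
     / Cmod (denomF l eb (RtoC t) e) ^ 2)%R.
Proof.
intros Hl Ht Heb He.
assert (Htc : RtoC t <> 0) by (apply RtoC_neq_0; lra).
rewrite <- mie_denom_eq by assumption.
unfold mie_r2, mie_denom.
set (s := Csqrt eb); set (o := Csqrt e).
set (x := RtoC t * o); set (xb := RtoC t * s).
assert (Hs : s <> 0) by now apply Csqrt_neq_0.
assert (Ho : o <> 0) by now apply Csqrt_neq_0.
assert (Es : s * s = eb) by apply Csqrt_sq.
assert (Eo : o * o = e) by apply Csqrt_sq.
set (DX := C_derive (xi l) xb); set (DP := C_derive (psi l) x).
set (PX := psi l x); set (XX := xi l xb).
set (D := XX * DP - o / s * PX * DX).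
assert (Hc : (0 < (2 * INR l + 1) / INR l)%R).
{ assert (0 < INR l)%R by (apply lt_0_INR; lia); apply Rdiv_lt_0_compat; lra. }
set (c := ((2 * INR l + 1) / INR l)%R) in *.
set (md := RtoC c * (Ci * xb ^ l * XX * / x ^ l * DP * eb
  - Ci * / x ^ (l + 1) * PX * xb ^ (l + 1) * DX * e)).
assert (Emd : md * o ^ l = RtoC c * Ci * eb * s ^ l * D).
{ unfold md, D, x, xb; rewrite !Cpow_mult_l, !Nat.add_1_r, !Cpow_S, <- Es, <- Eo.
  assert (Hol := Cpow_nz o l Ho); assert (Htl := Cpow_nz (RtoC t) l Htc).
  field; repeat split; assumption. }
apply (f_equal Cmod) in Emd.
rewrite !Cmod_mult, Cmod_Ci, Cmod_R, (Rabs_pos_eq c), !Cmod_pow in Emd by lra.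
destruct (Ceq_dec D 0) as [HD|HD].
- assert (Hmd : md = 0).
  { apply Cmod_eq_0; rewrite HD, Cmod_0, Rmult_0_r in Emd.
    apply Rmult_integral in Emd; destruct Emd as [|Emd]; [assumption|].
    exfalso; apply (pow_nonzero (Cmod o) l); [|assumption].
    pose proof (proj1 (Cmod_gt_0 o) Ho); lra. }
  rewrite HD, Hmd, Cdiv_0, Cmod_0; simpl; rewrite !Rmult_0_l, Rdiv_0; reflexivity.
- rewrite Cmod_div, Cmod_mult, Cmod_opp, Cmod_Ci, Cmod_div by assumption.
  assert (H1 := proj1 (Cmod_gt_0 o) Ho); assert (H2 := proj1 (Cmod_gt_0 s) Hs).
  assert (H3 := proj1 (Cmod_gt_0 D) HD).
  assert (Eeb : Cmod eb = (Cmod s * Cmod s)%R) by now rewrite <- Cmod_mult, Es.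
  assert (Ee : Cmod e = (Cmod o * Cmod o)%R) by now rewrite <- Cmod_mult, Eo.
  assert (Hol : (0 < Cmod o ^ l)%R) by now apply pow_lt.
  assert (Hsl : (0 < Cmod s ^ l)%R) by now apply pow_lt.
  assert (Emd' : Cmod md = (c * 1 * Cmod eb * Cmod s ^ l * Cmod D / Cmod o ^ l)%R).
  { rewrite <- Emd; field; lra. }
  rewrite Emd', Eeb, Ee.
  destruct l as [|p]; [lia|].
  replace (S p - 1)%nat with p by lia; rewrite Nat.add_1_r.
  rewrite !Rpow_mult_distr; simpl pow in *.
  assert (0 < Cmod o ^ p)%R by now apply pow_lt.
  assert (0 < Cmod s ^ p)%R by now apply pow_lt.
  field; repeat split; lra.
Qed.

(** With [x = t sqrt(e)], [sqrt(e) x^l conj(x)^(l-1) = t^(2l-1) |e|^(l-1) e]. This prefactor is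
    removed from the bracket of [Qabs]; the second product then keeps [|x|^4 = t^4 |e|^2]. *)
Definition absN (l : nat) (t : R) (e : C) : R :=
  Im (e * (RtoC (INR l + 1) * J l (RtoC t ^ 2 * e) * Cconj (J (l - 1) (RtoC t ^ 2 * e))
       + RtoC (INR l * t ^ 4 * Cmod e ^ 2) * J (l + 2) (RtoC t ^ 2 * e)
         * Cconj (J (l + 1) (RtoC t ^ 2 * e)))).

Definition absK (l : nat) (eb : C) (t : R) : R :=
  (2 / Re (Csqrt eb) * ((2 * INR l + 1) / INR l) ^ 2 * Cmod eb ^ (l + 1)
   * t ^ (2 * l - 1))%R.

Lemma Qabs_eq (l : nat) (eb e : C) (t : R) :
  (1 <= l)%nat -> (0 < t)%R -> eb <> 0 -> e <> 0 ->
  Qabs l eb t e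
  = (absK l eb t * (absN l t e / Cmod (denomF l eb (RtoC t) e) ^ 2))%R.
Proof.
intros Hl Ht Heb He; unfold Qabs, absK.
assert (Hr := Cmod_mie_r2 l eb e t Hl Ht Heb He).
match goal with |- context [Im ?X] => set (N := X) end.
assert (HN : Im N = (t ^ (2 * l - 1) * Cmod e ^ (l - 1) * absN l t e)%R).
{ unfold absN; rewrite <- Im_RtoC_mult; f_equal; unfold N.
  rewrite !sph_j_J, !sq_mult_Csqrt, !Cmult_conj, !Cpow_conj.
  destruct l as [|p]; [lia|].
  replace (S p - 1)%nat with p by lia.
  replace (2 * S p - 1)%nat with (S (2 * p)) by lia.
  replace (S p + 2)%nat with (S (S (S p))) by lia.
  replace (S p + 1)%nat with (S (S p)) by lia.
  set (o := Csqrt e).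
  assert (Eo : o * o = e) by apply Csqrt_sq.
  assert (Eoc : o * Cconj o = RtoC (Cmod e)).
  { rewrite <- Cmod2_conj; f_equal.
    rewrite <- (Cmod_Csqrt e); unfold o; ring. }
  set (x := RtoC t * o); set (xc := Cconj x).
  assert (Exc : x * xc = RtoC (t ^ 2 * Cmod e)).
  { unfold xc, x; rewrite Cmult_conj.
    replace (Cconj (RtoC t)) with (RtoC t) by (apply injective_projections; simpl; ring).
    rewrite RtoC_mult, RtoC_pow, <- Eoc; ring. }
  assert (Ep : x ^ p * xc ^ p = RtoC (t ^ (2 * p)) * RtoC (Cmod e ^ p)).
  { rewrite <- Cpow_mult_l, Exc, <- RtoC_pow, Rpow_mult_distr, <- pow_mult, RtoC_mult.
    reflexivity. }
  set (w := RtoC t ^ 2 * e).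
  rewrite !Cpow_S.
  set (U1 := J (S p) w); set (U2 := Cconj (J p w)).
  set (U3 := J (S (S (S p))) w).
  set (U4 := Cconj (J (S (S p)) w)).
  transitivity (o * x * (x ^ p * xc ^ p) *
     (RtoC (INR (S p) + 1) * U1 * U2 + RtoC (INR (S p)) * (x * xc) * (x * xc) * U3 * U4));
    [ring|].
  rewrite Ep, Exc; unfold x; rewrite !RtoC_mult, !RtoC_pow, (Cpow_S (RtoC t) (2 * p)).
  rewrite <- Eo; ring. }
rewrite HN.
transitivity (2 / Re (Csqrt eb) * (t ^ (2 * l - 1) * absN l t e)
  * (Cmod (mie_r2 l eb t e) ^ 2 * Cmod e ^ (l - 1)))%R; [ring|].
rewrite Hr; unfold Rdiv; ring.
Qed.

(** * Uniform estimates for small size *)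

Definition bounded_on (B : R) (g : R -> C -> C) : Prop :=
  exists M : R, (0 <= M)%R /\ forall (t : R) (e : C),
    (0 < t <= 1)%R -> (Cmod e <= B)%R -> (Cmod (g t e) <= M)%R.

Definition Im_bounded_on (B : R) (g : R -> C -> C) : Prop :=
  exists M : R, (0 <= M)%R /\ forall (t : R) (e : C),
    (0 < t <= 1)%R -> (Cmod e <= B)%R -> (Rabs (Im (g t e)) <= M * Rabs (Im e))%R.

(** Boundedness is carried along because [Im (g h) = Re g Im h + Im g Re h]: only the pair of
    properties is stable under products. *)
Definition tame_on (B : R) (g : R -> C -> C) : Prop :=
  bounded_on B g /\ Im_bounded_on B g.

Lemma bounded_on_const (B : R) (c : C) : bounded_on B (fun _ _ => c).
Proof. exists (Cmod c); split; [apply Cmod_ge_0 | intros; lra]. Qed.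

Lemma bounded_on_t (B : R) : bounded_on B (fun t _ => RtoC t).
Proof.
exists 1%R; split; [lra|]; intros t e Ht _; rewrite Cmod_R, Rabs_pos_eq; lra.
Qed.

Lemma bounded_on_e (B : R) : bounded_on B (fun _ e => e).
Proof.
exists (Rmax B 0); split; [apply Rmax_r|]; intros t e _ He.
eapply Rle_trans; [exact He | apply Rmax_l].
Qed.

Lemma bounded_on_plus (B : R) (g h : R -> C -> C) :
  bounded_on B g -> bounded_on B h -> bounded_on B (fun t e => g t e + h t e).
Proof.
intros (M & HM & H1) (N & HN & H2); exists (M + N)%R; split; [lra|].
intros t e Ht He; eapply Rle_trans; [apply Cmod_triangle|].
specialize (H1 t e Ht He); specialize (H2 t e Ht He); lra.
Qed.

Lemma bounded_on_mult (B : R) (g h : R -> C -> C) :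
  bounded_on B g -> bounded_on B h -> bounded_on B (fun t e => g t e * h t e).
Proof.
intros (M & HM & H1) (N & HN & H2); exists (M * N)%R; split; [nra|].
intros t e Ht He; rewrite Cmod_mult; apply Rmult_le_compat; auto using Cmod_ge_0.
Qed.

Lemma bounded_on_opp (B : R) (g : R -> C -> C) :
  bounded_on B g -> bounded_on B (fun t e => - g t e).
Proof.
intros (M & HM & H1); exists M; split; [assumption|].
intros t e Ht He; rewrite Cmod_opp; auto.
Qed.

Lemma bounded_on_minus (B : R) (g h : R -> C -> C) :
  bounded_on B g -> bounded_on B h -> bounded_on B (fun t e => g t e - h t e).
Proof. intros Hg Hh; now apply bounded_on_plus, bounded_on_opp. Qed.

Lemma bounded_on_pow (B : R) (g : R -> C -> C) (n : nat) :
  bounded_on B g -> bounded_on B (fun t e => g t e ^ n).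
Proof.
intros Hg; induction n as [|n IH]; [exact (bounded_on_const B 1)|].
apply (bounded_on_mult B g (fun t e => g t e ^ n)); assumption.
Qed.

Lemma bounded_on_conj (B : R) (g : R -> C -> C) :
  bounded_on B g -> bounded_on B (fun t e => Cconj (g t e)).
Proof.
intros (M & HM & H1); exists M; split; [assumption|].
intros t e Ht He; rewrite Cmod_conj; auto.
Qed.

Lemma bounded_on_entire (B : R) (a : nat -> R) (g : R -> C -> C) :
  entire_coeffs a -> bounded_on B g -> bounded_on B (fun t e => entire_fun a (g t e)).
Proof.
intros Ha (M & HM & H1); exists (2 * abs_sum a M)%R; split.
- pose proof (abs_sum_ge0 a M Ha HM); lra.
- intros t e Ht He; apply entire_fun_bound; auto.
Qed.

Lemma tame_on_real (B : R) (f : R -> C -> R) :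
  bounded_on B (fun t e => RtoC (f t e)) -> tame_on B (fun t e => RtoC (f t e)).
Proof.
intros H; split; [assumption|]; exists 0%R; split; [lra|]; intros t e _ _.
unfold Im; simpl; rewrite Rabs_R0; lra.
Qed.

Lemma tame_on_const (B c : R) : tame_on B (fun _ _ => RtoC c).
Proof. apply (tame_on_real B (fun _ _ => c)), bounded_on_const. Qed.

Lemma tame_on_t (B : R) : tame_on B (fun t _ => RtoC t).
Proof. apply (tame_on_real B (fun t _ => t)), bounded_on_t. Qed.

Lemma tame_on_e (B : R) : tame_on B (fun _ e => e).
Proof.
split; [apply bounded_on_e|]; exists 1%R; split; [lra|]; intros; lra.
Qed.

Lemma tame_on_plus (B : R) (g h : R -> C -> C) :
  tame_on B g -> tame_on B h -> tame_on B (fun t e => g t e + h t e).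
Proof.
intros [Hg (M & HM & H1)] [Hh (N & HN & H2)]; split; [now apply bounded_on_plus|].
exists (M + N)%R; split; [lra|]; intros t e Ht He.
specialize (H1 t e Ht He); specialize (H2 t e Ht He).
change (Rabs (Im (g t e) + Im (h t e)) <= (M + N) * Rabs (Im e))%R.
eapply Rle_trans; [apply Rabs_triang|]; lra.
Qed.

Lemma tame_on_opp (B : R) (g : R -> C -> C) :
  tame_on B g -> tame_on B (fun t e => - g t e).
Proof.
intros [Hg (M & HM & H1)]; split; [now apply bounded_on_opp|].
exists M; split; [assumption|]; intros t e Ht He.
change (Rabs (- Im (g t e)) <= M * Rabs (Im e))%R; rewrite Rabs_Ropp; auto.
Qed.

Lemma tame_on_conj (B : R) (g : R -> C -> C) :
  tame_on B g -> tame_on B (fun t e => Cconj (g t e)).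
Proof.
intros [Hg (M & HM & H1)]; split; [now apply bounded_on_conj|].
exists M; split; [assumption|]; intros t e Ht He.
rewrite im_conj, Rabs_Ropp; auto.
Qed.

Lemma tame_on_mult (B : R) (g h : R -> C -> C) :
  tame_on B g -> tame_on B h -> tame_on B (fun t e => g t e * h t e).
Proof.
intros [Hg (M & HM & H1)] [Hh (N & HN & H2)]; split; [now apply bounded_on_mult|].
destruct Hg as (P & HP & Hg); destruct Hh as (Q & HQ & Hh).
exists (P * N + M * Q)%R; split; [nra|]; intros t e Ht He.
specialize (H1 t e Ht He); specialize (H2 t e Ht He).
specialize (Hg t e Ht He); specialize (Hh t e Ht He).
pose proof (re_le_Cmod (g t e)) as Rg; pose proof (re_le_Cmod (h t e)) as Rh.
change (Rabs (Re (g t e) * Im (h t e) + Im (g t e) * Re (h t e))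
  <= (P * N + M * Q) * Rabs (Im e))%R.
eapply Rle_trans; [apply Rabs_triang|]; rewrite !Rabs_mult.
pose proof (Rabs_pos (Im e)).
assert (Rabs (Re (g t e)) * Rabs (Im (h t e)) <= P * (N * Rabs (Im e)))%R
  by (apply Rmult_le_compat; try apply Rabs_pos; lra).
assert (Rabs (Im (g t e)) * Rabs (Re (h t e)) <= (M * Rabs (Im e)) * Q)%R
  by (apply Rmult_le_compat; try apply Rabs_pos; lra).
lra.
Qed.

Lemma tame_on_entire (B : R) (a : nat -> R) (g : R -> C -> C) :
  entire_coeffs a -> tame_on B g -> tame_on B (fun t e => entire_fun a (g t e)).
Proof.
intros Ha [Hg (N & HN & H2)]; split; [now apply bounded_on_entire|].
destruct Hg as (M & HM & Hg).
(* [M + 1] rather than [M], since [entire_fun_Im_bound] requires a radius of at least 1. *)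
assert (HA := abs_sum_ge0 a (2 * (M + 1)) Ha ltac:(lra)).
exists (abs_sum a (2 * (M + 1)) * N)%R; split; [nra|]; intros t e Ht He.
eapply Rle_trans.
- apply (entire_fun_Im_bound a (M + 1)); [assumption | lra|].
  specialize (Hg t e Ht He); lra.
- rewrite Rmult_assoc; apply Rmult_le_compat_l; auto.
Qed.

Lemma tame_on_sq_mult (B : R) (g : R -> C -> C) :
  tame_on B g -> tame_on B (fun t e => RtoC t ^ 2 * g t e).
Proof.
intros Hg; apply tame_on_mult; [|assumption]; simpl.
repeat apply tame_on_mult; try apply tame_on_t; apply tame_on_const.
Qed.

Lemma bounded_on_sq_mult (B : R) (g : R -> C -> C) :
  bounded_on B g -> bounded_on B (fun t e => RtoC t ^ 2 * g t e).
Proof. intros Hg; apply bounded_on_mult; [|assumption]; apply bounded_on_pow, bounded_on_t. Qed.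

Ltac solve_entire :=
  repeat (first [apply jcoef_entire | apply ycoef_entire | apply jdcoef_entire
    | apply ydcoef_entire | apply entire_coeffs_shift]).

Ltac solve_bounded :=
  repeat first [apply bounded_on_const | apply bounded_on_t | apply bounded_on_e
  | apply bounded_on_sq_mult | apply bounded_on_plus | apply bounded_on_minus | apply bounded_on_mult
  | apply bounded_on_opp | apply bounded_on_pow | apply bounded_on_conj
  | apply bounded_on_entire; [solve [solve_entire]|] ].

Ltac solve_tame :=
  repeat first [apply tame_on_const | apply tame_on_t | apply tame_on_e
  | apply tame_on_sq_mult | apply tame_on_plus | apply tame_on_mult | apply tame_on_opp | apply tame_on_conj
  | apply tame_on_entire; [solve [solve_entire]|] ].

(** * Leading terms of the denominator and of the absorbed power *)

Definition shift (a : nat -> R) (k : nat) : R := a (S k).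

Lemma jcoef_0 (l : nat) :
  jcoef l 0 = (/ ((2 * INR l + 1) * INR (odd_dfact l)))%R.
Proof.
unfold jcoef; simpl fact; rewrite Nat.mul_1_l, Nat.add_0_r, Nat.add_1_r.
rewrite INR_odd_dfact_S; simpl; unfold Rdiv; ring.
Qed.

Lemma jdcoef_0 (l : nat) : jdcoef l 0 = ((INR l + 1) * jcoef l 0)%R.
Proof. unfold jdcoef; simpl (INR 0); ring. Qed.

Lemma ycoef_0 (l : nat) : ycoef l 0 = (- INR (odd_dfact l))%R.
Proof. unfold ycoef; simpl; rewrite Nat.sub_0_r; field. Qed.

Lemma ydcoef_0 (l : nat) : ydcoef l 0 = (INR l * INR (odd_dfact l))%R.
Proof. unfold ydcoef; rewrite ycoef_0; simpl (INR 0); ring. Qed.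

Lemma J_incr (l : nat) (w : C) :
  J l w = RtoC (jcoef l 0) + w * entire_fun (shift (jcoef l)) w.
Proof. apply entire_fun_incr, jcoef_entire. Qed.

Lemma JD_incr (l : nat) (w : C) :
  JD l w = RtoC (jdcoef l 0) + w * entire_fun (shift (jdcoef l)) w.
Proof. apply entire_fun_incr, jdcoef_entire. Qed.

Lemma Y_incr (l : nat) (w : C) :
  Y l w = RtoC (ycoef l 0) + w * entire_fun (shift (ycoef l)) w.
Proof. apply entire_fun_incr, ycoef_entire. Qed.

Lemma YD_incr (l : nat) (w : C) :
  YD l w = RtoC (ydcoef l 0) + w * entire_fun (shift (ydcoef l)) w.
Proof. apply entire_fun_incr, ydcoef_entire. Qed.

(* [t * remR] is the correction that is real for real [e] and [eb]; [radF]
   carries the radiation damping. *)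
Definition remR (l : nat) (eb : C) (t : R) (e : C) : C :=
  RtoC ((2 * INR l + 1) / INR l) *
  (- (eb * (RtoC (jdcoef l 0) * (RtoC t * eb * entire_fun (shift (ycoef l)) (RtoC t ^ 2 * eb))
            + RtoC t * e * entire_fun (shift (jdcoef l)) (RtoC t ^ 2 * e)
              * Y l (RtoC t ^ 2 * eb)))
   + e * (RtoC (jcoef l 0) * (RtoC t * eb * entire_fun (shift (ydcoef l)) (RtoC t ^ 2 * eb))
          + RtoC t * e * entire_fun (shift (jcoef l)) (RtoC t ^ 2 * e)
            * YD l (RtoC t ^ 2 * eb))).

Definition radF (l : nat) (eb : C) (t : R) (e : C) : C :=
  RtoC ((2 * INR l + 1) / INR l) *
  (eb * JD l (RtoC t ^ 2 * e) * J l (RtoC t ^ 2 * eb)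
   + - (e * J l (RtoC t ^ 2 * e) * JD l (RtoC t ^ 2 * eb))).

Lemma denomF_expand (l : nat) (eb e : C) (t : R) : (1 <= l)%nat ->
  denomF l eb (RtoC t) e
  = e - static_pole l eb + RtoC t * remR l eb t e
    + Ci * (RtoC t * Csqrt eb) ^ (2 * l + 1) * radF l eb t e.
Proof.
intros Hl; unfold denomF, remR, radF.
set (X := (RtoC t * Csqrt eb) ^ (2 * l + 1)).
set (w := RtoC t ^ 2 * e); set (wb := RtoC t ^ 2 * eb).
set (c := RtoC ((2 * INR l + 1) / INR l)).
(* The static limit. Since [jcoef l 0 * ydcoef l 0 = l/(2l+1)], the prefactor [(2l+1)/l] makes the
   coefficient of [e] equal to 1; the other product is [-(l+1)/(2l+1)] and yields the static
   pole. *)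
assert (E0 : e - static_pole l eb
  = c * (- (eb * RtoC (jdcoef l 0) * RtoC (ycoef l 0))
         + e * RtoC (jcoef l 0) * RtoC (ydcoef l 0))).
{ unfold static_pole, c.
  rewrite jdcoef_0, ycoef_0, ydcoef_0, jcoef_0.
  assert (0 < INR l)%R by (apply lt_0_INR; lia).
  pose proof (INR_odd_dfact_pos l).
  assert (INR l <> 0%R) by lra; assert (2 * INR l + 1 <> 0)%R by lra.
  assert (INR (odd_dfact l) <> 0%R) by lra.
  rewrite !RtoC_div, !RtoC_mult, RtoC_inv, RtoC_opp, RtoC_mult, !RtoC_plus, !RtoC_mult
    by (try apply Rmult_integral_contrapositive_currified; assumption).
  assert (RtoC (INR l) <> 0) by now apply RtoC_neq_0.
  assert (RtoC (INR (odd_dfact l)) <> 0) by now apply RtoC_neq_0.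
  assert (2 * RtoC (INR l) + 1 <> 0).
  { rewrite <- RtoC_mult, <- RtoC_plus; now apply RtoC_neq_0. }
  field; now repeat split. }
rewrite E0.
assert (EJ : J l w = RtoC (jcoef l 0) + RtoC t * RtoC t * e * entire_fun (shift (jcoef l)) w)
  by (rewrite (J_incr l w); unfold w at 1; ring).
assert (EJD : JD l w = RtoC (jdcoef l 0) + RtoC t * RtoC t * e * entire_fun (shift (jdcoef l)) w)
  by (rewrite (JD_incr l w); unfold w at 1; ring).
assert (EY : Y l wb = RtoC (ycoef l 0) + RtoC t * RtoC t * eb * entire_fun (shift (ycoef l)) wb)
  by (rewrite (Y_incr l wb); unfold wb at 1; ring).
assert (EYD : YD l wb = RtoC (ydcoef l 0) + RtoC t * RtoC t * eb * entire_fun (shift (ydcoef l)) wb)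
  by (rewrite (YD_incr l wb); unfold wb at 1; ring).
rewrite EJ, EJD, EY, EYD; ring.
Qed.

Lemma tame_remR (B : R) (l : nat) (eb : R) : tame_on B (remR l (RtoC eb)).
Proof. unfold remR, Y, YD; solve_tame. Qed.

Lemma bounded_remR (B : R) (l : nat) (eb : C) : bounded_on B (remR l eb).
Proof. unfold remR, Y, YD; solve_bounded. Qed.

Lemma bounded_radF (B : R) (l : nat) (eb : C) : bounded_on B (radF l eb).
Proof. unfold radF, J, JD; solve_bounded. Qed.

Lemma denomF_approx (B : R) (l : nat) (eb : C) : (1 <= l)%nat ->
  exists M, (0 <= M)%R /\ forall (t : R) (e : C), (0 < t <= 1)%R -> (Cmod e <= B)%R ->
    (Cmod (denomF l eb (RtoC t) e - (e - static_pole l eb)) <= M * t)%R.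
Proof.
intros Hl.
assert (HG : bounded_on B (fun t e => remR l eb t e
  + Ci * (RtoC t ^ (2 * l) * Csqrt eb ^ (2 * l + 1)) * radF l eb t e)).
{ apply bounded_on_plus; [apply bounded_remR|].
  apply bounded_on_mult; [solve_bounded | apply bounded_radF]. }
destruct HG as (M & HM & HG); exists M; split; [assumption|]; intros t e Ht He.
rewrite denomF_expand by assumption.
replace (e - static_pole l eb + RtoC t * remR l eb t e
    + Ci * (RtoC t * Csqrt eb) ^ (2 * l + 1) * radF l eb t e - (e - static_pole l eb))
  with (RtoC t * (remR l eb t e
  + Ci * (RtoC t ^ (2 * l) * Csqrt eb ^ (2 * l + 1)) * radF l eb t e)).
- rewrite Cmod_mult, Cmod_R, Rabs_pos_eq, Rmult_comm by lra.
  apply Rmult_le_compat_r; [lra|]; now apply HG.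
- rewrite Cpow_mult_l, (Nat.add_1_r (2 * l)), (Cpow_S (RtoC t)); ring.
Qed.

Definition absN0 (l : nat) : R :=
  ((INR l + 1) * jcoef l 0 * jcoef (l - 1) 0)%R.

(** At [t = 0] the bracket in [absN] is a real constant times [e]. The difference is [t] times the
    imaginary part of a tame function, so the error is proportional to [Im e] and not merely to
    [t]. *)
Lemma absN_approx (B : R) (l : nat) :
  exists M, (0 <= M)%R /\ forall (t : R) (e : C), (0 < t <= 1)%R -> (Cmod e <= B)%R ->
    (Rabs (absN l t e - absN0 l * Im e) <= M * t * Rabs (Im e))%R.
Proof.
set (T := fun (t : R) (e : C) => e *
  (RtoC (INR l + 1) * (RtoC (jcoef l 0)
      * (RtoC t * Cconj e * Cconj (entire_fun (shift (jcoef (l - 1))) (RtoC t ^ 2 * e)))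
     + RtoC t * e * entire_fun (shift (jcoef l)) (RtoC t ^ 2 * e)
       * Cconj (J (l - 1) (RtoC t ^ 2 * e)))
   + RtoC (INR l) * (RtoC t * (RtoC t * RtoC t)) * (e * Cconj e) * J (l + 2) (RtoC t ^ 2 * e)
         * Cconj (J (l + 1) (RtoC t ^ 2 * e)))).
assert (HT : tame_on B T) by (unfold T, J; solve_tame).
destruct HT as [_ (M & HM & HT)]; exists M; split; [assumption|]; intros t e Ht He.
replace (absN l t e - absN0 l * Im e)%R with (t * Im (T t e))%R.
- rewrite Rabs_mult, Rabs_pos_eq by lra.
  rewrite (Rmult_comm M t), Rmult_assoc; apply Rmult_le_compat_l; [lra|]; now apply HT.
- rewrite <- !Im_RtoC_mult; unfold absN.
  match goal with |- _ = (Im ?X - Im ?Z)%R =>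
    transitivity (Im (X - Z)); [f_equal | reflexivity] end.
  unfold T, absN0; set (w := RtoC t ^ 2 * e).
  rewrite (J_incr l w).
  transitivity (RtoC t * (e *
  (RtoC (INR l + 1) * (RtoC (jcoef l 0)
      * (RtoC t * Cconj e * Cconj (entire_fun (shift (jcoef (l - 1))) w))
     + RtoC t * e * entire_fun (shift (jcoef l)) w * Cconj (J (l - 1) w))
   + RtoC (INR l) * (RtoC t * (RtoC t * RtoC t)) * (e * Cconj e) * J (l + 2) w
         * Cconj (J (l + 1) w)))); [reflexivity|].
  rewrite <- Cmod2_conj, !RtoC_mult.
  assert (EJ : Cconj (J (l - 1) w) = RtoC (jcoef (l - 1) 0)
    + RtoC t ^ 2 * Cconj e * Cconj (entire_fun (shift (jcoef (l - 1))) w)).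
  { rewrite (J_incr (l - 1)), Cplus_conj, Cmult_conj; unfold w at 1.
    rewrite Cmult_conj, Cpow_conj.
    assert (EC : forall x : R, Cconj (RtoC x) = RtoC x)
      by (intros x; apply injective_projections; simpl; ring).
    now rewrite !EC. }
  assert (E4 : RtoC (t ^ 4) = RtoC t ^ 4) by apply RtoC_pow.
  rewrite E4.
  set (Q := Cconj (J (l - 1) w)) in *.
  transitivity (RtoC (INR l + 1) * e * (RtoC (jcoef l 0) * (Q - RtoC (jcoef (l - 1) 0)))
    + RtoC t * (e *
  (RtoC (INR l + 1) * (RtoC t * e * entire_fun (shift (jcoef l)) w * Q)
   + RtoC (INR l) * (RtoC t * (RtoC t * RtoC t)) * RtoC (Cmod e ^ 2) * J (l + 2) w
         * Cconj (J (l + 1) w)))).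
  + rewrite EJ; ring.
  + unfold w at 1; ring_simplify; unfold w; ring.
Qed.

(** * The plasmonic singularity *)

Lemma at_right_0_intro (P : R -> Prop) :
  (exists r, (0 < r)%R /\ forall t, (0 < t < r)%R -> P t) -> at_right 0 P.
Proof.
intros (r & Hr & H); exists (mkposreal r Hr); intros t Ht H0.
apply H; split; [assumption|].
change (Rabs (t - 0) < r)%R in Ht; rewrite Rminus_0_r, Rabs_pos_eq in Ht; lra.
Qed.

Lemma C_ball_Cmod (x y : C) (r : posreal) :
  (Cmod (y - x) < r)%R -> ball (M := C_UniformSpace) x r y.
Proof. exact (C_NormedModule_mixin_compat1 x y r). Qed.

Lemma ball_C_Cmod (x y : C) (r : posreal) :
  ball (M := C_UniformSpace) x r y -> (Cmod (y - x) < 2 * r)%R.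
Proof.
intros [H1 H2]; eapply Rle_lt_trans; [apply Cmod_le_Re_Im|].
change (Rabs (fst y - fst x) < r)%R in H1; change (Rabs (snd y - snd x) < r)%R in H2.
unfold Re, Im; simpl; unfold Rminus in *; lra.
Qed.

Lemma locally_C2 (e0 z0 : C) (P : C * C -> Prop) :
  locally (T := C2_NormedModule) (e0, z0) P ->
  exists r, (0 < r)%R /\ forall e z,
    (Cmod (e - e0) < r)%R -> (Cmod (z - z0) < r)%R -> P (e, z).
Proof.
intros [r H]; exists r; split; [apply cond_pos|]; intros e z He Hz.
apply H; split; now apply C_ball_Cmod.
Qed.

(** Continuity of [alpha] at the base point, where it is 1, turns the factorization into an error
    relative to [|e - ep z|], which remains sharp at the resonance itself. *)
Lemma plasmonic_local (l : nat) (eb : C) (f : C * C -> C) (ep : C -> C) :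
  is_plasmonic_singularity l eb f ep ->
  (forall d, (0 < d)%R -> exists r, (0 < r)%R /\ forall z, (Cmod z < r)%R ->
     (Cmod (ep z - static_pole l eb) < d)%R) /\
  (forall d, (0 < d)%R -> exists r, (0 < r)%R /\ forall e z,
     (Cmod (e - static_pole l eb) < r)%R -> (Cmod z < r)%R ->
     (Cmod (f (e, z) - (e - ep z)) <= d * Cmod (e - ep z))%R).
Proof.
intros (alpha & Ha & He & H1 & Hep0 & Hf).
apply locally_singleton in H1.
change (alpha (@pair C C (static_pole l eb) (RtoC 0)) = 1) in H1.
assert (Ca : continuous (T := C2_NormedModule) (U := C_NormedModule) alpha
  (static_pole l eb, RtoC 0)).
{ apply (filterdiff_continuous (U := C2_NormedModule) (V := C_NormedModule)).
  exact (locally_singleton (T := C2_NormedModule) _ _ Ha). }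
assert (Ce : continuous (T := AbsRing_UniformSpace C_AbsRing) (U := C_NormedModule) ep (RtoC 0)).
{ apply (ex_derive_continuous (K := C_AbsRing) (V := C_NormedModule)).
  exact (locally_singleton (T := C_UniformSpace) _ _ He). }
split.
- intros d Hd.
  assert (Hd2 : (0 < d / 2)%R) by lra.
  assert (HL := proj1 (filterlim_locally ep (ep 0)) Ce (mkposreal _ Hd2)).
  destruct HL as [r Hr].
  exists r; split; [apply cond_pos|]; intros z Hz.
  assert (Hb : ball (M := AbsRing_UniformSpace C_AbsRing) (RtoC 0) r z).
  { change (Cmod (z - 0) < r)%R; now replace (z - 0) with z by ring. }
  specialize (Hr z Hb); apply ball_C_Cmod in Hr; simpl in Hr.
  rewrite Hep0 in Hr; lra.
- intros d Hd.
  assert (Hd2 : (0 < d / 2)%R) by lra.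
  assert (HL := proj1 (@filterlim_locally _ C_NormedModule _ (@filter_filter _ _ (locally_filter _)) alpha _)
    Ca (mkposreal _ Hd2)).
  assert (HL2 := @filter_and _ _ (@filter_filter _ _ (locally_filter (T := C2_NormedModule) _))
    _ _ HL Hf).
  destruct (locally_C2 _ _ _ HL2) as (r & Hr & H).
  exists r; split; [assumption|]; intros e z Hez Hz.
  destruct (H e z Hez) as [HB HF]; [now replace (z - 0) with z by ring|].
  rewrite HF; simpl fst; simpl snd.
  apply ball_C_Cmod in HB.
  change (Cmod (alpha (e, z) - alpha (static_pole l eb, RtoC 0)) < 2 * (d / 2))%R in HB.
  rewrite H1 in HB.
  replace (alpha (e, z) * (e - ep z) - (e - ep z))
    with ((alpha (e, z) - 1) * (e - ep z)) by ring.
  rewrite Cmod_mult; apply Rmult_le_compat_r; [apply Cmod_ge_0 | lra].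
Qed.

Lemma static_pole_neq_0 (l : nat) (eb : C) :
  (1 <= l)%nat -> eb <> 0 -> static_pole l eb <> 0.
Proof.
intros Hl Heb E.
assert (0 < INR l)%R by (apply lt_0_INR; lia).
assert (0 < (INR l + 1) / INR l)%R by (apply Rdiv_lt_0_compat; lra).
apply (f_equal Cmod) in E; unfold static_pole in E.
rewrite Cmod_opp, Cmod_mult, Cmod_R, Cmod_0, Rabs_pos_eq in E by lra.
assert (0 < Cmod eb)%R by now apply Cmod_gt_0.
nra.
Qed.

Lemma denomF_pole_approx (l : nat) (eb : C) (f : C * C -> C) (ep : C -> C) :
  (1 <= l)%nat -> eb <> 0 ->
  is_mie_denom_extension l eb f -> is_plasmonic_singularity l eb f ep ->
  forall B d, (0 < d)%R -> exists r, (0 < r)%R /\ forall (t : R) (e : C),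
    (0 < t < r)%R -> (Cmod e <= B)%R -> e <> 0 ->
    (Cmod (denomF l eb (RtoC t) e - (e - ep (RtoC t))) <= d * Cmod (e - ep (RtoC t)))%R.
Proof.
intros Hl Heb [_ Hf] Hep B d Hd.
destruct (plasmonic_local l eb f ep Hep) as [Hcont Hnear].
destruct (Hnear d Hd) as (r1 & Hr1 & H1).
destruct (denomF_approx B l eb Hl) as (M & HM & H2).
(* Outside the disc of radius [r1], both [denomF] and [e - ep] are within [q] of [e - static_pole].
   Hence [|e - ep| >= 3 r1 / 4], while the total error is at most [2 q <= d r1 / 2]. *)
set (q := (Rmin 1 d * r1 / 4)%R).
assert (Hm : (0 < Rmin 1 d)%R) by (apply Rmin_pos; lra).
assert (Hm1 := Rmin_l 1 d); assert (Hm2 := Rmin_r 1 d).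
assert (Hq : (0 < q)%R) by (unfold q; nra).
destruct (Hcont q Hq) as (r2 & Hr2 & H3).
assert (Hr3 : (0 < q / (M + 1))%R) by (apply Rdiv_lt_0_compat; lra).
exists (Rmin (Rmin r1 1) (Rmin r2 (q / (M + 1)))); split.
{ repeat apply Rmin_pos; lra. }
intros t e [Ht0 Ht] HeB He.
assert (Ht1 := Rlt_le_trans _ _ _ Ht (Rmin_l _ _)).
assert (Ht2 := Rlt_le_trans _ _ _ Ht (Rmin_r _ _)).
assert (Ht11 := Rlt_le_trans _ _ _ Ht1 (Rmin_l _ _)).
assert (Ht12 := Rlt_le_trans _ _ _ Ht1 (Rmin_r _ _)).
assert (Ht21 := Rlt_le_trans _ _ _ Ht2 (Rmin_l _ _)).
assert (Ht22 := Rlt_le_trans _ _ _ Ht2 (Rmin_r _ _)).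
assert (Htc : RtoC t <> 0) by (apply RtoC_neq_0; lra).
assert (Hmod : Cmod (RtoC t) = t) by (rewrite Cmod_R; apply Rabs_pos_eq; lra).
destruct (Rlt_dec (Cmod (e - static_pole l eb)) r1) as [Hn|Hn].
- rewrite <- mie_denom_eq, <- Hf by assumption.
  apply H1; [assumption | lra].
- assert (HA := H2 t e ltac:(lra) HeB).
  assert (HB := H3 (RtoC t) ltac:(lra)).
  assert (HMt : (M * t <= q)%R).
  { apply Rlt_div_r in Ht22; [|lra]; nra. }
  replace (denomF l eb (RtoC t) e - (e - ep (RtoC t)))
    with ((denomF l eb (RtoC t) e - (e - static_pole l eb))
      + (ep (RtoC t) - static_pole l eb)) by ring.
  eapply Rle_trans; [apply Cmod_triangle|].
  assert (HC := Cmod_minus_rev (e - static_pole l eb) (ep (RtoC t) - static_pole l eb)).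
  replace (e - static_pole l eb - (ep (RtoC t) - static_pole l eb))
    with (e - ep (RtoC t)) in HC by ring.
  assert (q <= r1 / 4)%R by (unfold q; nra).
  apply Rle_trans with (2 * q)%R; [lra|].
  apply Rle_trans with (d * (3 / 4 * r1))%R.
  + unfold q; nra.
  + apply Rmult_le_compat_l; lra.
Qed.

(** The relative estimate is evaluated at the pole itself. This requires [ep t <> 0], because [f]
    agrees with [mie_denom] only there, and it follows from closeness to the nonzero static pole. *)
Lemma denomF_pole_zero (l : nat) (eb : C) (f : C * C -> C) (ep : C -> C) :
  (1 <= l)%nat -> eb <> 0 ->
  is_mie_denom_extension l eb f -> is_plasmonic_singularity l eb f ep ->
  exists r, (0 < r)%R /\ forall t : R, (0 < t < r)%R ->
    denomF l eb (RtoC t) (ep (RtoC t)) = 0.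
Proof.
intros Hl Heb Hf Hep.
assert (Hs : (0 < Cmod (static_pole l eb))%R)
  by now apply Cmod_gt_0, static_pole_neq_0.
destruct (proj1 (plasmonic_local l eb f ep Hep) _ Hs) as (r1 & Hr1 & H1).
destruct (denomF_pole_approx l eb f ep Hl Heb Hf Hep (2 * Cmod (static_pole l eb)) 1 Rlt_0_1)
  as (r2 & Hr2 & H2).
exists (Rmin r1 r2); split; [now apply Rmin_pos|]; intros t [Ht0 Ht].
assert (Ht1 := Rlt_le_trans _ _ _ Ht (Rmin_l _ _)).
assert (Ht2 := Rlt_le_trans _ _ _ Ht (Rmin_r _ _)).
specialize (H1 (RtoC t)); rewrite Cmod_R, Rabs_pos_eq in H1 by lra.
specialize (H1 Ht1).
assert (HA := Cmod_minus_rev (ep (RtoC t)) (static_pole l eb)).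
assert (H := H2 t (ep (RtoC t)) (conj Ht0 Ht2) ltac:(lra)).
replace (ep (RtoC t) - ep (RtoC t)) with (RtoC 0) in H by ring.
rewrite Cmod_0, Rmult_0_r in H.
apply Cmod_eq_0; apply Rle_antisym; [|apply Cmod_ge_0].
replace (denomF l eb (RtoC t) (ep (RtoC t)) - 0)
  with (denomF l eb (RtoC t) (ep (RtoC t))) in H by ring.
apply H; intros E; rewrite E in H1.
replace (0 - static_pole l eb) with (- static_pole l eb) in H1 by ring.
rewrite Cmod_opp in H1; lra.
Qed.

Lemma Im_static_pole (l : nat) (eb : C) :
  Im (static_pole l eb) = (- ((INR l + 1) / INR l * Im eb))%R.
Proof.
unfold static_pole.
change (- Im (RtoC ((INR l + 1) / INR l) * eb) = - ((INR l + 1) / INR l * Im eb))%R.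
now rewrite Im_RtoC_mult.
Qed.

Lemma Csqrt_pos_real (x : R) : (0 < x)%R -> Csqrt (RtoC x) = RtoC (sqrt x).
Proof.
intros Hx; unfold Csqrt; rewrite Cmod_R, Rabs_pos_eq by lra.
apply injective_projections; simpl.
- f_equal; lra.
- replace ((x - x) / 2)%R with 0%R by lra; rewrite sqrt_0; ring.
Qed.

(** At leading order both products in [radF] carry the same constant [jdcoef l 0 * jcoef l 0],
    leaving a multiple of [eb - e]. For [eb > 0] and [e] near the static pole its real part is
    positive: this is the sign of radiation damping. *)
Lemma radF_expand (l : nat) (eb : C) (B : R) : exists M, (0 <= M)%R /\
  forall (t : R) (e : C), (0 < t <= 1)%R -> (Cmod e <= B)%R ->
  (Cmod (radF l eb t e
    - RtoC ((2 * INR l + 1) / INR l * jdcoef l 0 * jcoef l 0) * (eb - e)) <= M * t)%R.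
Proof.
set (jd1 := entire_fun (shift (jdcoef l))); set (j1 := entire_fun (shift (jcoef l))).
set (c := RtoC ((2 * INR l + 1) / INR l)).
set (G := fun (t : R) (e : C) => c * (
  eb * (RtoC (jdcoef l 0) * (RtoC t * eb * j1 (RtoC t ^ 2 * eb))
        + RtoC t * e * jd1 (RtoC t ^ 2 * e) * J l (RtoC t ^ 2 * eb))
  - e * (RtoC (jcoef l 0) * (RtoC t * eb * jd1 (RtoC t ^ 2 * eb))
        + RtoC t * e * j1 (RtoC t ^ 2 * e) * JD l (RtoC t ^ 2 * eb)))).
assert (HG : bounded_on B G) by (unfold G, jd1, j1, J, JD; solve_bounded).
destruct HG as (M & HM & HG); exists M; split; [assumption|]; intros t e Ht He.
replace (radF l eb t e
    - RtoC ((2 * INR l + 1) / INR l * jdcoef l 0 * jcoef l 0) * (eb - e))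
  with (RtoC t * G t e).
- rewrite Cmod_mult, Cmod_R, Rabs_pos_eq, Rmult_comm by lra.
  apply Rmult_le_compat_r; [lra|]; now apply HG.
- unfold radF, G; rewrite !RtoC_mult; fold c.
  set (w := RtoC t ^ 2 * e); set (wb := RtoC t ^ 2 * eb).
  assert (EJ : J l w = RtoC (jcoef l 0) + RtoC t * RtoC t * e * j1 w)
    by (rewrite (J_incr l w); unfold w at 1, j1; ring).
  assert (EJD : JD l w = RtoC (jdcoef l 0) + RtoC t * RtoC t * e * jd1 w)
    by (rewrite (JD_incr l w); unfold w at 1, jd1; ring).
  assert (FJ : J l wb = RtoC (jcoef l 0) + RtoC t * RtoC t * eb * j1 wb)
    by (rewrite (J_incr l wb); unfold wb at 1, j1; ring).
  assert (FJD : JD l wb = RtoC (jdcoef l 0) + RtoC t * RtoC t * eb * jd1 wb)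
    by (rewrite (JD_incr l wb); unfold wb at 1, jd1; ring).
  rewrite EJ, EJD, FJ, FJD; ring.
Qed.

Lemma jcoef_0_pos (l : nat) : (0 < jcoef l 0)%R.
Proof.
rewrite jcoef_0; apply Rinv_0_lt_compat.
pose proof (INR_odd_dfact_pos l); pose proof (pos_INR l); nra.
Qed.

(* In a lossy background this is continuity; in a lossless one the displacement
   comes from radiation damping: the imaginary part of the equation for the
   pole is [Im e (1 + O(t)) + xb^(2l+1) Re (radF e) = 0] with [Re radF > 0]. *)
Lemma Im_pole_neg (l : nat) (eb : C) (f : C * C -> C) (ep : C -> C) :
  (1 <= l)%nat -> off_cut eb -> (0 <= Im eb)%R ->
  is_mie_denom_extension l eb f -> is_plasmonic_singularity l eb f ep ->
  exists r, (0 < r)%R /\ forall t : R, (0 < t < r)%R -> (Im (ep (RtoC t)) < 0)%R.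
Proof.
intros Hl Hcut Him Hf Hep.
assert (Heb := off_cut_neq_0 eb Hcut).
assert (Hl0 : (0 < INR l)%R) by (apply lt_0_INR; lia).
assert (Hk : (0 < (INR l + 1) / INR l)%R) by (apply Rdiv_lt_0_compat; lra).
assert (Hcont := proj1 (plasmonic_local l eb f ep Hep)).
destruct (Rle_lt_or_eq_dec _ _ Him) as [Hpos|Hzero].
- destruct (Hcont ((INR l + 1) / INR l * Im eb)%R ltac:(nra)) as (r & Hr & H).
  exists r; split; [assumption|]; intros t [Ht0 Ht].
  specialize (H (RtoC t)); rewrite Cmod_R, Rabs_pos_eq in H by lra.
  specialize (H Ht).
  pose proof (Im_le_Cmod (ep (RtoC t) - static_pole l eb)) as H1.
  change (Rabs (Im (ep (RtoC t)) - Im (static_pole l eb))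
    <= Cmod (ep (RtoC t) - static_pole l eb))%R in H1.
  rewrite Im_static_pole in H1; apply Rabs_le_between in H1; lra.
- assert (Hx : (0 < Re eb)%R).
  { destruct (Rlt_dec 0 (Re eb)); [assumption|]; exfalso; apply Hcut; lra. }
  set (x := Re eb) in *.
  assert (Ex : eb = RtoC x) by (apply injective_projections; [reflexivity | now symmetry]).
  destruct (denomF_pole_zero l eb f ep Hl Heb Hf Hep) as (r1 & Hr1 & H1).
  set (e0 := static_pole l eb) in *.
  set (B := (Cmod e0 + 1)%R).
  destruct (tame_remR B l x) as [_ (M & HM & HR)].
  destruct (radF_expand l eb B) as (N & HN & HI).
  set (g := ((2 * INR l + 1) / INR l * jdcoef l 0 * jcoef l 0)%R) in *.
  assert (Hj := jcoef_0_pos l).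
  assert (Hg : (0 < g)%R).
  { assert (0 < (2 * INR l + 1) / INR l)%R by (apply Rdiv_lt_0_compat; lra).
    unfold g; rewrite jdcoef_0; apply Rmult_lt_0_compat; [|assumption].
    apply Rmult_lt_0_compat; [assumption|]; apply Rmult_lt_0_compat; lra. }
  (* The static pole is negative, so a displacement below [x / 4] keeps [x - Re e >= 3 x / 4]. *)
  set (d := Rmin 1 (x / 4)%R).
  assert (Hd : (0 < d)%R) by (apply Rmin_pos; lra).
  destruct (Hcont d Hd) as (r2 & Hr2 & H2).
  (* [r3] keeps the remainder of [radF] below [g x / 4], against a main part of at least
     [3 g x / 4]; [r4] ensures [t M < 1]. If [Im e >= 0], then [Im e + t Im remR] is nonnegative and
     cannot balance the positive radiative term. *)
  set (r3 := (g * x / 4 / (N + 1))%R).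
  assert (Hr3 : (0 < r3)%R) by (unfold r3; apply Rdiv_lt_0_compat; nra).
  set (r4 := (/ (M + 1))%R).
  assert (Hr4 : (0 < r4)%R) by (apply Rinv_0_lt_compat; lra).
  exists (Rmin (Rmin 1 r1) (Rmin r2 (Rmin r3 r4))); split; [repeat apply Rmin_pos; lra|].
  intros t [Ht0 Ht].
  assert (Hta := Rlt_le_trans _ _ _ Ht (Rmin_l _ _)).
  assert (Htb := Rlt_le_trans _ _ _ Ht (Rmin_r _ _)).
  assert (Ht1 := Rlt_le_trans _ _ _ Hta (Rmin_l _ _)).
  assert (Htr1 := Rlt_le_trans _ _ _ Hta (Rmin_r _ _)).
  assert (Htr2 := Rlt_le_trans _ _ _ Htb (Rmin_l _ _)).
  assert (Htc := Rlt_le_trans _ _ _ Htb (Rmin_r _ _)).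
  assert (Htr3 := Rlt_le_trans _ _ _ Htc (Rmin_l _ _)).
  assert (Htr4 := Rlt_le_trans _ _ _ Htc (Rmin_r _ _)).
  specialize (H1 t ltac:(lra)); specialize (H2 (RtoC t)).
  rewrite Cmod_R, Rabs_pos_eq in H2 by lra; specialize (H2 Htr2).
  set (e := ep (RtoC t)) in *.
  assert (Hd1 := Rmin_l 1 (x / 4)); assert (Hd2 := Rmin_r 1 (x / 4)); fold d in Hd1, Hd2.
  assert (HeB : (Cmod e <= B)%R) by (pose proof (Cmod_minus_rev e e0); unfold B; lra).
  specialize (HR t e ltac:(lra) HeB); specialize (HI t e ltac:(lra) HeB).
  rewrite denomF_expand in H1 by assumption; fold e0 in H1.
  rewrite Ex, Csqrt_pos_real, <- Ex in H1 by assumption.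
  rewrite <- RtoC_mult, <- RtoC_pow in H1.
  set (X := ((t * sqrt x) ^ (2 * l + 1))%R) in *.
  assert (HX : (0 < X)%R).
  { apply pow_lt, Rmult_lt_0_compat; [lra | now apply sqrt_lt_R0]. }
  apply (f_equal Im) in H1.
  assert (E : (Im e - Im e0 + t * Im (remR l (RtoC x) t e) + X * Re (radF l eb t e) = 0)%R).
  { rewrite <- Ex; rewrite <- (Im_RtoC_mult t).
    etransitivity; [|exact H1]; unfold Im, Re, Ci; simpl; ring. }
  unfold e0 in E; rewrite Im_static_pole, <- Hzero in E.
  destruct (Rlt_dec (Im e) 0) as [|Hn]; [assumption|]; exfalso.
  rewrite (Rabs_pos_eq (Im e)) in HR by lra.
  assert (Htm : (t * (M + 1) < 1)%R).
  { apply Rmult_lt_compat_r with (r := (M + 1)%R) in Htr4; [|lra].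
    unfold r4 in Htr4; rewrite Rinv_l in Htr4; lra. }
  assert (Hre : (- (t * (M * Im e)) <= t * Im (remR l (RtoC x) t e))%R).
  { apply Rabs_le_between in HR; nra. }
  assert (HtN : (N * t < g * x / 4)%R).
  { unfold r3 in Htr3; apply Rlt_div_r in Htr3; [|lra]; nra. }
  pose proof (re_le_Cmod (radF l eb t e - RtoC g * (eb - e))) as HRe.
  pose proof (re_le_Cmod (e - e0)) as Hre0.
  assert (Ere0 : Re e0 = (- ((INR l + 1) / INR l * x))%R).
  { unfold e0, static_pole; rewrite Ex; unfold Re; simpl; ring. }
  change (Rabs (Re e - Re e0) <= Cmod (e - e0))%R in Hre0.
  apply Rabs_le_between in Hre0; rewrite Ere0 in Hre0.
  replace (Re (radF l eb t e - RtoC g * (eb - e)))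
    with (Re (radF l eb t e) - g * (x - Re e))%R in HRe
    by (unfold x, Re; simpl; ring).
  apply Rabs_le_between in HRe.
  assert (Hxe : (x * 3 / 4 <= x - Re e)%R) by nra.
  assert (0 < Re (radF l eb t e))%R by nra.
  assert (0 < X * Re (radF l eb t e))%R by now apply Rmult_lt_0_compat.
  nra.
Qed.

(** * The quasi-static approximation *)

Lemma absN0_pos (l : nat) : (0 < absN0 l)%R.
Proof.
unfold absN0; pose proof (jcoef_0_pos l); pose proof (jcoef_0_pos (l - 1)).
pose proof (pos_INR l).
apply Rmult_lt_0_compat; [apply Rmult_lt_0_compat|]; lra.
Qed.

Lemma absK_pos (l : nat) (eb : C) (t : R) :
  (1 <= l)%nat -> off_cut eb -> (0 < t)%R -> (0 < absK l eb t)%R.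
Proof.
intros Hl Hcut Ht; unfold absK.
assert (0 < INR l)%R by (apply lt_0_INR; lia).
assert (Hs := Re_Csqrt_pos eb Hcut).
assert (Heb := proj1 (Cmod_gt_0 eb) (off_cut_neq_0 eb Hcut)).
assert (0 < 2 / Re (Csqrt eb))%R by (apply Rdiv_lt_0_compat; lra).
assert (0 < ((2 * INR l + 1) / INR l) ^ 2)%R by (apply pow_lt, Rdiv_lt_0_compat; lra).
assert (0 < Cmod eb ^ (l + 1))%R by now apply pow_lt.
assert (0 < t ^ (2 * l - 1))%R by now apply pow_lt.
do 3 (apply Rmult_lt_0_compat; [|assumption]); assumption.
Qed.

(** The double factorials come from [j_l(z) ~ z^l / (2l+1)!!] and [j_(l-1)(z) ~ z^(l-1) / (2l-1)!!];
    one factor [2l+1] of the squared prefactor in [absK] cancels. *)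
Lemma Qabs_approx_eq (l : nat) (eb p e : C) (t : R) :
  (1 <= l)%nat -> off_cut eb ->
  Qabs_approx l eb p t e = (absK l eb t * absN0 l * abs_profile p e)%R.
Proof.
intros Hl Hcut; unfold Qabs_approx, absK, absN0, abs_profile.
rewrite !jcoef_0; destruct l as [|q]; [lia|].
replace (S q - 1)%nat with q by lia; rewrite INR_odd_dfact_S, S_INR.
pose proof (pos_INR q); pose proof (INR_odd_dfact_pos q).
assert (Hs := Re_Csqrt_pos eb Hcut).
set (G := (Im e / Cmod (e - p) ^ 2)%R).
field; repeat split; nra.
Qed.

(** Here [phi] stands for [|denomF| / |e - p|]. From [phi >= 3/4] one gets [1 / phi^2 <= 2] and
    [|1 / phi^2 - 1| <= 6 d <= eta / 2]; the numerator contributes [2 * eta / 4], so the budget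
    [eta] is split in halves. *)
Lemma relative_error (n0 n y phi nu d eta : R) :
  (0 < n0)%R -> (0 <= y)%R -> (0 < eta)%R ->
  (Rabs (n - n0 * y) <= nu * y)%R -> (nu <= eta * n0 / 4)%R ->
  (Rabs (phi - 1) <= d)%R -> (d <= / 4)%R -> (d <= eta / 12)%R ->
  (Rabs (n / phi ^ 2 - n0 * y) <= eta * (n0 * y))%R.
Proof.
intros Hn0 Hy Heta Hn Hnu Hphi Hd1 Hd2.
apply Rabs_le_between in Hphi; apply Rabs_le_between in Hn.
set (q := (/ phi ^ 2)%R).
assert (Hp2 : (9 / 16 <= phi ^ 2)%R) by (simpl; nra).
assert (Hq0 : (0 < q)%R) by (apply Rinv_0_lt_compat; lra).
assert (Hq : (q * phi ^ 2 = 1)%R) by (unfold q; field; simpl in Hp2; nra).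
assert (Hq2 : (q <= 2)%R) by nra.
assert (Hq1 : (- (6 * d) <= q - 1 <= 6 * d)%R).
{ replace (q - 1)%R with (q * ((1 - phi) * (1 + phi)))%R by nra.
  assert (- (3 * d) <= (1 - phi) * (1 + phi) <= 3 * d)%R by nra.
  assert (0 <= d)%R by lra; split; nra. }
unfold Rdiv; fold q.
replace (n * q - n0 * y)%R with ((n - n0 * y) * q + n0 * y * (q - 1))%R by ring.
assert (Hny : (0 <= n0 * y)%R) by nra.
assert (Hnuy : (nu * y <= eta * n0 / 4 * y)%R) by nra.
apply Rabs_le; split.
- assert (- (nu * y) * 2 <= (n - n0 * y) * q)%R by nra.
  assert (- (n0 * y * (eta / 2)) <= n0 * y * (q - 1))%R by nra.
  nra.
- assert ((n - n0 * y) * q <= nu * y * 2)%R by nra.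
  assert (n0 * y * (q - 1) <= n0 * y * (eta / 2))%R by nra.
  nra.
Qed.

Lemma abs_profile_ge0 (p e : C) : (0 <= Im e)%R -> (0 <= abs_profile p e)%R.
Proof.
intros H; unfold abs_profile; destruct (Req_dec (Cmod (e - p)) 0) as [E|E].
- rewrite E; simpl; rewrite Rmult_0_l, Rdiv_0; lra.
- apply Rdiv_le_0_compat; [assumption|].
  pose proof (Cmod_ge_0 (e - p)); apply pow_lt; lra.
Qed.

Lemma Qabs_uniform (l : nat) (eb : C) (f : C * C -> C) (ep : C -> C) :
  (1 <= l)%nat -> off_cut eb ->
  is_mie_denom_extension l eb f -> is_plasmonic_singularity l eb f ep ->
  forall B eta, (0 < eta)%R -> exists r, (0 < r)%R /\ forall (t : R), (0 < t < r)%R ->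
    forall e : C, passive e -> (Cmod e <= B)%R ->
    (Rabs (Qabs l eb t e - Qabs_approx l eb (ep (RtoC t)) t e)
     <= eta * Qabs_approx l eb (ep (RtoC t)) t e)%R.
Proof.
intros Hl Hcut Hf Hep B eta Heta.
assert (Heb := off_cut_neq_0 eb Hcut).
set (d := Rmin (/ 4) (eta / 12)).
assert (Hd : (0 < d)%R) by (apply Rmin_pos; lra).
destruct (denomF_pole_approx l eb f ep Hl Heb Hf Hep B d Hd) as (r1 & Hr1 & H1).
destruct (absN_approx B l) as (M & HM & H2).
assert (Hn0 := absN0_pos l).
set (r2 := (eta * absN0 l / 4 / (M + 1))%R).
assert (Hr2 : (0 < r2)%R) by (apply Rdiv_lt_0_compat; nra).
exists (Rmin (Rmin 1 r1) r2); split; [repeat apply Rmin_pos; lra|].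
intros t [Ht0 Ht] e [Hpe1 Hpe2] HeB.
assert (Hta := Rlt_le_trans _ _ _ Ht (Rmin_l _ _)).
assert (Htr2 := Rlt_le_trans _ _ _ Ht (Rmin_r _ _)).
assert (Ht1 := Rlt_le_trans _ _ _ Hta (Rmin_l _ _)).
assert (Htr1 := Rlt_le_trans _ _ _ Hta (Rmin_r _ _)).
assert (He := off_cut_neq_0 e Hpe2).
specialize (H1 t e (conj Ht0 Htr1) HeB He).
specialize (H2 t e ltac:(lra) HeB).
set (p := ep (RtoC t)) in *.
rewrite Qabs_eq, Qabs_approx_eq by assumption.
assert (HK := absK_pos l eb t Hl Hcut Ht0).
set (K := absK l eb t) in *.
set (F := denomF l eb (RtoC t) e) in *.
rewrite (Rmult_assoc K (absN0 l)), <- Rmult_minus_distr_l, Rabs_mult, (Rabs_pos_eq K) by lra.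
replace (eta * (K * (absN0 l * abs_profile p e)))%R
  with (K * (eta * (absN0 l * abs_profile p e)))%R by ring.
apply Rmult_le_compat_l; [lra|].
unfold abs_profile.
(* At the pole the relative bound forces [denomF] to vanish, and both cross sections are 0 by the
   convention for division. *)
destruct (Ceq_dec (e - p) 0) as [E|E].
- rewrite E in H1 |- *; rewrite Cmod_0, Rmult_0_r in H1.
  assert (EF : Cmod F = 0%R).
  { apply Rle_antisym; [|apply Cmod_ge_0]; replace F with (F - 0) by ring; exact H1. }
  rewrite EF, Cmod_0; simpl; rewrite !Rmult_0_l, !Rdiv_0, Rmult_0_r, Rminus_0_r, Rabs_R0; lra.
- assert (Hw := proj1 (Cmod_gt_0 _) E); set (w := Cmod (e - p)) in *.
  set (phi := (Cmod F / w)%R).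
  assert (Hphi : (Rabs (phi - 1) <= d)%R).
  { pose proof (Cmod_minus_rev F (e - p)) as Ha.
    pose proof (Cmod_minus_rev (e - p) F) as Hb.
    replace (e - p - F) with (- (F - (e - p))) in Hb by ring; rewrite Cmod_opp in Hb.
    fold w in Ha, Hb.
    assert (Hphiw : (phi * w = Cmod F)%R) by (unfold phi; field; lra).
    apply Rabs_le; split; nra. }
  replace (absN l t e / Cmod F ^ 2)%R with (absN l t e / phi ^ 2 * / w ^ 2)%R.
  2: { unfold phi.
       destruct (Req_dec (Cmod F) 0) as [E0|E0].
       - rewrite E0; unfold Rdiv; rewrite !Rmult_0_l; simpl; rewrite !Rmult_0_l, Rinv_0; ring.
       - field; split; lra. }
  replace (absN0 l * (Im e / w ^ 2))%R with (absN0 l * Im e * / w ^ 2)%R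
    by (unfold Rdiv; ring).
  assert (Hw2 : (0 < / w ^ 2)%R) by (apply Rinv_0_lt_compat, pow_lt; lra).
  rewrite <- Rmult_minus_distr_r, Rabs_mult, (Rabs_pos_eq (/ w ^ 2)), <- Rmult_assoc by lra.
  apply Rmult_le_compat_r; [lra|].
  rewrite (Rabs_pos_eq (Im e)) in H2 by assumption.
  apply relative_error with (nu := (M * t)%R) (d := d); try assumption.
  + unfold r2 in Htr2; apply Rlt_div_r in Htr2; [|lra]; nra.
  + apply Rmin_l.
  + apply Rmin_r.
Qed.

(** * The optimal permittivity *)

(** Reflection identity. Divided by [Im e > 0] it shows that the reciprocal of the profile is
    [4 |Im p|] plus a nonnegative term vanishing only at the conjugate of [p]: the maximum and its
    stability are both read off from it. *)
Lemma Cmod_conj_diff (p e : C) :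
  (Cmod (e - p) ^ 2 = Cmod (e - Cconj p) ^ 2 + 4 * (- Im p) * Im e)%R.
Proof.
rewrite !Cmod2_alt; destruct e as [x y], p as [a b]; unfold Re, Im; simpl; ring.
Qed.

Lemma Cmod_sub_ge_Im (p e : C) :
  (Im p < 0)%R -> (0 <= Im e)%R -> (Im p * Im p <= Cmod (e - p) ^ 2)%R.
Proof.
intros Hp He; rewrite Cmod2_alt, <- (Rplus_0_l (Im p * Im p)%R).
apply Rplus_le_compat; [apply pow2_ge_0|].
change (Im (e - p)) with (Im e + - Im p)%R; nra.
Qed.

Lemma abs_profile_conj (p : C) :
  (Im p < 0)%R -> abs_profile p (Cconj p) = (/ (4 * - Im p))%R.
Proof.
intros Hp; unfold abs_profile; rewrite Cmod_conj_diff, im_conj.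
replace (Cconj p - Cconj p) with (RtoC 0) by ring; rewrite Cmod_0.
field; lra.
Qed.

Lemma abs_profile_max (p e : C) :
  (Im p < 0)%R -> (0 <= Im e)%R -> (abs_profile p e <= abs_profile p (Cconj p))%R.
Proof.
intros Hp He; rewrite abs_profile_conj by assumption; unfold abs_profile.
assert (Hc := Cmod_conj_diff p e); assert (Hi := Cmod_sub_ge_Im p e Hp He).
assert (0 <= Cmod (e - Cconj p) ^ 2)%R by (apply pow_le, Cmod_ge_0).
apply Rle_div_l; [nra|].
apply Rmult_le_reg_l with (4 * - Im p)%R; [lra|].
rewrite <- Rmult_assoc, Rinv_r, Rmult_1_l by lra; lra.
Qed.

(* [- Im p] is the half-width of the resonance. *)
Lemma abs_profile_near_max (p e : C) (kappa eta : R) :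
  (Im p < 0)%R -> (0 <= Im e)%R -> (0 < kappa <= / 2)%R -> (0 < eta)%R ->
  (16 * kappa * (1 + eta) <= eta * eta)%R ->
  ((1 - kappa) * abs_profile p (Cconj p) <= (1 + kappa) * abs_profile p e)%R ->
  (Cmod (e - Cconj p) <= eta * - Im p)%R.
Proof.
intros Hp He Hk Heta Hke H.
rewrite abs_profile_conj in H by assumption; unfold abs_profile in H.
assert (Hc := Cmod_conj_diff p e); assert (Hi := Cmod_sub_ge_Im p e Hp He).
assert (Hd := Im_le_Cmod (e - Cconj p)).
change (Im (e - Cconj p)) with (Im e + - Im (Cconj p))%R in Hd.
rewrite im_conj, Ropp_involutive in Hd; apply Rabs_le_between in Hd.
assert (Hd0 := Cmod_ge_0 (e - Cconj p)).
set (b := (- Im p)%R) in *; set (y := Im e) in *; set (D := Cmod (e - Cconj p)) in *.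
set (W := (Cmod (e - p) ^ 2)%R) in *.
assert (Hb : (0 < b)%R) by (unfold b; lra).
assert (HW : (0 < W)%R) by nra.
assert (H2 : ((1 - kappa) * W <= (1 + kappa) * y * (4 * b))%R).
{ apply Rmult_le_compat_r with (r := (4 * b * W)%R) in H; [|nra].
  replace ((1 - kappa) * / (4 * b) * (4 * b * W))%R with ((1 - kappa) * W)%R in H
    by (field; lra).
  replace ((1 + kappa) * (y / W) * (4 * b * W))%R with ((1 + kappa) * y * (4 * b))%R in H
    by (field; lra).
  exact H. }
simpl in Hc.
(* The reflection identity makes the terms [4 b y] almost cancel in [H2], leaving
   [(1 - kappa) D^2 <= 8 kappa b y]. *)
assert (H3 : (D * D <= 16 * kappa * b * y)%R).
{ assert ((1 - kappa) * (D * D) <= 8 * kappa * b * y)%R by nra.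
  assert (/ 2 * (D * D) <= (1 - kappa) * (D * D))%R by nra.
  lra. }
(* Since [y <= b + D], this bounds [D^2] by [16 kappa (b^2 + b D)]. If [D > eta b], then
   [eta^2 (b^2 + b D) < (1 + eta) D^2], and the condition on [kappa] is exactly what contradicts
   this. *)
assert (Hyb : (y <= b + D)%R) by (unfold b in *; lra).
destruct (Rle_dec D (eta * b)) as [|Hn]; [assumption|exfalso].
apply Rnot_le_lt in Hn.
assert (H4 : (D * D <= 16 * kappa * (b * b + b * D))%R).
{ assert (0 <= 16 * kappa * b)%R by nra; nra. }
assert (Hx : (0 < eta * b)%R) by now apply Rmult_lt_0_compat.
assert (H5 : (eta * b * (eta * b) < D * D)%R) by (apply Rmult_le_0_lt_compat; lra).
assert (H6 : (eta * b * D < D * D)%R) by (apply Rmult_lt_compat_r; lra).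
assert (H7 : (eta * eta * (b * b + b * D) < (1 + eta) * (D * D))%R).
{ replace (eta * eta * (b * b + b * D))%R
    with (eta * b * (eta * b) + eta * (eta * b * D))%R by ring.
  assert (eta * (eta * b * D) < eta * (D * D))%R by (apply Rmult_lt_compat_l; lra).
  lra. }
assert (HD : (0 < D * D)%R) by nra.
assert (H8 : (eta * eta * (D * D) <= 16 * kappa * (eta * eta * (b * b + b * D)))%R).
{ replace (16 * kappa * (eta * eta * (b * b + b * D)))%R
    with (eta * eta * (16 * kappa * (b * b + b * D)))%R by ring.
  apply Rmult_le_compat_l; [nra | assumption]. }
assert (H9 : (16 * kappa * (eta * eta * (b * b + b * D))
  < 16 * kappa * ((1 + eta) * (D * D)))%R) by (apply Rmult_lt_compat_l; lra).
assert (H10 : (16 * kappa * (1 + eta) * (D * D) <= eta * eta * (D * D))%R)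
  by (apply Rmult_le_compat_r; lra).
lra.
Qed.

(** If the supremum [M] is not attained, every point of the plane has a radius [delta] with
    [g < M - delta] on the nearby part of [K]; off [K], closedness makes this vacuous. Compactness
    of the square bounds [delta] below, contradicting the supremum. Only upper semicontinuity of [g]
    enters. *)
Lemma max_on_compact (K : C -> Prop) (g : C -> R) (B G : R) :
  (exists x, K x) -> (forall x, K x -> (Cmod x <= B)%R) -> (forall x, K x -> (g x <= G)%R) ->
  (forall x, ~ K x -> exists d, (0 < d)%R /\ forall y, (Cmod (y - x) < d)%R -> ~ K y) ->
  (forall x, K x -> forall e, (0 < e)%R -> exists d, (0 < d)%R /\
     forall y, K y -> (Cmod (y - x) < d)%R -> (g y < g x + e)%R) ->
  exists x, K x /\ forall y, K y -> (g y <= g x)%R.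
Proof.
intros [x0 Hx0] HB HG Hclosed Hcont.
destruct (completeness (fun v => exists x, K x /\ v = g x)) as [M [HM1 HM2]].
{ exists G; intros v (x & Hx & ->); auto. }
{ exists (g x0), x0; auto. }
destruct (classic (exists x, K x /\ (M <= g x)%R)) as [(x & Hx & HMx)|Hno].
{ exists x; split; [assumption|]; intros y Hy.
  apply Rle_trans with M; [|assumption]; apply HM1; exists y; auto. }
exfalso.
assert (Hlt : forall x, K x -> (g x < M)%R).
{ intros x Hx; apply Rnot_le_lt; intros H; apply Hno; exists x; auto. }
assert (Hdelta : forall u v : R, exists d : posreal,
  forall y, (Rabs (Re y - u) < d)%R -> (Rabs (Im y - v) < d)%R -> K y -> (g y < M - d)%R).
{ intros u v.
  assert (Hball : forall (y : C) (d : R), (Rabs (Re y - u) < d / 2)%R ->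
    (Rabs (Im y - v) < d / 2)%R -> (Cmod (y - (u, v)) < d)%R).
  { intros y d H1 H2; eapply Rle_lt_trans; [apply Cmod_le_Re_Im|].
    change (Rabs (Re y - u) + Rabs (Im y - v) < d)%R; lra. }
  destruct (classic (K (u, v))) as [Huv|Huv].
  - assert (H := Hlt _ Huv).
    destruct (Hcont _ Huv ((M - g (u, v)) / 2)%R ltac:(lra)) as (d & Hd & Hg).
    assert (Hm : (0 < Rmin (d / 2) ((M - g (u, v)) / 2))%R) by (apply Rmin_pos; lra).
    exists (mkposreal _ Hm); simpl; intros y H1 H2 Hy.
    pose proof (Rmin_l (d / 2) ((M - g (u, v)) / 2)).
    pose proof (Rmin_r (d / 2) ((M - g (u, v)) / 2)).
    assert (g y < g (u, v) + (M - g (u, v)) / 2)%R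
      by (apply Hg; [assumption | apply Hball; lra]).
    lra.
  - destruct (Hclosed _ Huv) as (d & Hd & Hg).
    assert (Hm : (0 < d / 2)%R) by lra.
    exists (mkposreal _ Hm); simpl; intros y H1 H2 Hy; exfalso.
    apply (Hg y); [now apply Hball | assumption]. }
(* The compactness result expects the gauge as a function, so the radii are chosen here. *)
set (delta := fun u v => proj1_sig (constructive_indefinite_description _ (Hdelta u v))).
destruct (compactness_value_2d (- B) B (- B) B delta) as [d0 Hd0].
assert (Hy : exists y, K y /\ (M - d0 < g y)%R).
{ apply NNPP; intros Hn; assert (H : (M <= M - d0)%R).
  { apply HM2; intros v (x & Hx & ->); apply Rnot_lt_le; intros H; apply Hn.
    exists x; auto. }
  pose proof (cond_pos d0); lra. }
destruct Hy as (y & Hy & Hgy).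
assert (HBy := HB y Hy).
apply (Hd0 (Re y) (Im y)).
- pose proof (re_le_Cmod y) as H; apply Rabs_le_between in H; lra.
- pose proof (Im_le_Cmod y) as H; apply Rabs_le_between in H; lra.
- intros (u & v & _ & _ & H1 & H2 & H3); unfold delta in *.
  destruct (constructive_indefinite_description _ (Hdelta u v)) as [d Hd]; simpl in *.
  specialize (Hd y H1 H2 Hy); lra.
Qed.

(** * Continuity of the cross section in the permittivity *)

Lemma Ccontinuous_conj (f : C -> C) (z : C) :
  Ccontinuous f z -> Ccontinuous (fun y => Cconj (f y)) z.
Proof.
intros Hf e He; destruct (Hf e He) as (d & Hd & H); exists d; split; [assumption|].
intros y Hy; rewrite <- Cminus_conj, Cmod_conj; auto.
Qed.

Lemma Ccontinuous_opp (f : C -> C) (z : C) :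
  Ccontinuous f z -> Ccontinuous (fun y => - f y) z.
Proof.
intros Hf e He; destruct (Hf e He) as (d & Hd & H); exists d; split; [assumption|].
intros y Hy; replace (- f y - - f z) with (- (f y - f z)) by ring.
rewrite Cmod_opp; auto.
Qed.

Ltac solve_Ccontinuous :=
  repeat first [apply Ccontinuous_const | apply Ccontinuous_id
    | apply Ccontinuous_plus | apply Ccontinuous_mult | apply Ccontinuous_opp
    | apply Ccontinuous_conj
    | match goal with |- Ccontinuous (fun y => entire_fun ?a (@?g y)) ?z =>
        apply (Ccontinuous_comp g (entire_fun a));
        [|apply Ccontinuous_entire_fun; solve [solve_entire]] end ].

Lemma Ccontinuous_denomF (l : nat) (eb z e : C) : Ccontinuous (denomF l eb z) e.
Proof.
unfold denomF, J, JD, Y, YD, Cminus.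
set (X := (z * Csqrt eb) ^ (2 * l + 1)); set (Z := z ^ 2).
solve_Ccontinuous.
Qed.

Lemma Qabs_continuous (l : nat) (eb e : C) (t : R) :
  (1 <= l)%nat -> (0 < t)%R -> eb <> 0 -> e <> 0 -> off_cut eb ->
  denomF l eb (RtoC t) e <> 0 ->
  forall eta, (0 < eta)%R -> exists d, (0 < d)%R /\
    forall y : C, y <> 0 -> (Cmod (y - e) < d)%R ->
    (Rabs (Qabs l eb t y - Qabs l eb t e) < eta)%R.
Proof.
intros Hl Ht Heb He Hcut HF eta Heta.
set (F := denomF l eb (RtoC t)) in *.
set (G := fun y : C => y * (RtoC (INR l + 1) * J l (RtoC t ^ 2 * y) * Cconj (J (l - 1) (RtoC t ^ 2 * y))
  + RtoC (INR l * t ^ 4) * (y * Cconj y) * J (l + 2) (RtoC t ^ 2 * y)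
         * Cconj (J (l + 1) (RtoC t ^ 2 * y)))).
(* Writing [|F|^2] as [F conj(F)] presents the cross section as a constant times the imaginary part
   of a continuous complex function. *)
set (H := fun y => G y * / (F y * Cconj (F y))).
assert (HK := absK_pos l eb t Hl Hcut Ht).
assert (EQ : forall y : C, y <> 0 -> Qabs l eb t y = (absK l eb t * Im (H y))%R).
{ intros y Hy; rewrite Qabs_eq by assumption; f_equal.
  unfold H; rewrite <- Cmod2_conj; fold F.
  assert (EG : absN l t y = Im (G y)).
  { unfold absN, G; rewrite <- Cmod2_conj, (RtoC_mult (INR l * t ^ 4)); reflexivity. }
  rewrite EG.
  destruct (Req_dec (Cmod (F y) ^ 2) 0) as [E|E].
  - rewrite E, Rdiv_0.
    replace (G y * / RtoC 0) with (RtoC 0) by (symmetry; apply Cdiv_0); reflexivity.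
  - rewrite <- RtoC_inv, Cmult_comm, Im_RtoC_mult by assumption; unfold Rdiv; ring. }
assert (HC : Ccontinuous H e).
{ assert (CF : Ccontinuous F e) by apply Ccontinuous_denomF.
  apply Ccontinuous_mult.
  - unfold G, J; set (Z := RtoC t ^ 2); solve_Ccontinuous.
  - apply (Ccontinuous_comp (fun y => F y * Cconj (F y)) Cinv).
    + apply Ccontinuous_mult; [assumption | now apply Ccontinuous_conj].
    + apply Ccontinuous_inv; rewrite <- Cmod2_conj; apply RtoC_neq_0, pow_nonzero.
      pose proof (proj1 (Cmod_gt_0 _) HF); lra. }
destruct (HC (eta / absK l eb t)%R) as (d & Hd & HD); [now apply Rdiv_lt_0_compat|].
exists d; split; [assumption|]; intros y Hy Hye.
rewrite !EQ, <- Rmult_minus_distr_l, Rabs_mult, Rabs_pos_eq by (assumption || lra).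
specialize (HD y Hye); apply Rlt_div_r in HD; [|assumption].
pose proof (Im_le_Cmod (H y - H e)) as HI.
change (Rabs (Im (H y) - Im (H e)) <= Cmod (H y - H e))%R in HI.
nra.
Qed.

Lemma Qabs_max (l : nat) (eb : C) (f : C * C -> C) (ep : C -> C) :
  (1 <= l)%nat -> off_cut eb -> (0 <= Im eb)%R ->
  is_mie_denom_extension l eb f -> is_plasmonic_singularity l eb f ep ->
  forall B eta, (Cmod (static_pole l eb) < B)%R -> (0 < eta)%R ->
  exists r, (0 < r)%R /\ forall t : R, (0 < t < r)%R ->
    let D := fun e => passive e /\ (Cmod e <= B)%R in
    (exists e, is_max_on D (Qabs l eb t) e) /\
    (forall e, is_max_on D (Qabs l eb t) e ->
       (Cmod (e - eps_opt ep t) <= eta * Im (eps_opt ep t))%R).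
Proof.
intros Hl Hcut Him Hf Hep B eta HB Heta.
assert (Heb := off_cut_neq_0 eb Hcut).
(* The relative error allowed for [Qabs], chosen to meet the conditions of
   [abs_profile_near_max]. *)
set (kappa := Rmin (/ 2) (eta * eta / (16 * (1 + eta)))).
assert (Hk0 : (0 < kappa)%R).
{ apply Rmin_pos; [lra|]; apply Rdiv_lt_0_compat; nra. }
assert (Hk1 : (kappa <= / 2)%R) by apply Rmin_l.
assert (Hk2 : (16 * kappa * (1 + eta) <= eta * eta)%R).
{ assert (H := Rmin_r (/ 2) (eta * eta / (16 * (1 + eta)))); fold kappa in H.
  apply Rle_div_r in H; lra. }
destruct (Qabs_uniform l eb f ep Hl Hcut Hf Hep B kappa Hk0) as (r1 & Hr1 & H1).
destruct (Im_pole_neg l eb f ep Hl Hcut Him Hf Hep) as (r2 & Hr2 & H2).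
destruct (proj1 (plasmonic_local l eb f ep Hep) (B - Cmod (static_pole l eb))%R ltac:(lra))
  as (r3 & Hr3 & H3).
destruct (denomF_pole_approx l eb f ep Hl Heb Hf Hep B (/ 2) ltac:(lra)) as (r4 & Hr4 & H4).
exists (Rmin (Rmin r1 r2) (Rmin r3 r4)); split; [repeat apply Rmin_pos; lra|].
intros t [Ht0 Ht].
assert (Hta := Rlt_le_trans _ _ _ Ht (Rmin_l _ _)).
assert (Htb := Rlt_le_trans _ _ _ Ht (Rmin_r _ _)).
assert (Ht1 := Rlt_le_trans _ _ _ Hta (Rmin_l _ _)).
assert (Ht2 := Rlt_le_trans _ _ _ Hta (Rmin_r _ _)).
assert (Ht3 := Rlt_le_trans _ _ _ Htb (Rmin_l _ _)).
assert (Ht4 := Rlt_le_trans _ _ _ Htb (Rmin_r _ _)).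
specialize (H1 t (conj Ht0 Ht1)); specialize (H2 t (conj Ht0 Ht2)).
specialize (H3 (RtoC t)); rewrite Cmod_R, Rabs_pos_eq in H3 by lra; specialize (H3 Ht3).
assert (H4' := fun e => H4 t e (conj Ht0 Ht4)).
intros D; unfold eps_opt; set (p := ep (RtoC t)) in *.
assert (HK := absK_pos l eb t Hl Hcut Ht0); assert (Hn0 := absN0_pos l).
set (A := (absK l eb t * absN0 l)%R).
assert (HA : (0 < A)%R) by (apply Rmult_lt_0_compat; assumption).
assert (HQ : forall e, D e ->
  (A * ((1 - kappa) * abs_profile p e) <= Qabs l eb t e
   <= A * ((1 + kappa) * abs_profile p e))%R).
{ intros e [He1 He2]; specialize (H1 e He1 He2).
  rewrite Qabs_approx_eq in H1 by assumption; fold A in H1.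
  apply Rabs_le_between in H1; lra. }
assert (Hup : forall e, (0 < Im e)%R -> off_cut e) by (intros e He [H _]; lra).
assert (HpI : (0 < Im (Cconj p))%R) by (rewrite im_conj; lra).
assert (HpD : D (Cconj p)).
{ split; [split; [lra | now apply Hup]|].
  rewrite Cmod_conj; pose proof (Cmod_minus_rev p (static_pole l eb)); lra. }
assert (HQp := HQ _ HpD); rewrite abs_profile_conj in HQp by assumption.
split.
(* The passive set is not closed, since the cut is removed, so the maximum is sought at height at
   least [|Im p| / 16]. Below that height the profile is at most [1 / (16 |Im p|)], a quarter of its
   peak, and with [kappa <= 1/2] such points stay below the value at the conjugate of [p]. *)
- set (K := fun e : C => (Cmod e <= B)%R /\ (- Im p / 16 <= Im e)%R).
  assert (HKD : forall e, K e -> D e /\ e <> 0).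
  { intros e [Ha Hb].
    assert (off_cut e) by (apply Hup; lra).
    split; [split; [split; [lra | assumption] | assumption]|].
    now apply off_cut_neq_0. }
  assert (Hmax : exists e, K e /\ forall y, K y -> (Qabs l eb t y <= Qabs l eb t e)%R).
  { apply max_on_compact with (B := B)
      (G := (A * ((1 + kappa) * abs_profile p (Cconj p)))%R).
    - exists (Cconj p); split; [apply HpD | rewrite im_conj; lra].
    - now intros x [Hx _].
    - intros x Hx; destruct (HKD x Hx) as [Hx1 _].
      eapply Rle_trans; [apply HQ; assumption|].
      apply Rmult_le_compat_l; [lra|]; apply Rmult_le_compat_l; [lra|].
      apply abs_profile_max; [assumption | apply Hx1].
    - intros x Hx; destruct (Rle_dec (Cmod x) B) as [Hx1|Hx1].
      + assert (Hx2 : (Im x < - Im p / 16)%R)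
          by (apply Rnot_le_lt; intros H; apply Hx; now split).
        exists (- Im p / 16 - Im x)%R; split; [lra|]; intros y Hy [_ Hy2].
        pose proof (Im_le_Cmod (y - x)) as H.
        change (Rabs (Im y - Im x) <= Cmod (y - x))%R in H.
        apply Rabs_le_between in H; lra.
      + exists (Cmod x - B)%R; split; [lra|]; intros y Hy [Hy1 _].
        pose proof (Cmod_minus_rev x y) as H.
        replace (x - y) with (- (y - x)) in H by ring; rewrite Cmod_opp in H; lra.
    - intros x Hx e He; destruct (HKD x Hx) as [Hx1 Hx2].
      (* A zero of [denomF] would give [|x - p| <= |x - p| / 2], hence [x = p], but [x] lies above
         the real axis and [p] below it. *)
      assert (HF : denomF l eb (RtoC t) x <> 0).
      { intros E; specialize (H4' x (proj2 Hx1) Hx2); rewrite E in H4'; fold p in H4'.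
        replace (0 - (x - p)) with (- (x - p)) in H4' by ring; rewrite Cmod_opp in H4'.
        pose proof (Cmod_sub_ge_Im p x H2 (proj1 (proj1 Hx1))) as H.
        assert (Cmod (x - p) = 0)%R by (pose proof (Cmod_ge_0 (x - p)); lra).
        rewrite H0 in H; nra. }
      destruct (Qabs_continuous l eb x t Hl Ht0 Heb Hx2 Hcut HF e He) as (d & Hd & HC).
      exists d; split; [assumption|]; intros y Hy Hyx.
      specialize (HC y (proj2 (HKD y Hy)) Hyx); apply Rabs_def2 in HC; lra. }
  destruct Hmax as (x & Hx & Hmax); exists x; split; [now apply HKD|].
  intros y Hy; destruct (Rle_dec (- Im p / 16) (Im y)) as [Hy1|Hy1].
  + apply Hmax; split; [apply Hy | assumption].
  + apply Rle_trans with (Qabs l eb t (Cconj p)).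
    2: { apply Hmax; split; [apply HpD | rewrite im_conj; lra]. }
    eapply Rle_trans; [apply HQ; assumption|].
    eapply Rle_trans; [|apply HQp].
    apply Rmult_le_compat_l; [lra|].
    destruct Hy as [[Hy2 _] _].
    pose proof (Cmod_sub_ge_Im p y H2 Hy2) as H.
    assert (Hpr : (abs_profile p y <= / (16 * - Im p))%R).
    { unfold abs_profile; apply Rle_div_l; [nra|].
      apply Rmult_le_reg_l with (16 * - Im p)%R; [lra|].
      rewrite <- Rmult_assoc, Rinv_r, Rmult_1_l by lra; nra. }
    assert (Hge := abs_profile_ge0 p y Hy2).
    replace (/ (4 * - Im p))%R with (4 * / (16 * - Im p))%R by (field; lra).
    nra.
- intros e [HeD Hemax].
  assert (H := Hemax _ HpD).
  rewrite im_conj; apply abs_profile_near_max with (kappa := kappa); try assumption.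
  + apply HeD.
  + now split.
  + rewrite abs_profile_conj by assumption.
    apply Rmult_le_reg_l with A; [assumption|].
    eapply Rle_trans; [apply HQp|]; eapply Rle_trans; [apply H|]; now apply HQ.
Qed.

(** * Expansion of the pole for the dipole and the quadrupole *)

(** The radius is at most 1 so that a higher order implies every lower one. *)
Definition Oat (n : nat) (g : R -> C) : Prop :=
  exists r M, (0 < r <= 1)%R /\ (0 <= M)%R /\
    forall t, (0 < t < r)%R -> (Cmod (g t) <= M * t ^ n)%R.

Lemma Oat_plus (n : nat) (g h : R -> C) :
  Oat n g -> Oat n h -> Oat n (fun t => g t + h t).
Proof.
intros (r & M & Hr & HM & H) (r' & M' & Hr' & HM' & H').
pose proof (Rmin_l r r'); pose proof (Rmin_r r r').
exists (Rmin r r'), (M + M')%R; split; [split; [apply Rmin_pos|]; lra|].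
split; [lra|]; intros t Ht.
eapply Rle_trans; [apply Cmod_triangle|].
specialize (H t ltac:(lra)); specialize (H' t ltac:(lra)); lra.
Qed.

Lemma Oat_mult (n m : nat) (g h : R -> C) :
  Oat n g -> Oat m h -> Oat (n + m) (fun t => g t * h t).
Proof.
intros (r & M & Hr & HM & H) (r' & M' & Hr' & HM' & H').
pose proof (Rmin_l r r'); pose proof (Rmin_r r r').
exists (Rmin r r'), (M * M')%R; split; [split; [apply Rmin_pos|]; lra|].
split; [nra|]; intros t Ht.
rewrite Cmod_mult, pow_add.
replace (M * M' * (t ^ n * t ^ m))%R with (M * t ^ n * (M' * t ^ m))%R by ring.
apply Rmult_le_compat; auto using Cmod_ge_0; [apply H | apply H']; lra.
Qed.

Lemma Oat_opp (n : nat) (g : R -> C) : Oat n g -> Oat n (fun t => - g t).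
Proof.
intros (r & M & Hr & HM & H); exists r, M; split; [assumption|]; split; [assumption|].
intros t Ht; rewrite Cmod_opp; auto.
Qed.

Lemma Oat_minus (n : nat) (g h : R -> C) :
  Oat n g -> Oat n h -> Oat n (fun t => g t - h t).
Proof. intros Hg Hh; now apply Oat_plus, Oat_opp. Qed.

Lemma Oat_const (c : C) : Oat 0 (fun _ => c).
Proof.
exists 1%R, (Cmod c); split; [lra|]; split; [apply Cmod_ge_0|].
intros t Ht; simpl; lra.
Qed.

Lemma Oat_t (n : nat) : Oat n (fun t => RtoC t ^ n).
Proof.
exists 1%R, 1%R; split; [lra|]; split; [lra|].
intros t Ht; rewrite Cmod_pow, Cmod_R, Rabs_pos_eq; lra.
Qed.

Lemma Oat_weaken (m n : nat) (g : R -> C) : Oat m g -> (n <= m)%nat -> Oat n g.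
Proof.
intros (r & M & Hr & HM & H) Hmn.
exists r, M; split; [assumption|]; split; [assumption|]; intros t Ht.
eapply Rle_trans; [now apply H|]; apply Rmult_le_compat_l; [assumption|].
replace m with (n + (m - n))%nat by lia; rewrite pow_add.
assert (0 < t ^ n)%R by (apply pow_lt; lra).
assert (t ^ (m - n) <= 1)%R by (rewrite <- (pow1 (m - n)); apply pow_incr; lra).
nra.
Qed.

Lemma Oat_ext (n : nat) (g h : R -> C) :
  (exists r, (0 < r)%R /\ forall t, (0 < t < r)%R -> h t = g t) -> Oat n g -> Oat n h.
Proof.
intros (r & Hr & E) (r' & M & Hr' & HM & H).
pose proof (Rmin_l r r'); pose proof (Rmin_r r r').
exists (Rmin r r'), M; split; [split; [apply Rmin_pos|]; lra|].
split; [assumption|]; intros t Ht; rewrite E by lra; apply H; lra.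
Qed.

Lemma Oat_entire_fun (a : nat -> R) (v : R -> C) :
  entire_coeffs a -> Oat 0 v -> Oat 0 (fun t => entire_fun a (RtoC t ^ 2 * v t)).
Proof.
intros Ha (r & M & Hr & HM & H).
exists r, (2 * abs_sum a M)%R; split; [assumption|].
split; [pose proof (abs_sum_ge0 a M Ha HM); lra|]; intros t Ht.
rewrite pow_O, Rmult_1_r; apply entire_fun_bound; [assumption|].
rewrite Cmod_mult, Cmod_pow, Cmod_R, Rabs_pos_eq by lra.
specialize (H t Ht); rewrite pow_O, Rmult_1_r in H.
pose proof (Cmod_ge_0 (v t)).
assert (t ^ 2 <= 1)%R by (simpl; nra); assert (0 <= t ^ 2)%R by (simpl; nra); nra.
Qed.

Lemma Oat_entire_1 (a : nat -> R) (v : R -> C) :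
  entire_coeffs a -> Oat 0 v ->
  Oat 2 (fun t => entire_fun a (RtoC t ^ 2 * v t) - RtoC (a 0%nat)).
Proof.
intros Ha Hv.
apply (Oat_ext 2 (fun t => RtoC t ^ 2 * (v t * entire_fun (shift a) (RtoC t ^ 2 * v t)))).
- exists 1%R; split; [lra|]; intros t _.
  rewrite (entire_fun_incr a) by assumption; unfold shift; ring.
- apply (Oat_mult 2 0); [apply Oat_t|]; apply (Oat_mult 0 0); [assumption|].
  apply Oat_entire_fun; [now apply entire_coeffs_shift | assumption].
Qed.

Lemma Oat_entire_2 (a : nat -> R) (v : R -> C) :
  entire_coeffs a -> Oat 0 v ->
  Oat 4 (fun t => entire_fun a (RtoC t ^ 2 * v t)
    - (RtoC (a 0%nat) + RtoC (a 1%nat) * (RtoC t ^ 2 * v t))).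
Proof.
intros Ha Hv.
assert (Hs := entire_coeffs_shift a Ha); fold (shift a) in Hs.
apply (Oat_ext 4 (fun t => RtoC t ^ 2 * (v t *
   (entire_fun (shift a) (RtoC t ^ 2 * v t) - RtoC (shift a 0%nat))))).
- exists 1%R; split; [lra|]; intros t _.
  rewrite (entire_fun_incr a) by assumption; unfold shift; ring.
- apply (Oat_mult 2 2); [apply Oat_t|]; apply (Oat_mult 0 2); [assumption|].
  now apply Oat_entire_1.
Qed.

Lemma Oat_entire_3 (a : nat -> R) (v : R -> C) :
  entire_coeffs a -> Oat 0 v ->
  Oat 6 (fun t => entire_fun a (RtoC t ^ 2 * v t)
    - (RtoC (a 0%nat) + RtoC (a 1%nat) * (RtoC t ^ 2 * v t)
       + RtoC (a 2%nat) * (RtoC t ^ 2 * v t) ^ 2)).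
Proof.
intros Ha Hv.
assert (Hs := entire_coeffs_shift a Ha); fold (shift a) in Hs.
apply (Oat_ext 6 (fun t => RtoC t ^ 2 * (v t *
   (entire_fun (shift a) (RtoC t ^ 2 * v t)
     - (RtoC (shift a 0%nat) + RtoC (shift a 1%nat) * (RtoC t ^ 2 * v t)))))).
- exists 1%R; split; [lra|]; intros t _.
  rewrite (entire_fun_incr a) by assumption; unfold shift; ring.
- apply (Oat_mult 2 4); [apply Oat_t|]; apply (Oat_mult 0 4); [assumption|].
  now apply Oat_entire_2.
Qed.

(* Orders are inferred bottom-up for products and compared at the end. *)
Ltac Oat_factor :=
  first [eassumption | eapply Oat_t | eapply Oat_const
    | eapply Oat_mult; [Oat_factor | Oat_factor]
    | eapply Oat_opp; Oat_factor ].
Ltac solve_Oat :=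
  first [apply Oat_plus; solve_Oat | apply Oat_minus; solve_Oat
    | eapply Oat_weaken; [solve [Oat_factor] | simpl; lia] ].

Lemma Oat_ep (l : nat) (eb : C) (f : C * C -> C) (ep : C -> C) :
  is_plasmonic_singularity l eb f ep -> Oat 0 (fun t => ep (RtoC t)).
Proof.
intros Hep.
destruct (proj1 (plasmonic_local l eb f ep Hep) 1%R Rlt_0_1) as (r & Hr & H).
pose proof (Rmin_l 1 r); pose proof (Rmin_r 1 r).
exists (Rmin 1 r), (Cmod (static_pole l eb) + 1)%R.
split; [split; [apply Rmin_pos|]; lra|].
pose proof (Cmod_ge_0 (static_pole l eb)).
split; [lra|]; intros t Ht; rewrite pow_O, Rmult_1_r.
specialize (H (RtoC t)); rewrite Cmod_R, Rabs_pos_eq in H by lra; specialize (H ltac:(lra)).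
pose proof (Cmod_minus_rev (ep (RtoC t)) (static_pole l eb)); lra.
Qed.

Lemma RtoC_Rdiv (p q : Z) : q <> 0%Z -> RtoC (IZR p / IZR q) = RtoC (IZR p) / RtoC (IZR q).
Proof. intros H; apply RtoC_div; now apply not_0_IZR. Qed.

Ltac coef_tac :=
  unfold jdcoef, ydcoef, jcoef, ycoef; simpl Nat.leb; cbv iota;
  rewrite !INR_IZR_INZ; simpl Z.of_nat; simpl; try lra; field.

Lemma coef1_values :
  (jcoef 1 0 = 1 / 3 /\ jcoef 1 1 = -1 / 30 /\ jdcoef 1 0 = 2 / 3 /\ jdcoef 1 1 = -2 / 15
   /\ ycoef 1 0 = -1 /\ ycoef 1 1 = -1 / 2 /\ ydcoef 1 0 = 1 /\ ydcoef 1 1 = -1 / 2)%R.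
Proof. repeat split; coef_tac. Qed.

Lemma coef2_values :
  (jcoef 2 0 = 1 / 15 /\ jcoef 2 1 = -1 / 210 /\ jcoef 2 2 = 1 / 7560
   /\ jdcoef 2 0 = 1 / 5 /\ jdcoef 2 1 = -1 / 42 /\ jdcoef 2 2 = 1 / 1080
   /\ ycoef 2 0 = -3 /\ ycoef 2 1 = -1 / 2 /\ ycoef 2 2 = -1 / 8
   /\ ydcoef 2 0 = 6 /\ ydcoef 2 1 = 0 /\ ydcoef 2 2 = -1 / 4)%R.
Proof. repeat split; coef_tac. Qed.

Ltac Cfield := field; repeat split; apply RtoC_neq_0; lra.

Lemma dipole_expansion (eb : C) (f : C * C -> C) (ep : C -> C) :
  eb <> 0 -> is_mie_denom_extension 1 eb f -> is_plasmonic_singularity 1 eb f ep ->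
  Oat 4 (fun t => ep (RtoC t) - (- 2 * eb - 12 / 5 * eb ^ 2 * RtoC t ^ 2
    - 2 * Ci * eb ^ 2 * Csqrt eb * RtoC t ^ 3)).
Proof.
intros Heb Hf Hep.
assert (He := Oat_ep 1 eb f ep Hep).
set (e := fun t : R => ep (RtoC t)).
change (Oat 0 e) in He.
set (v := fun _ : R => eb); assert (Hv : Oat 0 v) by apply Oat_const.
destruct coef1_values as (A0 & A1 & D0 & D1 & Y0 & Y1 & YD0 & YD1).
assert (HJ := Oat_entire_2 _ e (jcoef_entire 1) He); rewrite A0, A1 in HJ.
assert (HJD := Oat_entire_2 _ e (jdcoef_entire 1) He); rewrite D0, D1 in HJD.
assert (HY := Oat_entire_2 _ v (ycoef_entire 1) Hv); rewrite Y0, Y1 in HY.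
assert (HYD := Oat_entire_2 _ v (ydcoef_entire 1) Hv); rewrite YD0, YD1 in HYD.
assert (KJ := Oat_entire_1 _ e (jcoef_entire 1) He); rewrite A0 in KJ.
assert (KJD := Oat_entire_1 _ e (jdcoef_entire 1) He); rewrite D0 in KJD.
assert (LJ := Oat_entire_1 _ v (jcoef_entire 1) Hv); rewrite A0 in LJ.
assert (LJD := Oat_entire_1 _ v (jdcoef_entire 1) Hv); rewrite D0 in LJD.
assert (BY := Oat_entire_fun _ v (ycoef_entire 1) Hv).
assert (BYD := Oat_entire_fun _ v (ydcoef_entire 1) Hv).
assert (BJ := Oat_entire_fun _ v (jcoef_entire 1) Hv).
assert (BJD := Oat_entire_fun _ v (jdcoef_entire 1) Hv).
clear A0 A1 D0 D1 Y0 Y1 YD0 YD1.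
change (entire_fun (jcoef 1)) with (J 1) in *.
change (entire_fun (jdcoef 1)) with (JD 1) in *.
change (entire_fun (ycoef 1)) with (Y 1) in *.
change (entire_fun (ydcoef 1)) with (YD 1) in *.
unfold v in *; rewrite !RtoC_Rdiv in * by discriminate.
destruct (denomF_pole_zero 1 eb f ep (le_n 1) Heb Hf Hep) as (r & Hr & HF).
set (s := Csqrt eb).
assert (E1 : Oat 4 (fun t => (e t + 2 * eb)
   + RtoC t ^ 2 * (eb ^ 2 - 9 / 10 * e t * eb - e t ^ 2 / 10)
   + RtoC t ^ 3 * (Ci * s ^ 3 * (2 / 3) * (eb - e t)))).
(* As [denomF] vanishes at the pole, the truncated equation equals minus its truncation error, with
   prefactor [(2l+1)/l = 3]. Each product is split as [A B - A0 B0 = (A - A0) B + A0 (B - B0)]; the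
   explicit [t^4] terms are cross terms of the truncations. *)
{ apply (Oat_ext 4 (fun t => - (3) * (
    - eb * ((JD 1 (RtoC t ^ 2 * e t) - (2 / 3 + -2 / 15 * (RtoC t ^ 2 * e t)))
               * Y 1 (RtoC t ^ 2 * eb))
    - eb * (2 / 3 * (Y 1 (RtoC t ^ 2 * eb) - (-1 + -1 / 2 * (RtoC t ^ 2 * eb))))
    - eb * (-2 / 15 * (RtoC t ^ 2 * e t)
              * (Y 1 (RtoC t ^ 2 * eb) - (-1 + -1 / 2 * (RtoC t ^ 2 * eb))))
    - eb * (1 / 15 * (RtoC t ^ 4 * e t * eb))
    + e t * ((J 1 (RtoC t ^ 2 * e t) - (1 / 3 + -1 / 30 * (RtoC t ^ 2 * e t)))
               * YD 1 (RtoC t ^ 2 * eb))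
    + e t * (1 / 3 * (YD 1 (RtoC t ^ 2 * eb) - (1 + -1 / 2 * (RtoC t ^ 2 * eb))))
    + e t * (-1 / 30 * (RtoC t ^ 2 * e t)
              * (YD 1 (RtoC t ^ 2 * eb) - (1 + -1 / 2 * (RtoC t ^ 2 * eb))))
    + e t * (1 / 60 * (RtoC t ^ 4 * e t * eb))
    + Ci * s ^ 3 * eb * RtoC t ^ 3 * ((JD 1 (RtoC t ^ 2 * e t) - 2 / 3) * J 1 (RtoC t ^ 2 * eb))
    + Ci * s ^ 3 * eb * RtoC t ^ 3 * (2 / 3 * (J 1 (RtoC t ^ 2 * eb) - 1 / 3))
    - Ci * s ^ 3 * e t * RtoC t ^ 3 * ((J 1 (RtoC t ^ 2 * e t) - 1 / 3) * JD 1 (RtoC t ^ 2 * eb))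
    - Ci * s ^ 3 * e t * RtoC t ^ 3 * (1 / 3 * (JD 1 (RtoC t ^ 2 * eb) - 2 / 3))))).
  - exists r; split; [assumption|]; intros t Ht; specialize (HF t Ht).
    change (ep (RtoC t)) with (e t) in HF.
    match goal with |- ?X = _ =>
      transitivity (X - denomF 1 eb (RtoC t) (e t)); [rewrite HF; ring|] end.
    unfold denomF; fold s.
    replace (RtoC ((2 * INR 1 + 1) / INR 1)) with (RtoC 3)
      by (f_equal; simpl; field).
    simpl (2 * 1 + 1)%nat; rewrite Cpow_mult_l.
    Cfield.
  - apply (Oat_mult 0 4); [apply Oat_const|]; solve_Oat. }

assert (Hu : Oat 2 (fun t => e t + 2 * eb)).
{ eapply Oat_ext; [|apply (Oat_minus 2 _ (fun t =>
    RtoC t ^ 2 * (eb * eb) - RtoC t ^ 2 * (9 / 10 * e t * eb)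
    - RtoC t ^ 2 * (1 / 10 * e t * e t)
    + RtoC t ^ 3 * (Ci * s ^ 3 * (2 / 3) * eb)
    - RtoC t ^ 3 * (Ci * s ^ 3 * (2 / 3) * e t)) (Oat_weaken 4 2 _ E1 ltac:(lia))); solve_Oat].
  exists 1%R; split; [lra|]; intros t _; Cfield. }
assert (Hs : s * s = eb) by apply Csqrt_sq.
(* Put [e = -2 eb + u] with [u = O(t^2)]. The [t^2] coefficient becomes
   [12/5 eb^2 - 1/2 eb u - u^2/10] and the bracket [eb - e] becomes [3 eb - u]; the added lines
   cancel the parts containing [u], all of order 4 or higher. *)
apply (Oat_ext 4 (fun t => ((e t + 2 * eb)
   + RtoC t ^ 2 * (eb ^ 2 - 9 / 10 * e t * eb - e t ^ 2 / 10)
   + RtoC t ^ 3 * (Ci * s ^ 3 * (2 / 3) * (eb - e t)))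
   + RtoC t ^ 2 * (1 / 2 * eb * (e t + 2 * eb))
   + RtoC t ^ 2 * (1 / 10 * (e t + 2 * eb) * (e t + 2 * eb))
   + RtoC t ^ 3 * (Ci * s ^ 3 * (2 / 3) * (e t + 2 * eb)))).
- exists 1%R; split; [lra|]; intros t _; fold s.
  change (ep (RtoC t)) with (e t); rewrite <- Hs; Cfield.
- apply Oat_plus; [apply Oat_plus; [apply Oat_plus; [exact E1|]|]|]; solve_Oat.
Qed.

Lemma quadrupole_expansion (eb : C) (f : C * C -> C) (ep : C -> C) :
  eb <> 0 -> is_mie_denom_extension 2 eb f -> is_plasmonic_singularity 2 eb f ep ->
  Oat 6 (fun t => ep (RtoC t) - (- (3 / 2) * eb - 5 / 14 * eb ^ 2 * RtoC t ^ 2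
    - 65 / 392 * eb ^ 3 * RtoC t ^ 4 - Ci / 12 * eb ^ 3 * Csqrt eb * RtoC t ^ 5)).
Proof.
intros Heb Hf Hep.
assert (He := Oat_ep 2 eb f ep Hep).
set (e := fun t : R => ep (RtoC t)).
change (Oat 0 e) in He.
set (v := fun _ : R => eb); assert (Hv : Oat 0 v) by apply Oat_const.
destruct coef2_values as (A0 & A1 & A2 & D0 & D1 & D2 & Y0 & Y1 & Y2 & YD0 & YD1 & YD2).
assert (HJ := Oat_entire_3 _ e (jcoef_entire 2) He); rewrite A0, A1, A2 in HJ.
assert (HJD := Oat_entire_3 _ e (jdcoef_entire 2) He); rewrite D0, D1, D2 in HJD.
assert (HY := Oat_entire_3 _ v (ycoef_entire 2) Hv); rewrite Y0, Y1, Y2 in HY.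
assert (HYD := Oat_entire_3 _ v (ydcoef_entire 2) Hv); rewrite YD0, YD1, YD2 in HYD.
assert (KJ := Oat_entire_1 _ e (jcoef_entire 2) He); rewrite A0 in KJ.
assert (KJD := Oat_entire_1 _ e (jdcoef_entire 2) He); rewrite D0 in KJD.
assert (LJ := Oat_entire_1 _ v (jcoef_entire 2) Hv); rewrite A0 in LJ.
assert (LJD := Oat_entire_1 _ v (jdcoef_entire 2) Hv); rewrite D0 in LJD.
assert (BY := Oat_entire_fun _ v (ycoef_entire 2) Hv).
assert (BYD := Oat_entire_fun _ v (ydcoef_entire 2) Hv).
assert (BJ := Oat_entire_fun _ v (jcoef_entire 2) Hv).
assert (BJD := Oat_entire_fun _ v (jdcoef_entire 2) Hv).
clear A0 A1 A2 D0 D1 D2 Y0 Y1 Y2 YD0 YD1 YD2.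
change (entire_fun (jcoef 2)) with (J 2) in *.
change (entire_fun (jdcoef 2)) with (JD 2) in *.
change (entire_fun (ycoef 2)) with (Y 2) in *.
change (entire_fun (ydcoef 2)) with (YD 2) in *.
unfold v in *; rewrite !RtoC_Rdiv in * by discriminate.
destruct (denomF_pole_zero 2 eb f ep ltac:(lia) Heb Hf Hep) as (r & Hr & HF).
set (s := Csqrt eb).
assert (E1 : Oat 6 (fun t => (e t + 3 / 2 * eb)
   + RtoC t ^ 2 * (eb ^ 2 / 4 - 5 / 28 * e t * eb - e t ^ 2 / 14)
   + RtoC t ^ 4 * (eb ^ 3 / 16 - e t * eb ^ 2 / 14 + e t ^ 2 * eb / 144 + e t ^ 3 / 504)
   + RtoC t ^ 5 * (Ci * s ^ 5 * (1 / 30) * (eb - e t)))).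
(* Same splitting with prefactor [5/2]; the explicit [t^6] and [t^8] terms are the cross terms
   beyond the truncation. One of them is missing because [ydcoef 2 1 = 0]. *)
{ apply (Oat_ext 6 (fun t => - (5 / 2) * (
    - eb * ((JD 2 (RtoC t ^ 2 * e t)
              - (1 / 5 + -1 / 42 * (RtoC t ^ 2 * e t) + 1 / 1080 * (RtoC t ^ 2 * e t) ^ 2))
               * Y 2 (RtoC t ^ 2 * eb))
    - eb * (1 / 5 * (Y 2 (RtoC t ^ 2 * eb)
              - (-3 + -1 / 2 * (RtoC t ^ 2 * eb) + -1 / 8 * (RtoC t ^ 2 * eb) ^ 2)))
    - eb * (-1 / 42 * (RtoC t ^ 2 * e t) * (Y 2 (RtoC t ^ 2 * eb)
              - (-3 + -1 / 2 * (RtoC t ^ 2 * eb) + -1 / 8 * (RtoC t ^ 2 * eb) ^ 2)))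
    - eb * (1 / 1080 * (RtoC t ^ 4 * e t * e t) * (Y 2 (RtoC t ^ 2 * eb)
              - (-3 + -1 / 2 * (RtoC t ^ 2 * eb) + -1 / 8 * (RtoC t ^ 2 * eb) ^ 2)))
    - eb * (1 / 336 * (RtoC t ^ 6 * e t * eb * eb))
    + eb * (1 / 2160 * (RtoC t ^ 6 * e t * e t * eb))
    + eb * (1 / 8640 * (RtoC t ^ 8 * e t * e t * eb * eb))
    + e t * ((J 2 (RtoC t ^ 2 * e t)
              - (1 / 15 + -1 / 210 * (RtoC t ^ 2 * e t) + 1 / 7560 * (RtoC t ^ 2 * e t) ^ 2))
               * YD 2 (RtoC t ^ 2 * eb))
    + e t * (1 / 15 * (YD 2 (RtoC t ^ 2 * eb)
              - (6 + 0 * (RtoC t ^ 2 * eb) + -1 / 4 * (RtoC t ^ 2 * eb) ^ 2)))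
    + e t * (-1 / 210 * (RtoC t ^ 2 * e t) * (YD 2 (RtoC t ^ 2 * eb)
              - (6 + 0 * (RtoC t ^ 2 * eb) + -1 / 4 * (RtoC t ^ 2 * eb) ^ 2)))
    + e t * (1 / 7560 * (RtoC t ^ 4 * e t * e t) * (YD 2 (RtoC t ^ 2 * eb)
              - (6 + 0 * (RtoC t ^ 2 * eb) + -1 / 4 * (RtoC t ^ 2 * eb) ^ 2)))
    + e t * (1 / 840 * (RtoC t ^ 6 * e t * eb * eb))
    - e t * (1 / 30240 * (RtoC t ^ 8 * e t * e t * eb * eb))
    + Ci * s ^ 5 * eb * RtoC t ^ 5 * ((JD 2 (RtoC t ^ 2 * e t) - 1 / 5) * J 2 (RtoC t ^ 2 * eb))
    + Ci * s ^ 5 * eb * RtoC t ^ 5 * (1 / 5 * (J 2 (RtoC t ^ 2 * eb) - 1 / 15))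
    - Ci * s ^ 5 * e t * RtoC t ^ 5 * ((J 2 (RtoC t ^ 2 * e t) - 1 / 15) * JD 2 (RtoC t ^ 2 * eb))
    - Ci * s ^ 5 * e t * RtoC t ^ 5 * (1 / 15 * (JD 2 (RtoC t ^ 2 * eb) - 1 / 5))))).
  - exists r; split; [assumption|]; intros t Ht; specialize (HF t Ht).
    change (ep (RtoC t)) with (e t) in HF.
    match goal with |- ?X = _ =>
      transitivity (X - denomF 2 eb (RtoC t) (e t)); [rewrite HF; ring|] end.
    unfold denomF; fold s.
    replace (RtoC ((2 * INR 2 + 1) / INR 2)) with (5 / 2)
      by (rewrite <- RtoC_Rdiv by discriminate; f_equal; simpl; field).
    simpl (2 * 2 + 1)%nat; rewrite Cpow_mult_l.
    Cfield.
  - apply (Oat_mult 0 6); [apply Oat_const|]; solve_Oat. }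
assert (Hu : Oat 2 (fun t => e t + 3 / 2 * eb)).
{ eapply Oat_ext; [|apply (Oat_minus 2 _ (fun t =>
    RtoC t ^ 2 * (1 / 4 * eb * eb) - RtoC t ^ 2 * (5 / 28 * e t * eb)
    - RtoC t ^ 2 * (1 / 14 * e t * e t)
    + RtoC t ^ 4 * (1 / 16 * eb * eb * eb) - RtoC t ^ 4 * (1 / 14 * e t * eb * eb)
    + RtoC t ^ 4 * (1 / 144 * e t * e t * eb) + RtoC t ^ 4 * (1 / 504 * e t * e t * e t)
    + RtoC t ^ 5 * (Ci * s ^ 5 * (1 / 30) * eb)
    - RtoC t ^ 5 * (Ci * s ^ 5 * (1 / 30) * e t)) (Oat_weaken 6 2 _ E1 ltac:(lia))); solve_Oat].
  exists 1%R; split; [lra|]; intros t _; Cfield. }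
(* A second substitution is needed: for [e = -3/2 eb + u] the [t^2] coefficient is
   [5/14 eb^2 + 1/28 eb u - u^2/14], so the [t^2] part of [u] feeds into order 4. The result is
   [65/392 = 5/28 - 5/392], where [5/28] is the [t^4] coefficient at the static pole. *)
assert (Hu4 : Oat 4 (fun t => e t + 3 / 2 * eb + 5 / 14 * eb ^ 2 * RtoC t ^ 2)).
{ eapply Oat_ext; [|apply (Oat_minus 4 _ (fun t =>
    RtoC t ^ 2 * (1 / 28 * eb * (e t + 3 / 2 * eb))
    - RtoC t ^ 2 * (1 / 14 * (e t + 3 / 2 * eb) * (e t + 3 / 2 * eb))
    + RtoC t ^ 4 * (1 / 16 * eb * eb * eb) - RtoC t ^ 4 * (1 / 14 * e t * eb * eb)
    + RtoC t ^ 4 * (1 / 144 * e t * e t * eb) + RtoC t ^ 4 * (1 / 504 * e t * e t * e t)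
    + RtoC t ^ 5 * (Ci * s ^ 5 * (1 / 30) * eb)
    - RtoC t ^ 5 * (Ci * s ^ 5 * (1 / 30) * e t)) (Oat_weaken 6 4 _ E1 ltac:(lia))); solve_Oat].
  exists 1%R; split; [lra|]; intros t _; Cfield. }
assert (Hs : s * s = eb) by apply Csqrt_sq.
(* The [t^4] corrections replace [e], [e^2] and [e^3] by their static values, the differences of
   powers being factored through [e + 3/2 eb]. *)
apply (Oat_ext 6 (fun t => ((e t + 3 / 2 * eb)
   + RtoC t ^ 2 * (eb ^ 2 / 4 - 5 / 28 * e t * eb - e t ^ 2 / 14)
   + RtoC t ^ 4 * (eb ^ 3 / 16 - e t * eb ^ 2 / 14 + e t ^ 2 * eb / 144 + e t ^ 3 / 504)
   + RtoC t ^ 5 * (Ci * s ^ 5 * (1 / 30) * (eb - e t)))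
   - RtoC t ^ 2 * (1 / 28 * eb * (e t + 3 / 2 * eb + 5 / 14 * eb ^ 2 * RtoC t ^ 2))
   + RtoC t ^ 2 * (1 / 14 * (e t + 3 / 2 * eb) * (e t + 3 / 2 * eb))
   + RtoC t ^ 4 * (1 / 14 * eb * eb * (e t + 3 / 2 * eb))
   - RtoC t ^ 4 * (1 / 144 * eb * e t * (e t + 3 / 2 * eb))
   + RtoC t ^ 4 * (1 / 144 * (3 / 2) * eb * eb * (e t + 3 / 2 * eb))
   - RtoC t ^ 4 * (1 / 504 * e t * e t * (e t + 3 / 2 * eb))
   + RtoC t ^ 4 * (1 / 504 * (3 / 2) * eb * e t * (e t + 3 / 2 * eb))
   - RtoC t ^ 4 * (1 / 504 * (9 / 4) * eb * eb * (e t + 3 / 2 * eb))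
   + RtoC t ^ 5 * (Ci * s ^ 5 * (1 / 30) * (e t + 3 / 2 * eb)))).
- exists 1%R; split; [lra|]; intros t _; fold s.
  change (ep (RtoC t)) with (e t); rewrite <- Hs; Cfield.
- repeat first [exact E1 | apply Oat_minus; [|solve_Oat] | apply Oat_plus; [|solve_Oat]].
Qed.

(** For [Im z > 0] conjugation switches the sign chosen in [Csqrt]. On the real axis the sign does
    not switch, but off the cut [z] is then positive and its root has imaginary part 0. *)
Lemma Csqrt_conj (z : C) : off_cut z -> (0 <= Im z)%R -> Csqrt (Cconj z) = Cconj (Csqrt z).
Proof.
intros Hz Hi; unfold Csqrt; rewrite Cmod_conj, re_conj, im_conj.
apply injective_projections; simpl; [reflexivity|].
destruct (Rle_dec 0 (Im z)) as [_|]; [|contradiction].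
destruct (Rle_dec 0 (- Im z)) as [H|H]; [|ring].
assert (Hi0 : Im z = 0%R) by lra.
assert (Hr : (0 < Re z)%R).
{ destruct (Rlt_dec 0 (Re z)); [assumption|]; exfalso; apply Hz; lra. }
assert (Hm : Cmod z = Re z).
{ pose proof (Cmod_sq z) as Hq; rewrite Hi0 in Hq; pose proof (Cmod_ge_0 z); nra. }
rewrite Hm; replace ((Re z - Re z) / 2)%R with 0%R by lra; rewrite sqrt_0; ring.
Qed.

Lemma bigO_pow_conj (n : nat) (g h : R -> C) :
  (forall t, h t = Cconj (g t)) -> Oat n g -> bigO_pow h n.
Proof.
intros E (r & M & Hr & HM & H); exists M; apply at_right_0_intro.
exists r; split; [lra|]; intros t Ht; rewrite E, Cmod_conj; now apply H.
Qed.

Lemma Cconj_RtoC (x : R) : Cconj (RtoC x) = RtoC x.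
Proof. apply injective_projections; simpl; ring. Qed.

Lemma Cconj_Ci : Cconj Ci = - Ci.
Proof. apply injective_projections; simpl; ring. Qed.

Theorem mainTheorem5
  (l : nat) (eb : C) (f : C * C -> C) (ep : C -> C)
  (hl : (1 <= l)%nat)
  (heb_cut : off_cut eb)
  (heb_im : (0 <= Im eb)%R)
  (hf : is_mie_denom_extension l eb f)
  (hep : is_plasmonic_singularity l eb f ep) :
  (* (i) for each fixed eps, and uniformly for bounded eps *)
  ((forall eps : C, passive eps ->
      is_equiv (at_right 0)
        (fun k0a : R => Qabs l eb k0a eps)
        (fun k0a : R => Qabs_approx l eb (ep (RtoC k0a)) k0a eps)) /\
   (forall B eta : R, (0 < eta)%R ->
      at_right 0 (fun k0a : R =>
        forall eps : C, passive eps -> (Cmod eps <= B)%R ->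
          (Rabs (Qabs l eb k0a eps
                 - Qabs_approx l eb (ep (RtoC k0a)) k0a eps)
           <= eta * Rabs (Qabs_approx l eb (ep (RtoC k0a)) k0a eps))%R)))
  /\
  (* (ii) *)
  ((forall k0a : R, (0 < k0a)%R ->
      exists c : R, (0 < c)%R /\
        forall eps : C,
          Qabs_approx l eb (ep (RtoC k0a)) k0a eps
          = (c * abs_profile (ep (RtoC k0a)) eps)%R) /\
   at_right 0 (fun k0a : R =>
      is_local_max_on (fun eps => (0 < Im eps)%R)
        (abs_profile (ep (RtoC k0a))) (eps_opt ep k0a)) /\
   (forall B eta : R,
      (Cmod (static_pole l eb) < B)%R -> (0 < eta)%R ->
      at_right 0 (fun k0a : R =>
        let D := fun eps => passive eps /\ (Cmod eps <= B)%R in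
        (exists eps, is_max_on D (Qabs l eb k0a) eps) /\
        (forall eps, is_max_on D (Qabs l eb k0a) eps ->
           (Cmod (eps - eps_opt ep k0a) <= eta * Im (eps_opt ep k0a))%R))))
  /\
  (* (iii) *)
  ((l = 1%nat ->
      bigO_pow (fun k0a : R =>
        let z := RtoC k0a in
        let ebc := Cconj eb in
        eps_opt ep k0a
        - (- 2 * ebc - 12 / 5 * ebc ^ 2 * z ^ 2
           + 2 * Ci * ebc ^ 2 * Csqrt ebc * z ^ 3)) 4) /\
   (l = 2%nat ->
      bigO_pow (fun k0a : R =>
        let z := RtoC k0a in
        let ebc := Cconj eb in
        eps_opt ep k0a
        - (- (3 / 2) * ebc - 5 / 14 * ebc ^ 2 * z ^ 2
           - 65 / 392 * ebc ^ 3 * z ^ 4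
           + Ci / 12 * ebc ^ 3 * Csqrt ebc * z ^ 5)) 6)).
Proof.
assert (Heb := off_cut_neq_0 eb heb_cut).
assert (HU : forall B eta : R, (0 < eta)%R -> at_right 0 (fun k0a : R =>
  forall eps : C, passive eps -> (Cmod eps <= B)%R ->
    (Rabs (Qabs l eb k0a eps - Qabs_approx l eb (ep (RtoC k0a)) k0a eps)
     <= eta * Rabs (Qabs_approx l eb (ep (RtoC k0a)) k0a eps))%R)).
{ intros B eta Heta; apply at_right_0_intro.
  destruct (Qabs_uniform l eb f ep hl heb_cut hf hep B eta Heta) as (r & Hr & H).
  exists r; split; [assumption|]; intros t Ht e He HeB.
  eapply Rle_trans; [now apply H|].
  apply Rmult_le_compat_l; [lra | apply Rle_abs]. }
split; [split; [|exact HU]|split].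
- intros eps Heps eta.
  apply (filter_imp (F := at_right 0)) with (2 := HU (Cmod eps) eta (cond_pos eta)).
  intros t H; specialize (H eps Heps (Rle_refl _)).
  change (Rabs (Qabs_approx l eb (ep (RtoC t)) t eps - Qabs l eb t eps)
    <= eta * Rabs (Qabs_approx l eb (ep (RtoC t)) t eps))%R.
  now rewrite Rabs_minus_sym.
- split; [|split].
  + intros t Ht; exists (absK l eb t * absN0 l)%R; split.
    * apply Rmult_lt_0_compat; [now apply absK_pos | apply absN0_pos].
    * intros eps; now apply Qabs_approx_eq.
  + apply at_right_0_intro.
    destruct (Im_pole_neg l eb f ep hl heb_cut heb_im hf hep) as (r & Hr & H).
    exists r; split; [assumption|]; intros t Ht; specialize (H t Ht).
    unfold eps_opt; split; [rewrite im_conj; lra|].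
    (* The radius is arbitrary: the profile is maximal over the whole upper half-plane. *)
    exists (mkposreal 1 Rlt_0_1); intros y _ Hy; apply abs_profile_max; lra.
  + intros B eta HB Heta; apply at_right_0_intro.
    exact (Qabs_max l eb f ep hl heb_cut heb_im hf hep B eta HB Heta).
- assert (Hconj := Csqrt_conj eb heb_cut heb_im).
  split; intros El; subst l.
  + eapply bigO_pow_conj; [|exact (dipole_expansion eb f ep Heb hf hep)].
    intros t; cbv zeta; unfold eps_opt; rewrite Hconj.
    unfold Cdiv; rewrite <- !RtoC_inv by lra.
    rewrite !Cminus_conj, !Cmult_conj, !Cpow_conj, !Cconj_RtoC, Cconj_Ci.
    ring.
  + eapply bigO_pow_conj; [|exact (quadrupole_expansion eb f ep Heb hf hep)].
    intros t; cbv zeta; unfold eps_opt; rewrite Hconj.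
    unfold Cdiv; rewrite <- !RtoC_inv by lra.
    rewrite !Cminus_conj, !Cmult_conj, !Copp_conj, !Cmult_conj, !Cpow_conj,
      !Cconj_RtoC, Cconj_Ci.
    ring.
Qed.
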